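(* Let $M$ be a compact Riemannian manifold, let $\omega$ be a Dini summable modulus of continuity, let $f:M\to M$ be a $C^{1,\omega}$ diffeomorphism, and let $\Lambda\subset M$ be a compact $f$-invariant hyperbolic set whose unstable distribution $E^u$ has constant dimension $q$. Then the unstable distribution $x\mapsto E^u_x$ has a Dini summable modulus of continuity on $\Lambda$: there are a Dini summable modulus of continuity $\omega'$ and a constant $C>0$ such that $$d_{grass}(E^u_x,E^u_y)\le C\,\omega'\big(d(x,y)\big)\qquad\text{for all }x,y\in\Lambda .$$
   Context: A modulus of continuity is a continuous, increasing, concave map $\omega:\mathbb{R}_+\to\mathbb{R}_+$ with $\omega(0)=0$. It is Dini summable if $\int_0^1\frac{\omega(t)}{t}\,dt<+\infty$. A $C^1$ diffeomorphism $f$ is $C^{1,\omega}$ if there is $C>0$ with $\|df_x-df_y\|\le C\,\omega(d(x,y))$ for all $x,y\in M$ (the difference being understood, e.g., in a fixed finite smooth atlas). A closed $f$-invariant set $\Lambda$ is hyperbolic if there are $C>0$, $\lambda\in(0,1)$ and a $df$-invariant splitting $T_xM=E^u_x\oplus E^s_x$, $x\in\Lambda$, such that $\|df^n v\|\le C\lambda^n\|v\|$ for $v\in E^s_x$, $n\in\mathbb{N}$, and $\|df^{-n}v\|\le C\lambda^n\|v\|$ for $v\in E^u_x$, $n\in\mathbb{N}$. The distribution $x\mapsto E^u_x$ is viewed as a section over $\Lambda$ of the Grassmannian bundle $G^q(M)=\bigsqcup_{x\in M}G(q,T_xM)$, and $d_{grass}$ denotes the distance on $G^q(M)$ coming from a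 Riemannian metric on this compact manifold. *)

(* Defs.v *)
From mathcomp Require Import all_boot all_order all_algebra.
From mathcomp Require Import all_classical all_reals all_analysis.

Set Implicit Arguments.
Unset Strict Implicit.
Unset Printing Implicit Defensive.

Import Order.TTheory GRing.Theory Num.Theory.
Import numFieldNormedType.Exports.

Local Open Scope classical_set_scope.
Local Open Scope ring_scope.

Section Calculus.
Context {R : realType} {E F : normedModType R}.

(* For finite-dimensional [E] and open [U] this is the usual class C^k on U. *)
Fixpoint Ck (k : nat) (U : set E) (f : E -> F) : Prop :=
  if k is k'.+1 then
    (forall y, U y -> differentiable f y) /\
    (forall v, Ck k' U (fun y => 'D_v f y))
  else forall y, U y -> {for y, continuous f}.

Definition smooth (U : set E) (f : E -> F) : Prop := forall k, Ck k U f.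

End Calculus.

(* Points of R_+ are the nonnegative elements of R; values of [w] on negative
   reals are irrelevant. *)
Definition modulus_of_continuity {R : realType} (w : R -> R) : Prop :=
  [/\ w 0 = 0,
      forall t, 0 <= t -> 0 <= w t,
      {within `[0, +oo[, continuous w},
      forall s t, 0 <= s -> s < t -> w s < w t &
      forall s t a, 0 <= s -> 0 <= t -> 0 <= a -> a <= 1 ->
        a * w s + (1 - a) * w t <= w (a * s + (1 - a) * t)].

Definition Dini_summable {R : realType} (w : R -> R) : Prop :=
  (\int[lebesgue_measure]_(t in `]0%R, 1%R]) (w t / t)%:E < +oo)%E.

(* [w] evaluated at an extended distance: the distance between points in
   different connected components is [+oo], and so is its modulus. *)
Definition modulus_at {R : realType} (w : R -> R) (d : \bar R) : \bar R :=
  if d is r%:E%E then (w r)%:E%E else +oo%E.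

(* A chart is a partial bijection between [chart_dom] and its image in the model
   space, given by two total functions that are only meaningful there. *)
Record chart (X E : Type) := Chart {
  chart_dom : set X;
  chart_map : X -> E;
  chart_inv : E -> X }.

(* [chart_at x] is a preferred chart at [x]; it identifies the tangent space
   at [x] with the model space [E]. *)
Record charted (X E : Type) := Charted {
  atlas : set (chart X E);
  chart_at : X -> chart X E }.

Definition chart_image X E (e : chart X E) (U : set X) : set E :=
  chart_map e @` (chart_dom e `&` U).

Section Manifolds.
Context {R : realType} {E : normedModType R}.

Definition topological_chart (M : topologicalType) (e : chart M E) : Prop :=
  [/\ open (chart_dom e),
      open (chart_image e setT),
      forall x, chart_dom e x -> chart_inv e (chart_map e x) = x,
      {within chart_dom e, continuous (chart_map e)} &
      {within chart_image e setT, continuous (chart_inv e)}].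

Definition smooth_atlas (M : topologicalType) (A : set (chart M E)) : Prop :=
  [/\ forall e, A e -> topological_chart e,
      forall x, exists2 e, A e & chart_dom e x &
      forall e e', A e -> A e' ->
        smooth (chart_image e (chart_dom e')) (chart_map e' \o chart_inv e)].

Definition smooth_manifold (M : topologicalType) (S : charted M E) : Prop :=
  smooth_atlas (atlas S) /\
  forall x, atlas S (chart_at S x) /\ chart_dom (chart_at S x) x.

Definition in_charts X (e e' : chart X E) (f : X -> X) : E -> E :=
  chart_map e' \o f \o chart_inv e.

Definition tangent_map X (S : charted X E) (f : X -> X) (x : X) : E -> E :=
  let e := chart_at S x in
  'd (in_charts e (chart_at S (f x)) f) (chart_map e x).

(* The isomorphism T_xX -> E given by the differential at [x] of the chart [e],
   and its inverse. *)
Definition to_chart X (S : charted X E) (e : chart X E) (x : X) : E -> E :=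
  let e0 := chart_at S x in
  'd (chart_map e \o chart_inv e0) (chart_map e0 x).

Definition of_chart X (S : charted X E) (e : chart X E) (x : X) : E -> E :=
  'd (chart_map (chart_at S x) \o chart_inv e) (chart_map e x).

Definition C1_map (M : topologicalType) (S : charted M E) (f : M -> M) : Prop :=
  continuous f /\
  forall e e', atlas S e -> atlas S e' ->
    Ck 1 (chart_image e (f @^-1` chart_dom e')) (in_charts e e' f).

Definition C1_diffeomorphism (M : topologicalType) (S : charted M E)
    (f finv : M -> M) : Prop :=
  [/\ cancel f finv, cancel finv f, C1_map S f & C1_map S finv].

Definition riemannian_metric X (S : charted X E) (g : X -> E -> E -> R) : Prop :=
  [/\ forall x a u v w, g x (a *: u + v) w = a * g x u w + g x v w,
      forall x u v, g x u v = g x v u,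
      forall x v, v != 0 -> 0 < g x v v &
      forall e, atlas S e -> forall u v,
        smooth (chart_image e setT)
          (fun y => let x := chart_inv e y in
             g x (of_chart S e x u) (of_chart S e x v))].

Definition rnorm X (g : X -> E -> E -> R) (x : X) (v : E) : R :=
  Num.sqrt (g x v v).

Definition velocity X (S : charted X E) (c : R -> X) (t : R) : E :=
  derive1 (chart_map (chart_at S (c t)) \o c) t.

Definition C1_curve X (S : charted X E) (c : R -> X) : Prop :=
  forall t, t \in `[0, 1] ->
    let e := chart_at S (c t) in
    [/\ \forall s \near t, chart_dom e (c s),
        \forall s \near t, derivable (chart_map e \o c) s 1 &
        {for t, continuous (derive1 (chart_map e \o c))}].

Definition curve_length X (S : charted X E) (g : X -> E -> E -> R)
    (c : R -> X) : \bar R :=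
  (\int[lebesgue_measure]_(t in `[0%R, 1%R])
     (rnorm g (c t) (velocity S c t))%:E)%E.

(* [C1_curve] only constrains [c] near [0, 1], so a C^1 curve on [0, 1] is seen
   through a C^1 extension to a slightly larger interval.
   Piecewise C^1 paths, as finite concatenations of C^1 curves on [0, 1]. *)
Fixpoint piecewise_C1 X (S : charted X E) (x : X) (p : seq (R -> X)) (y : X) :
    Prop :=
  if p is c :: p' then
    [/\ C1_curve S c, c 0 = x & piecewise_C1 S (c 1) p' y]
  else x = y.

Definition rdist X (S : charted X E) (g : X -> E -> E -> R) (x y : X) : \bar R :=
  ereal_inf [set (\sum_(c <- p) curve_length S g c)%E |
              p in [set p | piecewise_C1 S x p y]].

(* Regularity of the differential read in some finite smooth atlas [A],
   compatible with the smooth structure of M. The atlas cannot be arbitrary: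
   derivatives of transition maps may blow up near the boundary of the charts.
   Two atlases for which the bound holds give the same local regularity. *)
Definition C1_modulus (M : topologicalType) (S : charted M E)
    (g : M -> E -> E -> R) (w : R -> R) (f : M -> M) : Prop :=
  exists A : set (chart M E),
    [/\ finite_set A, smooth_atlas A, smooth_atlas (atlas S `|` A) &
    exists2 C : R, 0 < C &
      forall e e', A e -> A e' -> forall x y,
        chart_dom e x -> chart_dom e y -> chart_dom e' (f x) ->
        chart_dom e' (f y) -> forall v : E,
        (`| 'd (in_charts e e' f) (chart_map e x) v -
            'd (in_charts e e' f) (chart_map e y) v |%:E
         <= C%:E * modulus_at w (rdist S g x y) * `|v|%:E)%E].

End Manifolds.

Section Hyperbolicity.
Context {R : realType} {n : nat}.

Definition hyperbolic_set (M : topologicalType) (S : charted M 'rV[R]_n)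
    (g : M -> 'rV[R]_n -> 'rV[R]_n -> R) (f finv : M -> M) (L : set M)
    (Eu Es : M -> {vspace 'rV[R]_n}) : Prop :=
  [/\ closed L, f @` L = L,
      forall x, L x -> (Eu x + Es x)%VS = fullv /\ (Eu x :&: Es x)%VS = 0%VS,
      forall x, L x ->
        (linfun (tangent_map S f x) @: Eu x)%VS = Eu (f x) /\
        (linfun (tangent_map S f x) @: Es x)%VS = Es (f x) &
      exists C lam : R, [/\ 0 < C, 0 < lam, lam < 1 &
        forall x, L x -> forall (k : nat) (v : 'rV[R]_n),
          (v \in Es x ->
             rnorm g (iter k f x) (tangent_map S (iter k f) x v)
             <= C * lam ^+ k * rnorm g x v) /\
          (v \in Eu x ->
             rnorm g (iter k finv x) (tangent_map S (iter k finv) x v)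
             <= C * lam ^+ k * rnorm g x v)]].

End Hyperbolicity.

Section Grassmannian.
Context {R : realType} {n : nat}.

Definition row_space q (A : 'M[R]_(q, n)) : {vspace 'rV[R]_n} :=
  limg (linfun (mulmxr A : 'rV[R]_q -> 'rV[R]_n)).

(* The rows of [P] and [Q] together form a basis of R^n. The q-planes
   transverse to the row space of [Q] are the row spaces of [P + X *m Q], for a
   unique [X], which is their coordinate in the affine chart of G(q, R^n)
   given by [P] and [Q]. *)
Definition in_affine_chart q r (P : 'M[R]_(q, n)) (Q : 'M[R]_(r, n))
    (V : {vspace 'rV[R]_n}) (X : 'M[R]_(q, r)) : Prop :=
  V = row_space (P + X *m Q).

(* A point of the Grassmannian bundle is a pair (x, V) with V a subspace of
   T_xM; G^q(M) consists of those with \dim V = q, which are the points covered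
   by these charts. Over a chart [e] of M, the plane [V] is first transported to
   R^n by the differential of [e], then read in an affine chart. *)
Definition grass_chart (M : Type) (S : charted M 'rV[R]_n) (q : nat)
    (e : chart M 'rV[R]_n) (P : 'M[R]_(q, n)) (Q : 'M[R]_(n - q, n)) :
    chart (M * {vspace 'rV[R]_n}) ('rV[R]_n * 'M[R]_(q, n - q))%type :=
  let plane (p : M * {vspace 'rV[R]_n}) :=
    (linfun (to_chart S e p.1) @: p.2)%VS in
  Chart
    [set p | [/\ chart_dom e p.1, \dim p.2 = q &
                 exists X, in_affine_chart P Q (plane p) X]]
    (fun p => (chart_map e p.1, xget 0 [set X | in_affine_chart P Q (plane p) X]))
    (fun yX => let x := chart_inv e yX.1 in
       (x, (linfun (of_chart S e x) @: row_space (P + yX.2 *m Q))%VS)).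

Definition vspace_rows q (V : {vspace 'rV[R]_n}) : 'M[R]_(q, n) :=
  \matrix_(i < q) (vbasis V)`_i.

(* The preferred chart at (x, V) is the one given by the preferred chart at x,
   a basis of V and a basis of a complement of V. *)
Definition grass_bundle (M : Type) (S : charted M 'rV[R]_n) (q : nat) :
    charted (M * {vspace 'rV[R]_n}) ('rV[R]_n * 'M[R]_(q, n - q))%type :=
  Charted
    [set c | exists e P Q, [/\ atlas S e, row_free (col_mx P Q) &
                               c = grass_chart S e P Q]]
    (fun p => grass_chart S (chart_at S p.1)
       (vspace_rows q p.2) (vspace_rows (n - q) (p.2 ^C)%VS)).

End Grassmannian.

(* Main.v *)
(* Let x, y be close points of L, with backward orbits x_k, y_k, and let T be the
   transport from T_yM to T_xM read in a chart of the finite atlas witnessing the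
   modulus w of df. For v in E^u_y with backward iterates v_k, the stable components
   s_k of T v_k satisfy s_k = df s_(k+1) + e_k, where e_k is the stable projection of
   the defect of T to commute with df, so |e_k| <= C w(d(x_k, y_k)) |v_(k+1)|. As f
   contracts e_k by lambda^k, |v_k| <= C lambda^k |v| and d(x_k, y_k) <= K^k d(x, y),
   the stable component of T v is at most
   C (sum_k lambda^(2k) w(min(K^(k+1) d(x, y), 1))) |v|.
   This series is a modulus of continuity, Dini summable because replacing t by K t
   shifts the dyadic sum of w by finitely many bounded terms. No regularity of E^u is
   used beforehand, and the stable projections are uniformly bounded by hyperbolicity
   alone.
   A small stable component is then turned into a small distance in the Grassmannian
   bundle: by Cramer's rule every q-plane is the row space of P + X Q with |X| <= 1 for
   a coordinate splitting (P, Q), and segments in these boundedly many charts have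
   length bounded by their coordinate length. For points at finite distance at least
   r0 it suffices that the distance of any two q-planes over them is bounded, as one
   sees by chaining finitely many chart balls. *)
From HB Require Import structures.
Require Import Defs.
From mathcomp Require Import all_boot all_order all_algebra.
From mathcomp Require Import fingroup perm.
From mathcomp Require Import all_classical all_reals all_analysis.
From mathcomp Require Import measurable_realfun ring lra.

Set Implicit Arguments.
Unset Strict Implicit.
Unset Printing Implicit Defensive.

Import Order.TTheory GRing.Theory Num.Theory.
Import numFieldNormedType.Exports.
Local Open Scope classical_set_scope.
Local Open Scope ring_scope.

(** * C^1 maps and coordinates *)

(** The sum uses w(min(t, 1)) because K is only a Lipschitz constant of the inverse map and nothing
    makes lambda^2 K small: without the truncation the terms lambda^(2k) w(K^k t) may diverge. A
    dilation by K could lower the exponent of a Hoelder modulus, but for the Dini condition it costs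
    only a fixed number of dyadic scales. Distances are infima of lengths of paths. On M they are
    compared with chart coordinates from both sides, and the lower bound rests on the fact that a
    short path cannot leave a chart ball. On the bundle only upper bounds occur, obtained from
    segments in charts, so the bundle is never given a topology. The atlas witnessing the modulus of
    df may differ from the atlas of M. Local lemmas are therefore stated for an atlas [B] containing
    the latter; in the end [B] is the union of both. Transition maps are smooth, so a change of
    charts costs a Lipschitz term, absorbed by adding t to the new modulus. *)

Section NearEqDiff.
Context {R : realType} {V W : normedModType R}.

Lemma near_eq_differentiable (f g : V -> W) x :
  {near x, f =1 g} -> differentiable f x -> differentiable g x.
Proof.
move=> fg df.
have fgx : f x = g x := nbhs_singleton fg.
have [dfc /eqaddoP dfe] := (diff_locallyP _ _).1 df.
have dge : g \o shift x = cst (g x) + 'd f x +o_ 0 id.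
  apply/eqaddoP => e e0; have dfe' := dfe e e0.
  have fg0 : \forall y \near 0, f (y + x) = g (y + x).
    by move: fg; rewrite (near_shift 0) subr0.
  apply: filterS2 fg0 dfe' => y fgy.
  suff -> : (f \o shift x - (cst (f x) + 'd f x)) y =
            (g \o shift x - (cst (g x) + 'd f x)) y by [].
  by rewrite !fctE /= fgy fgx.
apply/diff_locallyP.
have E : 'd g x = 'd f x :> (V -> W) by apply: diff_unique.
by rewrite E.
Qed.

Lemma near_eq_diff (f g : V -> W) x :
  {near x, f =1 g} -> differentiable f x -> 'd g x = 'd f x :> (V -> W).
Proof.
move=> fg df; apply/funext => v.
rewrite -!deriveE //; last exact: near_eq_differentiable fg df.
by symmetry; apply: near_eq_derive.
Qed.

End NearEqDiff.

Lemma cvg_bigsum {R : realType} {W : normedModType R} (T : Type)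
    (F : set_system T) (I : Type) (s : seq I) (f : I -> T -> W) (l : I -> W) :
  Filter F -> (forall i, f i x @[x --> F] --> l i) ->
  (\sum_(i <- s) f i x) @[x --> F] --> \sum_(i <- s) l i.
Proof.
move=> FF fl; elim: s => [|i s IH].
  by rewrite big_nil; under eq_fun do rewrite big_nil; exact: cvg_cst.
by rewrite big_cons; under eq_fun do rewrite big_cons; exact: cvgD.
Qed.

Section Coordinates.
Context {R : realType}.

(** Finite dimension enters only through a finite basis whose coordinate functionals have norm at
    most 1. This covers at once the model space of M and that of the bundle, a product of row
    vectors and matrices. *)
Definition coordinates (E : normedModType R) (I : finType) (b : I -> E)
    (c : I -> E -> R) :=
  [/\ forall k a u v, c k (a *: u + v) = a * c k u + c k v,
      forall k u, `|c k u| <= `|u| &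
      forall u, u = \sum_k c k u *: b k].

Lemma coordinates_continuous (E : normedModType R) (I : finType) (b : I -> E)
    (c : I -> E -> R) k : coordinates b c -> continuous (c k).
Proof.
case=> lin bd _ z; apply/cvgrPdist_le => e e0; near=> y.
have -> : c k z - c k y = c k (z - y).
  by rewrite [z - y]addrC -[- y]scaleN1r lin mulN1r addrC.
apply: le_trans (bd _ _) _; near: y.
by apply/nbhs_ballP; exists e => //= y; rewrite -ball_normE /= => /ltW.
Unshelve. all: by end_near. Qed.

Lemma rV_coordinates n : coordinates (fun k : 'I_n => delta_mx 0 k : 'rV[R]_n)
  (fun k u => u 0 k).
Proof.
split=> [k a u v|k u|u]; first by rewrite !mxE.
  rewrite [leRHS]/Num.Def.normr/= mx_normrE.
  exact: (le_bigmax _ _ (0, k)).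
exact: row_sum_delta.
Qed.

Lemma prod_coordinates n q r : coordinates
  (fun k : 'I_n + 'I_q * 'I_r =>
     match k with inl i => (delta_mx 0 i, 0) | inr ij => (0, delta_mx ij.1 ij.2) end
     : ('rV[R]_n * 'M[R]_(q, r))%type)
  (fun k u => match k with inl i => u.1 0 i | inr ij => u.2 ij.1 ij.2 end).
Proof.
split=> [[i|[i j]] a [u1 u2] [v1 v2]|[i|[i j]] [u1 u2]|[u1 u2]] /=.
- by rewrite !mxE.
- by rewrite !mxE.
- rewrite prod_normE le_max; apply/orP; left.
  rewrite [leRHS]/Num.Def.normr/= mx_normrE.
  exact: (le_bigmax _ _ (0, i)).
- rewrite prod_normE le_max; apply/orP; right.
  rewrite [leRHS]/Num.Def.normr/= mx_normrE.
  exact: (le_bigmax _ _ (i, j)).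
- rewrite big_sumType /=.
  have fstsum (J : finType) (F : J -> ('rV[R]_n * 'M[R]_(q, r))%type) :
    \sum_k F k = (\sum_k (F k).1, \sum_k (F k).2).
    by elim/big_ind3 : _ => [|? ? ? ? ? ? -> ->|i _]//; case: (F i).
  rewrite !fstsum /=.
  rewrite [X in (_, X) + _]big1; last by move=> i _; rewrite scaler0.
  rewrite [X in _ + (X, _)]big1; last by move=> i _; rewrite scaler0.
  rewrite {1}(row_sum_delta u1) {1}(matrix_sum_delta u2) pair_bigA.
  by congr pair; rewrite /= ?addr0 ?add0r.
Qed.

End Coordinates.

Section C1.
Context {R : realType}.
Implicit Types E F G : normedModType R.

Lemma C1_diff E F (U : set E) (f : E -> F) y : Ck 1 U f -> U y -> differentiable f y.
Proof. by case=> + _; exact. Qed.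

Lemma C1_derive E F (U : set E) (f : E -> F) v y :
  Ck 1 U f -> U y -> {for y, continuous ('D_v f)}.
Proof. by case=> _ + Uy; move=> /(_ v y Uy). Qed.

Lemma C1_continuous E F (U : set E) (f : E -> F) y :
  Ck 1 U f -> U y -> {for y, continuous f}.
Proof. by move=> cf Uy; apply: differentiable_continuous; exact: C1_diff cf Uy. Qed.

Lemma C1_sub E F (U V : set E) (f : E -> F) : V `<=` U -> Ck 1 U f -> Ck 1 V f.
Proof.
by move=> VU [df cf]; split=> [y /VU|v y /VU]; [exact: df|exact: cf].
Qed.

Lemma C1_ext E F (U : set E) (f g : E -> F) : open U ->
  (forall y, U y -> f y = g y) -> Ck 1 U f -> Ck 1 U g.
Proof.
move=> oU fg [df cf].
have nfg y : U y -> {near y, f =1 g}.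
  by move=> Uy; have := open_nbhs_nbhs (conj oU Uy); apply: filterS => z /fg.
split=> [y Uy|v y Uy]; first exact: near_eq_differentiable (nfg y Uy) (df y Uy).
have e : {near y, 'D_v f =1 'D_v g}.
  have := open_nbhs_nbhs (conj oU Uy); apply: filterS => z /nfg nz.
  exact: near_eq_derive.
have := cf v y Uy; rewrite /prop_for /continuous_at.
rewrite (nbhs_singleton e); apply: cvg_trans; exact: near_eq_cvg.
Qed.

Lemma C1_cst E F (U : set E) (a : F) : Ck 1 U (cst a).
Proof.
split=> [y _|v y _]; first exact: differentiable_cst.
have -> : 'D_v (cst a : E -> F) = cst 0 by apply/funext => z; exact: derive_cst.
exact: cvg_cst.
Qed.

Lemma C1_linear E F (U : set E) (f : E -> F) : linear f -> continuous f -> Ck 1 U f.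
Proof.
move=> lf cf.
pose fM := GRing.isLinear.Build _ _ _ _ _ lf.
pose fL : {linear E -> F} := HB.pack f fM.
have cfL : continuous fL by [].
split=> [y _|v y _]; first exact: (@linear_differentiable _ _ _ fL).
have -> : 'D_v f = cst (f v).
  apply/funext => z; rewrite deriveE; last exact: (@linear_differentiable _ _ _ fL).
  by rewrite (@diff_lin _ _ _ fL).
exact: cvg_cst.
Qed.

Lemma diff_linear E F (f : E -> F) x v : linear f -> continuous f -> 'd f x v = f v.
Proof.
move=> lf cf; pose fM := GRing.isLinear.Build _ _ _ _ _ lf.
by pose fL : {linear E -> F} := HB.pack f fM; rewrite (@diff_lin _ _ _ fL).
Qed.

Lemma C1D E F (U : set E) (f g : E -> F) : Ck 1 U f -> Ck 1 U g ->
  open U -> Ck 1 U (fun y => f y + g y).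
Proof.
move=> [df cf] [dg cg] oU; split=> [y Uy|v y Uy].
  by apply: differentiableD; [exact: df|exact: dg].
have e : {near y, (fun z => 'D_v f z + 'D_v g z) =1 'D_v (fun z => f z + g z)}.
  have := open_nbhs_nbhs (conj oU Uy); apply: filterS => z Uz.
  by rewrite deriveD//; apply: diff_derivable; [exact: df|exact: dg].
rewrite /prop_for /continuous_at -(nbhs_singleton e).
by apply: cvg_trans (near_eq_cvg e) _; apply: cvgD; [exact: cf|exact: cg].
Qed.

Lemma C1M E (U : set E) (f g : E -> R) : Ck 1 U f -> Ck 1 U g ->
  open U -> Ck 1 U (fun y => f y * g y).
Proof.
move=> Cf Cg oU; have [df cf] := Cf; have [dg cg] := Cg.
split=> [y Uy|v y Uy].
  by apply: differentiableM; [exact: df|exact: dg].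
have e : {near y, (fun z => f z * 'D_v g z + g z * 'D_v f z) =1
                  'D_v (fun z => f z * g z)}.
  have := open_nbhs_nbhs (conj oU Uy); apply: filterS => z Uz.
  by rewrite deriveM//; apply: diff_derivable; [exact: df|exact: dg].
rewrite /prop_for /continuous_at -(nbhs_singleton e).
apply: cvg_trans (near_eq_cvg e) _; apply: cvgD; apply: cvgM.
- exact: C1_continuous Cf Uy.
- exact: cg.
- exact: C1_continuous Cg Uy.
- exact: cf.
Qed.

Lemma C1Zl E F (U : set E) (f : E -> R) (a : F) : Ck 1 U f ->
  open U -> Ck 1 U (fun y => f y *: a).
Proof.
move=> Cf oU; have [df cf] := Cf.
split=> [y Uy|v y Uy]; first by apply: differentiableZl; exact: df.
have e : {near y, (fun z => 'D_v f z *: a) =1 'D_v (fun z => f z *: a)}.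
  have := open_nbhs_nbhs (conj oU Uy); apply: filterS => z Uz.
  have dz := df z Uz.
  rewrite [RHS]deriveE//; last exact: differentiableZl.
  by rewrite diffZl// deriveE.
rewrite /prop_for /continuous_at -(nbhs_singleton e).
apply: cvg_trans (near_eq_cvg e) _; apply: cvgZr_tmp; exact: cf.
Qed.

Lemma C1_sum E F (U : set E) (I : Type) (s : seq I) (P : pred I) (f : I -> E -> F) :
  open U -> (forall i, Ck 1 U (f i)) ->
  Ck 1 U (fun y => \sum_(i <- s | P i) f i y).
Proof.
move=> oU Cf; elim: s => [|i s IH].
  by apply: C1_ext (@C1_cst E F U 0) => // y _; rewrite big_nil.
case Pi : (P i); last by apply: C1_ext IH => // y _; rewrite big_cons Pi.
by apply: C1_ext (C1D (Cf i) IH oU) => // y _; rewrite big_cons Pi.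
Qed.

Lemma C1_prod E (U : set E) (I : Type) (s : seq I) (P : pred I) (f : I -> E -> R) :
  open U -> (forall i, Ck 1 U (f i)) ->
  Ck 1 U (fun y => \prod_(i <- s | P i) f i y).
Proof.
move=> oU Cf; elim: s => [|i s IH].
  by apply: C1_ext (@C1_cst E R U 1) => // y _; rewrite big_nil.
case Pi : (P i); last by apply: C1_ext IH => // y _; rewrite big_cons Pi.
by apply: C1_ext (C1M (Cf i) IH oU) => // y _; rewrite big_cons Pi.
Qed.

Lemma C1V E (U : set E) (f : E -> R) : Ck 1 U f ->
  (forall y, U y -> f y != 0) -> open U -> Ck 1 U (fun y => (f y)^-1).
Proof.
move=> Cf f0 oU; have [df cf] := Cf.
split=> [y Uy|v y Uy].
  by apply: differentiableV; [exact: df|exact: f0].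
have e : {near y, (fun z => - (f z) ^- 2 * 'D_v f z) =1 'D_v (fun z => (f z)^-1)}.
  have := open_nbhs_nbhs (conj oU Uy); apply: filterS => z Uz.
  have dz := df z Uz.
  rewrite [RHS]deriveE//; last by apply: differentiableV => //; exact: f0.
  by rewrite diffV ?f0// deriveE.
rewrite /prop_for /continuous_at -(nbhs_singleton e).
apply: cvg_trans (near_eq_cvg e) _; apply: cvgM; last exact: cf.
apply: cvgN; apply: cvgV; first by rewrite expf_neq0// f0.
have cy : f z @[z --> y] --> f y := C1_continuous Cf Uy.
by under eq_fun do rewrite expr2; rewrite expr2; exact: cvgM.
Qed.

Section WithCoordinates.
Context (F : normedModType R) (I : finType) (b : I -> F) (c : I -> F -> R).
Hypothesis bc : coordinates b c.

Lemma diff_coordinates G (g : F -> G) z u : differentiable g z ->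
  'd g z u = \sum_k c k u *: 'D_(b k) g z.
Proof.
move=> dg; have [_ _ e] := bc; rewrite {1}(e u) linear_sum.
by apply: eq_bigr => k _; rewrite linearZ deriveE.
Qed.

Lemma is_diff_coord E (g : E -> F) z k : differentiable g z ->
  differentiable (c k \o g) z /\ forall v, 'd (c k \o g) z v = c k ('d g z v).
Proof.
move=> dg; have [lin _ _] := bc.
have cklin : linear (c k) by move=> a u w; exact: lin.
pose cM := GRing.isLinear.Build _ _ _ _ _ cklin.
pose cL : {linear F -> R} := HB.pack (c k) cM.
have ck : continuous cL by exact: (@coordinates_continuous _ _ _ _ _ k bc).
have dc : differentiable (c k) (g z) by exact: (@linear_differentiable _ _ _ cL).
split=> [|v]; first exact: differentiable_comp.
by rewrite (diff_comp dg dc) /= (@diff_lin _ _ _ cL (g z) ck).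
Qed.

(** In the chain rule the direction ['D_v f z] moves with [z], whereas [Ck 1 V g] gives continuity
    of ['D_u g] for a fixed [u] only. Expanding the direction in the basis reduces to fixed
    directions. *)
Lemma C1_comp E G (U : set E) (V : set F) (f : E -> F) (g : F -> G) :
  Ck 1 U f -> Ck 1 V g -> (forall y, U y -> V (f y)) -> open U ->
  Ck 1 U (g \o f).
Proof.
move=> Cf Cg UV oU; have [df cf] := Cf; have [dg cg] := Cg.
split=> [y Uy|v y Uy].
  by apply: differentiable_comp; [exact: df|exact/dg/UV].
have e : {near y, (fun z => \sum_k c k ('D_v f z) *: 'D_(b k) g (f z))
    =1 'D_v (g \o f)}.
  have := open_nbhs_nbhs (conj oU Uy); apply: filterS => z Uz.
  have dz := df z Uz; have dgz := dg _ (UV _ Uz).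
  rewrite [RHS]deriveE; last exact: differentiable_comp.
  by rewrite diff_comp//= diff_coordinates// deriveE.
rewrite /prop_for /continuous_at -(nbhs_singleton e).
apply: cvg_trans (near_eq_cvg e) _; apply: cvg_bigsum => k; apply: cvgZ.
  apply: (@cvg_comp _ _ _ ('D_v f) (c k)); first exact: cf.
  have ck : continuous (c k) by exact: coordinates_continuous bc.
  exact: ck.
apply: (@cvg_comp _ _ _ f ('D_(b k) g)); first exact: C1_continuous Cf Uy.
exact: cg _ _ (UV _ Uy).
Qed.

Lemma C1_coord E (U : set E) (f : E -> F) k : open U -> Ck 1 U f ->
  Ck 1 U (fun y => c k (f y)).
Proof.
move=> oU Cf; apply: (@C1_comp E R U setT f (c k)) => //.
apply: C1_linear; last exact: coordinates_continuous bc.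
by case: bc => lin _ _ a u v; exact: lin.
Qed.

Lemma C1_of_coord E (U : set E) (f : E -> F) : open U ->
  (forall k, Ck 1 U (fun y => c k (f y))) -> Ck 1 U f.
Proof.
move=> oU Cf; have [_ _ e] := bc.
apply: (@C1_ext _ _ U (fun y => \sum_k c k (f y) *: b k)) => //.
by apply: C1_sum => // k; apply: C1Zl.
Qed.

Lemma C1_diff_bounded G (U : set F) (g : F -> G) z0 : open U -> U z0 ->
  Ck 1 U g ->
  exists2 C : R, 0 < C & \forall z \near z0, forall u, `|'d g z u| <= C * `|u|.
Proof.
move=> oU Uz0 Cg; have [_ bd _] := bc.
(* The inner [+ 1] is the room left by continuity of the partial derivatives; the outer one keeps
   the constant positive for an empty basis. *)
exists (\sum_k (`|'D_(b k) g z0| + 1) + 1).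
  by rewrite ltr_wpDl// sumr_ge0// => k _; rewrite addr_ge0.
have near_k k : \forall z \near z0, `|'D_(b k) g z| <= `|'D_(b k) g z0| + 1.
  have /cvgrPdist_le/(_ 1 ltr01) := @C1_derive _ _ _ _ (b k) _ Cg Uz0.
  apply: filterS => z h; rewrite -(subrK ('D_(b k) g z0) ('D_(b k) g z)) addrC.
  by rewrite (le_trans (ler_normD _ _))// lerD2l distrC.
have all_k : \forall z \near z0, forall k, `|'D_(b k) g z| <= `|'D_(b k) g z0| + 1.
  exact: filter_forall.
near=> z => u.
have Uz : U z by near: z; exact: open_nbhs_nbhs.
rewrite diff_coordinates; last exact: C1_diff Cg Uz.
apply: le_trans (ler_norm_sum _ _ _) _.
rewrite mulrDl mul1r mulr_suml -[leLHS]addr0 lerD// ler_sum// => k _.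
rewrite normrZ mulrC ler_pM//.
by move: k; near: z.
Unshelve. all: by end_near. Qed.

End WithCoordinates.

Lemma derive_line E F (g : E -> F) z v (t : R) :
  differentiable g (z + t *: v) ->
  is_derive t (1 : R) (fun s : R => g (z + s *: v)) ('d g (z + t *: v) v).
Proof.
move=> dg; have := @diff_derivable _ _ _ _ _ v dg; have := deriveE v dg.
rewrite /derivable /derive => <-.
have -> : (fun h : R => h^-1 *: (g (h *: v + (z + t *: v)) - g (z + t *: v))) =
   (fun h : R => h^-1 *: (g (z + (h *: 1 + t) *: v) - g (z + t *: v))).
  apply/funext => h; congr (_ *: (g _ - _)).
  by rewrite scalerDl addrCA /GRing.scale/= mulr1.
by move=> dgv; apply: DeriveDef.
Qed.

Lemma mean_value01 (h dh : R -> R) :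
  (forall t : R, t \in `[0, 1] -> is_derive t (1 : R) h (dh t)) ->
  exists2 t : R, t \in `[0, 1] & h 1 - h 0 = dh t.
Proof.
move=> Dh.
have ch : {within `[0, 1], continuous h}.
  by apply: derivable_within_continuous => t tI; have [] := Dh t tI.
have Dho (t : R) : t \in `]0, 1[ -> is_derive t (1 : R) h (dh t).
  by move=> tI; apply: Dh; exact: subset_itv_oo_cc.
have [t tI] := MVT_segment ler01 Dho ch.
by rewrite subr0 mulr1 => ->; exists t.
Qed.

(** The mean value theorem is scalar: it is applied to each coordinate of [g] along a segment, which
    stays in the ball by convexity, and the norms of the [b' k] enter the constant. *)
Lemma C1_lipschitz E F (I J : finType) (b : I -> E) (c : I -> E -> R)
    (b' : J -> F) (c' : J -> F -> R) (U : set E) (g : E -> F) z0 :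
  coordinates b c -> coordinates b' c' -> open U -> U z0 -> Ck 1 U g ->
  exists C r : R, [/\ 0 < C, 0 < r & forall z1 z2,
    `|z1 - z0| < r -> `|z2 - z0| < r -> `|g z1 - g z2| <= C * `|z1 - z2|].
Proof.
move=> bc bc' oU Uz0 Cg.
have [C C0 nC] := C1_diff_bounded bc oU Uz0 Cg.
have [lin' bd' e'] := bc'.
have : \forall z \near z0, (forall u, `|'d g z u| <= C * `|u|) /\ U z.
  by apply: filterI => //; exact: open_nbhs_nbhs.
move=> /nbhs_ballP[r /= r0 rP].
exists (C * (\sum_k `|b' k| + 1)), r; split => //.
  by rewrite mulr_gt0// ltr_wpDl// sumr_ge0.
move=> z1 z2 z1r z2r; pose v := z1 - z2; pose p (t : R) := z2 + t *: v.
have pr t : t \in `[0, 1] -> `|p t - z0| < r.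
  rewrite in_itv/= => /andP[t0 t1].
  have -> : p t - z0 = t *: (z1 - z0) + (1 - t) *: (z2 - z0).
    have -> : p t - z0 = (z2 - z0) + t *: ((z1 - z0) - (z2 - z0)).
      by rewrite /p /v [in RHS]opprB [in RHS]addrA subrK addrAC.
    by rewrite scalerBr scalerBl scale1r addrCA.
  apply: le_lt_trans (ler_normD _ _) _; rewrite !normrZ !ger0_norm ?subr_ge0//.
  have [->|tn0] := eqVneq t 0; first by rewrite mul0r add0r subr0 mul1r.
  have h1 : t * `|z1 - z0| < t * r by rewrite ltr_pM2l// lt0r tn0.
  have h2 : (1 - t) * `|z2 - z0| <= (1 - t) * r.
    by rewrite ler_wpM2l ?subr_ge0// ltW.
  lra.
have cb k : `|c' k (g z1 - g z2)| <= C * `|z1 - z2|.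
  pose h (t : R) : R := c' k (g (p t)).
  have dh (t : R) : t \in `[0, 1] -> is_derive t (1 : R) h (c' k ('d g (p t) v)).
    move=> tI; have ptr := pr t tI.
    have [_ Upt] : (forall u, `|'d g (p t) u| <= C * `|u|) /\ U (p t).
      by apply: rP; rewrite -ball_normE /= distrC.
    have dg : differentiable g (p t) := C1_diff Cg Upt.
    have [dcg <-] := is_diff_coord bc' k dg.
    exact: (@derive_line _ _ (c' k \o g)).
  have [t tI ht] := mean_value01 dh.
  have -> : c' k (g z1 - g z2) = h 1 - h 0.
    rewrite /h /p scale1r scale0r addr0 /v addrCA subrr addr0.
    by rewrite addrC -scaleN1r lin' mulN1r addrC.
  rewrite ht; apply: le_trans (bd' _ _) _.
  have [+ _] : (forall u, `|'d g (p t) u| <= C * `|u|) /\ U (p t).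
    by apply: rP; rewrite -ball_normE /= distrC; exact: pr.
  exact.
rewrite {1}(e' (g z1 - g z2)); apply: le_trans (ler_norm_sum _ _ _) _.
rewrite mulrAC mulrDr mulr1 mulr_sumr -[leLHS]addr0 lerD//; last first.
  by rewrite mulr_ge0// ltW.
by apply: ler_sum => k _; rewrite normrZ ler_wpM2r.
Qed.

(** Meant for transition maps, which are smooth. The differential is a combination of the partial
    derivatives ['D_(b k) g], each of them locally Lipschitz. *)
Lemma C1_diff_lipschitz E F (I J : finType) (b : I -> E) (c : I -> E -> R)
    (b' : J -> F) (c' : J -> F -> R) (U : set E) (g : E -> F) z0 :
  coordinates b c -> coordinates b' c' -> open U -> U z0 -> Ck 1 U g ->
  (forall v, Ck 1 U ('D_v g)) ->
  exists C r : R, [/\ 0 < C, 0 < r & forall z1 z2 u,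
    `|z1 - z0| < r -> `|z2 - z0| < r ->
    `|'d g z1 u - 'd g z2 u| <= C * `|z1 - z2| * `|u|].
Proof.
move=> bc bc' oU Uz0 Cg Cdg.
have lipk (k : I) : exists Cr : R * R, [/\ 0 < Cr.1, 0 < Cr.2 & forall z1 z2,
    `|z1 - z0| < Cr.2 -> `|z2 - z0| < Cr.2 ->
    `|'D_(b k) g z1 - 'D_(b k) g z2| <= Cr.1 * `|z1 - z2|].
  have [C [r [C0 r0 h]]] := C1_lipschitz bc bc' oU Uz0 (Cdg (b k)).
  by exists (C, r).
have [Cr CrP] := choice lipk.
have [r0 /= r00 rU] := (nbhs_ballP _ _).1 (open_nbhs_nbhs (conj oU Uz0)).
exists (\sum_k (Cr k).1 + 1), (\big[Num.min/r0]_k (Cr k).2); split.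
- by rewrite ltr_wpDl// sumr_ge0// => k _; have [/ltW] := CrP k.
- by elim/big_ind : _ => // [x y x0 y0|k _]; [rewrite lt_min x0|case: (CrP k)].
have ler : forall k, \big[Num.min/r0]_k (Cr k).2 <= (Cr k).2.
  by move=> k; rewrite (bigD1 k)//= ge_min lexx.
have ler0 : \big[Num.min/r0]_k (Cr k).2 <= r0.
  by elim/big_rec : _ => // k x _ xr; rewrite ge_min xr orbT.
move=> z1 z2 u z1r z2r.
have Uz z : `|z - z0| < \big[Num.min/r0]_k (Cr k).2 -> U z.
  by move=> zr; apply: rU; rewrite -ball_normE /= distrC (lt_le_trans zr).
rewrite (diff_coordinates bc u (C1_diff Cg (Uz _ z1r))).
rewrite (diff_coordinates bc u (C1_diff Cg (Uz _ z2r))).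
rewrite -sumrB; apply: le_trans (ler_norm_sum _ _ _) _.
rewrite !mulrDl mul1r !mulr_suml -[leLHS]addr0 lerD ?mulr_ge0//.
apply: ler_sum => k _; rewrite -scalerBr normrZ mulrC ler_pM//.
  by have [_ _] := CrP k; apply; exact: lt_le_trans (ler k).
by case: bc => _ + _; exact.
Qed.

End C1.

(** * Length distance of a metric in charts *)

(** The integral of a nonnegative function is a supremum over the simple functions below it, hence
    monotone for arbitrary functions. Lengths can thus be compared without proving that the speed of
    a curve is measurable. *)
Lemma ge0_integral_le d (T : measurableType d) (R : realType)
    (mu : {measure set T -> \bar R}) (D D' : set T) (f1 f2 : T -> \bar R) :
  D `<=` D' -> (forall x, D x -> 0 <= f1 x)%E ->
  (forall x, D' x -> 0 <= f2 x)%E -> (forall x, D x -> f1 x <= f2 x)%E ->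
  (\int[mu]_(x in D) f1 x <= \int[mu]_(x in D') f2 x)%E.
Proof.
move=> DD' f10 f20 f12; rewrite (integral_mkcond D) (integral_mkcond D').
have h1 x : (0 <= (f1 \_ D) x)%E by apply: erestrict_ge0.
have h2 x : (0 <= (f2 \_ D') x)%E by apply: erestrict_ge0.
have h12 x : ((f1 \_ D) x <= (f2 \_ D') x)%E.
  rewrite /patch; case: ifPn => [|_]; last by case: ifPn => // /[!inE]; exact: f20.
  by rewrite inE => Dx; rewrite ifT ?f12// inE; exact: DD'.
rewrite !ge0_integralTE//; apply: ereal_sup_le.
by apply: image_subset => h /= hf x; exact: le_trans (hf x) (h12 x).
Qed.

Section Charted.
Context {R : realType} {E : normedModType R}.
Context (X : Type) (S : charted X E) (g : X -> E -> E -> R).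

Lemma curve_length_ge0 (c : R -> X) : (0 <= curve_length S g c)%E.
Proof. by apply: integral_ge0 => t _; rewrite lee_fin sqrtr_ge0. Qed.

Lemma path_length_ge0 (p : seq (R -> X)) :
  (0 <= \sum_(c <- p) curve_length S g c)%E.
Proof. by apply: sume_ge0 => c _; exact: curve_length_ge0. Qed.

Lemma rdist_ge0 x y : (0 <= rdist S g x y)%E.
Proof. by apply: le_ereal_inf_tmp => _ [p _ <-]; exact: path_length_ge0. Qed.

Lemma rdist_xx x : rdist S g x x = 0%E.
Proof.
apply/eqP; rewrite eq_le rdist_ge0 andbT; apply: ereal_inf_lbound.
by exists [::] => //; rewrite big_nil.
Qed.

Lemma piecewise_C1_cat x y z p p' :
  piecewise_C1 S x p y -> piecewise_C1 S y p' z -> piecewise_C1 S x (p ++ p') z.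
Proof.
elim: p x => [x -> //|c p IH x [Cc cx cp] pz].
by split => //; exact: IH.
Qed.

Lemma rdist_triangle x y z :
  (rdist S g x z <= rdist S g x y + rdist S g y z)%E.
Proof.
have [xy|xy] := eqVneq (rdist S g x y) +oo%E.
  by rewrite xy addye ?leey// gt_eqF// (lt_le_trans _ (rdist_ge0 _ _)).
have [yz|yz] := eqVneq (rdist S g y z) +oo%E.
  by rewrite yz addey ?leey// gt_eqF// (lt_le_trans _ (rdist_ge0 _ _)).
have fxy : rdist S g x y \is a fin_num by rewrite ge0_fin_numE ?rdist_ge0// ltey.
have fyz : rdist S g y z \is a fin_num by rewrite ge0_fin_numE ?rdist_ge0// ltey.
apply/lee_addgt0Pr => e e0.
have e20 : 0 < e / 2 by rewrite divr_gt0.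
have [_ [p px <-] lp] := @lb_ereal_inf_adherent _ _ _ e20 fxy.
have [_ [p' py <-] lp'] := @lb_ereal_inf_adherent _ _ _ e20 fyz.
apply: (@le_trans _ _ (\sum_(c <- p ++ p') curve_length S g c)%E).
  by apply: ereal_inf_lbound; exists (p ++ p') => //; exact: piecewise_C1_cat py.
rewrite big_cat/=; apply: le_trans (leeD (ltW lp) (ltW lp')) _.
by rewrite addeACA -EFinD -splitr.
Qed.

Lemma rdist_curve x y c l : C1_curve S c -> c 0 = x -> c 1 = y ->
  (curve_length S g c <= l)%E -> (rdist S g x y <= l)%E.
Proof.
move=> Cc c0 c1; apply: le_trans; apply: ereal_inf_lbound.
by exists [:: c]; [split|rewrite big_seq1].
Qed.

Lemma curve_length_le c (l : R) :
  (forall t : R, t \in `[0, 1] -> rnorm g (c t) (velocity S c t) <= l) ->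
  (curve_length S g c <= l%:E)%E.
Proof.
move=> cl.
have -> : l%:E = (\int[lebesgue_measure]_(t in `[0%R, 1%R]) (cst l%:E) t)%E.
  rewrite integral_cst//= lebesgue_measure_itv/= lte_fin ltr01.
  by rewrite oppr0 adde0 mule1.
have r0 t : (0 <= (rnorm g (c t) (velocity S c t))%:E)%E.
  by rewrite lee_fin sqrtr_ge0.
apply: ge0_integral_le => [//|t _|t tI|t tI]; first exact: r0.
  by rewrite /= lee_fin (le_trans _ (cl _ tI))// sqrtr_ge0.
by rewrite /= lee_fin cl.
Qed.

(** This is what makes segments through [z] into C^1 curves for the preferred charts. It is phrased
    with an open set of the model space, so that it makes sense on [M * {vspace E}] as well, which
    carries no topology here. *)
Definition regular_at (e : chart X E) (z : E) :=
  chart_map e (chart_inv e z) = z /\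
  exists U : set E, [/\ open U, U z,
    forall y, U y -> chart_dom (chart_at S (chart_inv e z)) (chart_inv e y) &
    Ck 1 U (chart_map (chart_at S (chart_inv e z)) \o chart_inv e)].

Definition segment (z1 z2 : E) (t : R) : E := z1 + t *: (z2 - z1).

Lemma segment_continuous z1 z2 : continuous (segment z1 z2).
Proof.
move=> t; apply: cvgD; first exact: cvg_cst.
by apply: cvgZr_tmp; exact: cvg_id.
Qed.

Lemma segment_C1_curve (e : chart X E) z1 z2 :
  (forall t : R, t \in `[0, 1] -> regular_at e (segment z1 z2 t)) ->
  C1_curve S (chart_inv e \o segment z1 z2).
Proof.
move=> reg t tI; have [ez [U [oU Uz Udom CU]]] := reg t tI.
have nU : \forall s \near t, U (segment z1 z2 s).
  exact: (segment_continuous (open_nbhs_nbhs (conj oU Uz))).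
set e0 := chart_at _ _; pose tau := chart_map e0 \o chart_inv e.
have dtau s : U (segment z1 z2 s) ->
    is_derive s (1 : R) (chart_map e0 \o (chart_inv e \o segment z1 z2))
      ('D_(z2 - z1) tau (segment z1 z2 s)).
  move=> Us; have dt : differentiable tau (segment z1 z2 s) := C1_diff CU Us.
  by rewrite deriveE//; exact: (@derive_line _ _ _ tau).
split.
- by apply: filterS nU => s; exact: Udom.
- by apply: filterS nU => s Us; have [] := dtau s Us.
have e1 : {near t, ('D_(z2 - z1) tau \o segment z1 z2) =1
   derive1 (chart_map e0 \o (chart_inv e \o segment z1 z2))}.
  apply: filterS nU => s Us; rewrite derive1E.
  by have [_ ->] := dtau s Us.
rewrite /prop_for /continuous_at -(nbhs_singleton e1).
apply: cvg_trans (near_eq_cvg e1) _.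
apply: cvg_comp; first exact: segment_continuous.
exact: (C1_derive CU Uz).
Qed.

Lemma segment_velocity (e : chart X E) z1 z2 t :
  regular_at e (segment z1 z2 t) ->
  velocity S (chart_inv e \o segment z1 z2) t =
  of_chart S e (chart_inv e (segment z1 z2 t)) (z2 - z1).
Proof.
move=> [ez [U [oU Uz Udom CU]]].
rewrite /velocity derive1E /of_chart ez.
set tau := _ \o chart_inv e.
have dt : differentiable tau (segment z1 z2 t) := C1_diff CU Uz.
by have [_ <-] := @derive_line _ _ _ tau z1 (z2 - z1) t dt.
Qed.

Lemma segment_rdist (e : chart X E) z1 z2 (C : R) : 0 <= C ->
  (forall t : R, t \in `[0, 1] -> regular_at e (segment z1 z2 t)) ->
  (forall t : R, t \in `[0, 1] ->
     let x := chart_inv e (segment z1 z2 t) in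
     let v := of_chart S e x (z2 - z1) in
     g x v v <= C * `|z1 - z2| ^+ 2) ->
  (rdist S g (chart_inv e z1) (chart_inv e z2) <= (Num.sqrt C * `|z1 - z2|)%:E)%E.
Proof.
move=> C0 reg bd.
apply: (@rdist_curve _ _ (chart_inv e \o segment z1 z2)).
- exact: segment_C1_curve.
- by rewrite /= /segment scale0r addr0.
- by rewrite /= /segment scale1r addrC subrK.
apply: curve_length_le => t tI; rewrite segment_velocity; last exact: reg.
rewrite /rnorm; apply: (@le_trans _ _ (Num.sqrt (C * `|z1 - z2| ^+ 2))).
  by rewrite ler_wsqrtr//; exact: bd.
by rewrite sqrtrM// sqrtr_sqr normr_id.
Qed.

Section WithCoordinates.
Context (I : finType) (b : I -> E) (c : I -> E -> R).
Hypothesis bc : coordinates b c.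

Lemma bilinear_coordinates (G : E -> E -> R) :
  (forall a u v w, G (a *: u + v) w = a * G u w + G v w) ->
  (forall u v, G u v = G v u) ->
  forall u, G u u = \sum_k \sum_l c k u * c l u * G (b k) (b l).
Proof.
move=> lin sym u; have [_ _ e] := bc.
have lin0 w : G 0 w = 0.
  have := lin 1 0 0 w; rewrite scale1r addr0 mul1r.
  by move/eqP; rewrite -subr_eq subrr eq_sym => /eqP.
have sumE (F : I -> E) w : G (\sum_k c k u *: F k) w = \sum_k c k u * G (F k) w.
  elim/big_rec2 : _ => [|k x y _ <-]; first exact: lin0.
  by rewrite lin.
rewrite {1}(e u) sumE; apply: eq_bigr => k _.
rewrite sym [in G _ _](e u) sumE mulr_sumr; apply: eq_bigr => l _.
by rewrite mulrA (sym (b l)).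
Qed.

(** Stated for symmetric forms of any sign: it is also applied to the difference of a metric at two
    points. *)
Lemma bilinear_bound (G : E -> E -> R) (C : R) :
  (forall a u v w, G (a *: u + v) w = a * G u w + G v w) ->
  (forall u v, G u v = G v u) ->
  (forall k l, `|G (b k) (b l)| <= C) ->
  forall u, `|G u u| <= (\sum_(k : I) \sum_(l : I) C) * `|u| ^+ 2.
Proof.
move=> lin sym bd u; have [_ bdc _] := bc.
rewrite bilinear_coordinates// mulr_suml (le_trans (ler_norm_sum _ _ _))//.
apply: ler_sum => k _; rewrite mulr_suml (le_trans (ler_norm_sum _ _ _))//.
apply: ler_sum => l _; rewrite normrM mulrC ler_pM// normrM expr2 ler_pM//.
Qed.

Lemma metric_bound_compact (K : set E) (G : E -> E -> E -> R) :
  compact K ->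
  (forall z a u v w, K z -> G z (a *: u + v) w = a * G z u w + G z v w) ->
  (forall z u v, K z -> G z u v = G z v u) ->
  (forall u v z, K z -> {for z, continuous (fun z => G z u v)}) ->
  exists2 C : R, 0 < C & forall z u, K z -> G z u u <= C * `|u| ^+ 2.
Proof.
move=> cK lin sym cont.
have bkl (kl : I * I) : exists2 C : R, 0 < C &
    forall z, K z -> `|G z (b kl.1) (b kl.2)| <= C.
  have : compact ((fun z => G z (b kl.1) (b kl.2)) @` K).
    apply: continuous_compact => //.
    apply: continuous_in_subspaceT => z /[!inE] Kz; exact: cont.
  move=> /compact_bounded[M [_ /(_ (`|M| + 1))]] h.
  exists (`|M| + 1); first by rewrite ltr_wpDl.
  by move=> z Kz; apply: h; [rewrite (le_lt_trans (ler_norm _))// ltrDl|exists z].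
pose B kl := sval (cid2 (bkl kl)).
have B0 kl : 0 < B kl by rewrite /B; case: cid2.
have BP kl z : K z -> `|G z (b kl.1) (b kl.2)| <= B kl.
  by rewrite /B; case: cid2 => //= C _; exact.
pose C := \sum_kl B kl.
have BC kl : B kl <= C.
  by rewrite /C (bigD1 kl)//= lerDl sumr_ge0// => i _; exact: ltW.
have C0 : 0 <= C by apply: sumr_ge0 => i _; exact: ltW.
exists ((\sum_(k : I) \sum_(l : I) C) + 1).
  by rewrite ltr_wpDl// sumr_ge0// => k _; exact: sumr_ge0.
move=> z u Kz; apply: le_trans (ler_norm _) _.
apply: le_trans (@bilinear_bound (G z) C _ _ _ u) _.
- by move=> *; exact: lin.
- by move=> *; exact: sym.
- by move=> k l; exact: le_trans (BP (k, l) z Kz) (BC _).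
by rewrite ler_wpM2r ?sqr_ge0// ler_wpDr.
Qed.

(** Serves both M, with a ball in a chart, and the bundle, with a product of balls. Compactness of
    [K] bounds the coefficients of the metric and convexity keeps the segments inside. *)
Lemma segment_rdist_compact (e : chart X E) (K : set E) :
  riemannian_metric S g -> atlas S e -> compact K ->
  K `<=` chart_image e setT ->
  (forall z1 z2 t, K z1 -> K z2 -> t \in `[0, 1] -> K (segment z1 z2 t)) ->
  (forall z, K z -> regular_at e z) ->
  exists2 C : R, 0 < C & forall z1 z2, K z1 -> K z2 ->
    (rdist S g (chart_inv e z1) (chart_inv e z2) <= (C * `|z1 - z2|)%:E)%E.
Proof.
move=> [lin sym pos sm] Se cK Kim Kconv Kreg.
pose G z u v := let x := chart_inv e z in g x (of_chart S e x u) (of_chart S e x v).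
have [C C0 GC] : exists2 C : R, 0 < C & forall z u, K z -> G z u u <= C * `|u| ^+ 2.
  apply: metric_bound_compact => //.
  - by move=> z a u v w _; rewrite /G /of_chart linearP lin.
  - by move=> z u v _; exact: sym.
  - by move=> u v z Kz; apply: (sm e Se u v 0); exact: Kim.
exists (Num.sqrt C); first by rewrite sqrtr_gt0.
move=> z1 z2 K1 K2; apply: segment_rdist; first exact: ltW.
- by move=> t tI; apply/Kreg/Kconv.
- by move=> t tI /=; rewrite (distrC z1); apply/GC/Kconv.
Qed.

End WithCoordinates.
End Charted.

(** * Charts and tangent maps *)

Section Charts.
Context {R : realType} {E : normedModType R}.

Definition transition X (e e' : chart X E) : E -> E := chart_map e' \o chart_inv e.

Section Topological.
Context (M : topologicalType) (e : chart M E) (he : topological_chart e).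

Lemma chart_mapK x : chart_dom e x -> chart_inv e (chart_map e x) = x.
Proof. by case: he => _ _ + _ _; exact. Qed.

Lemma chart_map_image x : chart_dom e x -> chart_image e setT (chart_map e x).
Proof. by exists x. Qed.

Lemma chart_imageP (U : set M) z :
  chart_image e U z <-> chart_image e setT z /\ U (chart_inv e z).
Proof.
split=> [[x [ex Ux] <-]|[[x [ex _] <-]]]; first by rewrite chart_mapK//; split => //; exists x.
by rewrite chart_mapK// => Ux; exists x.
Qed.

Lemma chart_image_dom z : chart_image e setT z -> chart_dom e (chart_inv e z).
Proof. by case=> x [ex _] <-; rewrite chart_mapK. Qed.

Lemma chart_invK z : chart_image e setT z -> chart_map e (chart_inv e z) = z.
Proof. by case=> x [ex _] <-; rewrite chart_mapK. Qed.

Lemma chart_map_continuous x : chart_dom e x -> {for x, continuous (chart_map e)}.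
Proof.
case: he => oe _ _ + _; rewrite (continuous_open_subspace _ oe) => ce ex.
by apply: ce; rewrite inE.
Qed.

Lemma chart_inv_continuous z : chart_image e setT z ->
  {for z, continuous (chart_inv e)}.
Proof.
case: he => _ oi _ _; rewrite (continuous_open_subspace _ oi) => ce ex.
by apply: ce; rewrite inE.
Qed.

Lemma chart_image_open (U : set M) : open U -> open (chart_image e U).
Proof.
move=> oU; rewrite openE => z /chart_imageP[iz Uz]; rewrite /interior.
have oi : open (chart_image e setT) by case: he.
have n1 : nbhs z (chart_image e setT) by exact: open_nbhs_nbhs.
have n2 : nbhs z (chart_inv e @^-1` U).
  by apply: (chart_inv_continuous iz); exact: open_nbhs_nbhs.
by apply: filterS2 n1 n2 => y i1 i2; apply/chart_imageP.
Qed.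

Lemma chart_dom_open : open (chart_dom e).
Proof. by case: he. Qed.

End Topological.

Section Atlas.
Context (M : topologicalType) (B : set (chart M E)) (hB : smooth_atlas B).

Lemma atlas_chart e : B e -> topological_chart e.
Proof. by case: hB => + _ _; exact. Qed.

Lemma transition_C1 e e' : B e -> B e' ->
  Ck 1 (chart_image e (chart_dom e')) (transition e e').
Proof. by case: hB => _ _ + Be Be'; move=> /(_ e e' Be Be' 1). Qed.

Lemma transition_derive_C1 e e' v : B e -> B e' ->
  Ck 1 (chart_image e (chart_dom e')) ('D_v (transition e e')).
Proof. by case: hB => _ _ + Be Be'; move=> /(_ e e' Be Be' 2)[_]; exact. Qed.

Lemma image_in (e e' : chart M E) x : chart_dom e x -> chart_dom e' x ->
  chart_image e (chart_dom e') (chart_map e x).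
Proof. by move=> ex e'x; exists x. Qed.

Lemma transition_diff e e' x : B e -> B e' -> chart_dom e x -> chart_dom e' x ->
  differentiable (transition e e') (chart_map e x).
Proof. by move=> Be Be' ex e'x; exact: (C1_diff (transition_C1 Be Be') (image_in ex e'x)). Qed.

Definition dtrans (e e' : chart M E) (x : M) : E -> E :=
  'd (transition e e') (chart_map e x).

Lemma dtrans_id e x u : B e -> chart_dom e x -> dtrans e e x u = u.
Proof.
move=> Be ex; rewrite /dtrans.
have ne : {near chart_map e x, id =1 transition e e}.
  have te := atlas_chart Be.
  have : nbhs (chart_map e x) (chart_image e setT).
    by apply: open_nbhs_nbhs; split; [case: te|exact: chart_map_image].
  by apply: filterS => z iz; rewrite /transition /= chart_invK.
have di : differentiable (id : E -> E) (chart_map e x) by [].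
by rewrite (near_eq_diff ne di) -deriveE// derive_id.
Qed.

Lemma near_dom e e' x : B e -> B e' -> chart_dom e x -> chart_dom e' x ->
  \forall z \near chart_map e x, chart_image e setT z /\ chart_dom e' (chart_inv e z).
Proof.
move=> Be Be' ex e'x; have te := atlas_chart Be; have te' := atlas_chart Be'.
have o : open (chart_image e (chart_dom e')).
  by apply: chart_image_open => //; exact: chart_dom_open.
have := open_nbhs_nbhs (conj o (image_in ex e'x)).
by apply: filterS => z /(chart_imageP te).
Qed.

Lemma dtrans_comp e e' e'' x u : B e -> B e' -> B e'' ->
  chart_dom e x -> chart_dom e' x -> chart_dom e'' x ->
  dtrans e' e'' x (dtrans e e' x u) = dtrans e e'' x u.
Proof.
move=> Be Be' Be'' ex e'x e''x; rewrite /dtrans.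
have te := atlas_chart Be; have te' := atlas_chart Be'.
have d1 := transition_diff Be Be' ex e'x.
have ee : transition e e' (chart_map e x) = chart_map e' x.
  by rewrite /transition /= chart_mapK.
have d2 : differentiable (transition e' e'') (transition e e' (chart_map e x)).
  by rewrite ee; exact: transition_diff.
have ne : {near chart_map e x, transition e' e'' \o transition e e' =1 transition e e''}.
  apply: filterS (near_dom Be Be' ex e'x) => z [iz ez].
  by rewrite /transition /= chart_mapK.
rewrite (near_eq_diff ne); last exact: differentiable_comp.
by rewrite diff_comp// /= ee.
Qed.

Lemma dtransK e e' x u : B e -> B e' -> chart_dom e x -> chart_dom e' x ->
  dtrans e' e x (dtrans e e' x u) = u.
Proof. by move=> *; rewrite dtrans_comp// dtrans_id. Qed.

Context (S : charted M E) (SB : atlas S `<=` B) (hS : smooth_manifold S).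

Lemma chart_at_atlas x : atlas S (chart_at S x).
Proof. by case: hS => _ /(_ x)[]. Qed.

Lemma chart_at_B x : B (chart_at S x).
Proof. exact/SB/chart_at_atlas. Qed.

Lemma chart_at_dom x : chart_dom (chart_at S x) x.
Proof. by case: hS => _ /(_ x)[]. Qed.

Local Hint Resolve chart_at_B chart_at_dom : core.

Lemma to_chartE e x : to_chart S e x = dtrans (chart_at S x) e x.
Proof. by []. Qed.

Lemma of_chartE e x : of_chart S e x = dtrans e (chart_at S x) x.
Proof. by []. Qed.

Lemma to_chartK e x u : B e -> chart_dom e x -> to_chart S e x (of_chart S e x u) = u.
Proof. by move=> Be ex; rewrite to_chartE of_chartE dtransK. Qed.

Lemma of_chartK e x u : B e -> chart_dom e x -> of_chart S e x (to_chart S e x u) = u.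
Proof. by move=> Be ex; rewrite to_chartE of_chartE dtransK. Qed.

Lemma to_chart_trans e e' x u : B e -> B e' -> chart_dom e x -> chart_dom e' x ->
  dtrans e e' x (to_chart S e x u) = to_chart S e' x u.
Proof. by move=> Be Be' ex ex'; rewrite !to_chartE dtrans_comp. Qed.

Lemma regular_chart e z : atlas S e -> chart_image e setT z -> regular_at S e z.
Proof.
move=> Se iz; have Be := SB Se; have te := atlas_chart Be.
split; first exact: chart_invK.
exists (chart_image e (chart_dom (chart_at S (chart_inv e z)))); split.
- by apply: chart_image_open => //; apply/chart_dom_open/atlas_chart.
- by apply/(chart_imageP te); split => //; exact: chart_at_dom.
- by move=> y /(chart_imageP te)[].
- exact: transition_C1.
Qed.

Definition diff_at (f : M -> M) x := {for x, continuous f} /\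
  differentiable (in_charts (chart_at S x) (chart_at S (f x)) f)
    (chart_map (chart_at S x) x).

Definition dcharts (e e' : chart M E) (f : M -> M) x : E -> E :=
  'd (in_charts e e' f) (chart_map e x).

Lemma near_dom_comp f e e' x : {for x, continuous f} -> B e -> B e' ->
  chart_dom e x -> chart_dom e' (f x) ->
  \forall z \near chart_map e x, chart_image e setT z /\ chart_dom e' (f (chart_inv e z)).
Proof.
move=> cf Be Be' ex e'x; have te := atlas_chart Be; have te' := atlas_chart Be'.
have nf : nbhs x (f @^-1` chart_dom e').
  by apply: cf; apply: open_nbhs_nbhs; split => //; exact: chart_dom_open.
have ni : nbhs (chart_map e x) (chart_image e setT).
  by apply: open_nbhs_nbhs; split; [case: te|exact: chart_map_image].
have ci := chart_inv_continuous te (chart_map_image ex).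
have nf' : nbhs (chart_map e x) (chart_inv e @^-1` (f @^-1` chart_dom e')).
  by apply: ci; rewrite chart_mapK.
by apply: filterS2 ni nf'.
Qed.

Lemma dcharts_comp f h e e' e'' x : B e -> B e' -> B e'' ->
  chart_dom e x -> chart_dom e' (f x) -> chart_dom e'' (h (f x)) ->
  {for x, continuous f} ->
  differentiable (in_charts e e' f) (chart_map e x) ->
  differentiable (in_charts e' e'' h) (chart_map e' (f x)) ->
  differentiable (in_charts e e'' (h \o f)) (chart_map e x) /\
  forall u, dcharts e e'' (h \o f) x u = dcharts e' e'' h (f x) (dcharts e e' f x u).
Proof.
move=> Be Be' Be'' ex e'x e''x cf d1 d2.
have te := atlas_chart Be; have te' := atlas_chart Be'.
have ee : in_charts e e' f (chart_map e x) = chart_map e' (f x).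
  by rewrite /in_charts /= chart_mapK.
have ne : {near chart_map e x,
    in_charts e' e'' h \o in_charts e e' f =1 in_charts e e'' (h \o f)}.
  apply: filterS (near_dom_comp cf Be Be' ex e'x) => z [iz fz].
  by rewrite /in_charts /= chart_mapK.
have d2' : differentiable (in_charts e' e'' h) (in_charts e e' f (chart_map e x)).
  by rewrite ee.
have dc := differentiable_comp d1 d2'.
split=> [|u]; first exact: near_eq_differentiable ne dc.
by rewrite /dcharts (near_eq_diff ne dc) diff_comp// /= ee.
Qed.

Lemma dcharts_id e e' x u : dcharts e e' id x u = dtrans e e' x u.
Proof. by []. Qed.

(** A change of chart is the identity map read in two charts, so the source and target charts are
    changed by [dcharts_comp] applied with [id] on either side. *)
Lemma diff_at_charts f e e' x : diff_at f x -> B e -> B e' ->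
  chart_dom e x -> chart_dom e' (f x) ->
  differentiable (in_charts e e' f) (chart_map e x) /\
  forall v, to_chart S e' (f x) (tangent_map S f x v) =
            dcharts e e' f x (to_chart S e x v).
Proof.
move=> [cf df] Be Be' ex e'x.
have idc (y : M) : {for y, continuous (id : M -> M)} by exact: cvg_id.
have [d1 E1] := @dcharts_comp id f e (chart_at S x) (chart_at S (f x)) x
  Be (chart_at_B _) (chart_at_B _) ex (chart_at_dom _) (chart_at_dom _) (idc x)
  (transition_diff Be (chart_at_B _) ex (chart_at_dom _)) df.
have [d2 E2] := @dcharts_comp f id e (chart_at S (f x)) e' x
  Be (chart_at_B _) Be' ex (chart_at_dom _) e'x cf d1
  (transition_diff (chart_at_B _) Be' (chart_at_dom _) e'x).
split=> [//|v]; rewrite E2 E1 !dcharts_id to_chartE.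
by rewrite -of_chartE of_chartK.
Qed.

Lemma diff_at_comp f h x : diff_at f x -> diff_at h (f x) -> diff_at (h \o f) x /\
  forall v, tangent_map S (h \o f) x v = tangent_map S h (f x) (tangent_map S f x v).
Proof.
move=> [cf df] [ch dh].
have [d1 E1] := @dcharts_comp f h (chart_at S x) (chart_at S (f x))
  (chart_at S (h (f x))) x (chart_at_B _) (chart_at_B _) (chart_at_B _)
  (chart_at_dom _) (chart_at_dom _) (chart_at_dom _) cf df dh.
by split=> [|v]; [split=> //; exact: continuous_comp|exact: E1].
Qed.

Lemma diff_at_id x : diff_at id x /\ forall v, tangent_map S id x v = v.
Proof.
split; last by move=> v; rewrite -[LHS]/(dtrans _ _ x v) dtrans_id.
split; first exact: cvg_id.
by rewrite -[in_charts _ _ _]/(transition _ _); apply: transition_diff.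
Qed.

Lemma diff_at_iter f k x : (forall y, diff_at f y) -> diff_at (iter k f) x.
Proof.
move=> df; elim: k => [|k IH]; first by have [] := diff_at_id x.
by have [] := diff_at_comp IH (df _).
Qed.

Lemma tangent_iterSr f k x v : (forall y, diff_at f y) ->
  tangent_map S (iter k.+1 f) x v =
  tangent_map S (iter k f) (f x) (tangent_map S f x v).
Proof.
move=> df; have [_ <-] := diff_at_comp (df x) (diff_at_iter k (f x) df).
by congr (tangent_map S _ x v); apply/funext => y; rewrite /= -iterSr.
Qed.

Lemma tangent_mapK f h x v : cancel f h -> diff_at f x -> diff_at h (f x) ->
  tangent_map S h (f x) (tangent_map S f x v) = v.
Proof.
move=> fK df dh; have [_ <-] := diff_at_comp df dh.
have -> : h \o f = id by apply/funext => y; exact: fK.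
by have [_ ->] := diff_at_id x.
Qed.

Lemma C1_map_diff_at f x : C1_map S f -> diff_at f x.
Proof.
move=> [cf Cf]; split; first exact: cf.
have te := atlas_chart (chart_at_B x).
apply: (C1_diff (Cf _ _ (chart_at_atlas x) (chart_at_atlas (f x)))).
by apply/(chart_imageP te); split; [exact: chart_map_image|rewrite /= chart_mapK].
Qed.

End Atlas.
End Charts.

Lemma rV_norm_le {R : realType} n (u : 'rV[R]_n) (C : R) : 0 <= C ->
  (forall i, `|u 0 i| <= C) -> `|u| <= C.
Proof.
move=> C0 uC; rewrite [leLHS]/Num.Def.normr/= mx_normrE.
by apply: bigmax_le => // -[i j] _ /=; rewrite ord1.
Qed.

Lemma dist_continuous {R : realType} (V : normedModType R) (a : V) :
  continuous (fun z : V => `|z - a|).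
Proof.
move=> z; apply: cvg_norm; apply: cvgB; [exact: cvg_id|exact: cvg_cst].
Qed.

Lemma continuous_bigsum {R : realType} (T : topologicalType) (V : normedModType R)
    (I : Type) (s : seq I) (f : I -> T -> V) :
  (forall i, continuous (f i)) -> continuous (fun z => \sum_(i <- s) f i z).
Proof. by move=> cf z; apply: cvg_bigsum => i; exact: cf. Qed.

Lemma near_comp (T U : topologicalType) (f : T -> U) x0 (P : U -> Prop) :
  {for x0, continuous f} -> (\forall y \near f x0, P y) ->
  \forall x \near x0, P (f x).
Proof. by move=> cf; exact: cf. Qed.

Lemma near_forall (T : topologicalType) (z0 : T) (I : finType) (P : I -> T -> Prop) :
  (forall i, \forall z \near z0, P i z) -> \forall z \near z0, forall i, P i z.
Proof. by move=> h; exact: filter_forall. Qed.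

Lemma closed_ball_rV_compact {R : realType} n (a : 'rV[R]_n) (r : R) :
  compact [set z | `|z - a| <= r].
Proof.
have [r0|r0] := ltP r 0.
  suff -> : [set z : 'rV[R]_n | `|z - a| <= r] = set0 by exact: compact0.
  by apply/seteqP; split => // z /= /le_lt_trans /(_ r0); rewrite normr_lt0.
apply: bounded_closed_compact.
  exists (`|a| + r); split; first by rewrite num_real.
  move=> x /ltW ax z /= zr; apply: le_trans ax.
  rewrite -(subrK a z) addrC; apply: le_trans (ler_normD _ _) _.
  by rewrite lerD2l.
have -> : [set z : 'rV[R]_n | `|z - a| <= r] =
    (fun z : 'rV[R]_n => `|z - a|) @^-1` [set x | x <= r] by [].
have cf := @dist_continuous _ 'rV[R]_n a.
by move/continuous_closedP : cf; apply; exact: closed_le.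
Qed.

Lemma unit_sphere_rV_compact {R : realType} n : compact [set u : 'rV[R]_n | `|u| = 1].
Proof.
have sphere_closed (V : normedModType R) : closed [set u : V | `|u| = 1].
  have cf : continuous (fun z : V => `|z|) by exact: norm_continuous.
  by move/continuous_closedP : cf => /(_ [set 1]); apply; exact: closed_eq.
have -> : [set u : 'rV[R]_n | `|u| = 1] =
    [set u | `|u - 0| <= 1] `&` [set u | `|u| = 1].
  by apply/seteqP; split => [z /= z1|z []//]; rewrite subr0 z1.
by apply: compact_closedI; [exact: closed_ball_rV_compact|exact: sphere_closed].
Qed.

(** * Local comparison of a metric with the norm of the model space *)

Section MetricLower.
Context {R : realType} {E : normedModType R}.
Context (I : finType) (b : I -> E) (c : I -> E -> R) (bc : coordinates b c).

Lemma definite_lower_bound (G : E -> E -> R) :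
  (forall a u v w, G (a *: u + v) w = a * G u w + G v w) ->
  (forall u v, G u v = G v u) -> (forall u, u != 0 -> 0 < G u u) ->
  compact [set u : E | `|u| = 1] ->
  exists2 m : R, 0 < m & forall u, m * `|u| ^+ 2 <= G u u.
Proof.
move=> lin sym pos cA.
have G00 : G 0 0 = 0.
  have := lin 1 0 0 0; rewrite scale1r addr0 mul1r.
  by move/eqP; rewrite -subr_eq subrr eq_sym => /eqP.
have GZ a u : G (a *: u) (a *: u) = a ^+ 2 * G u u.
  have l1 w : G (a *: u) w = a * G u w.
    have G0w : G 0 w = 0.
      have := lin 1 0 0 w; rewrite scale1r addr0 mul1r.
      by move/eqP; rewrite -subr_eq subrr eq_sym => /eqP.
    by rewrite -[a *: u]addr0 lin G0w addr0.
  by rewrite l1 sym l1 mulrA expr2.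
pose A := [set u : E | `|u| = 1].
(* The sphere is empty when [E] is trivial, and any constant works then. *)
have [A0|/set0P A0] := eqVneq A set0.
  exists 1 => // u; have [->|u0] := eqVneq u 0.
    by rewrite normr0 expr0n mulr0 G00.
  have : A (`|u|^-1 *: u).
    by rewrite /A /= normrZ normfV normr_id mulVf// normr_eq0.
  by rewrite A0.
have cG : {within A, continuous (fun u : E => G u u)}.
  apply: continuous_subspaceT => u.
  have -> : (fun u : E => G u u) =
      (fun u : E => \sum_k \sum_l c k u * c l u * G (b k) (b l)).
    by apply/funext => z; rewrite (bilinear_coordinates bc lin sym).
  apply: continuous_bigsum => k; apply: continuous_bigsum => l z.
  have cc j : continuous (c j) by exact: (@coordinates_continuous _ _ _ _ _ j bc).
  by apply: cvgM; [apply: cvgM; exact: cc|exact: cvg_cst].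
have [v cAc cmin] := compact_EVT_min A0 cA cG.
have c1 : `|v| = 1 by move: cAc; rewrite inE.
exists (G v v); first by apply: pos; rewrite -normr_gt0 c1.
move=> u; have [->|u0] := eqVneq u 0.
  by rewrite normr0 expr0n mulr0 G00.
have nu : `|u| != 0 by rewrite normr_eq0.
have Au : `|u|^-1 *: u \in A.
  by rewrite inE /A /= normrZ normfV normr_id mulVf.
have := cmin _ Au; rewrite GZ exprVn mulrC.
by rewrite ler_pdivlMr// exprn_gt0// normr_gt0.
Qed.

Lemma metric_equivalence (G : E -> E -> E -> R) (z0 : E) :
  (forall z a u v w, G z (a *: u + v) w = a * G z u w + G z v w) ->
  (forall z u v, G z u v = G z v u) ->
  (exists2 m : R, 0 < m & forall u, m * `|u| ^+ 2 <= G z0 u u) ->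
  (forall u v, {for z0, continuous (fun z => G z u v)}) ->
  exists2 C : R, 0 < C & \forall z \near z0, forall u,
    `|u| ^+ 2 <= C * G z u u /\ G z u u <= C * `|u| ^+ 2.
Proof.
move=> lin sym [m m0 mG] cont.
pose N : R := \sum_(k : I) \sum_(l : I) 1.
have N0 : 0 <= N by apply: sumr_ge0 => k _; exact: sumr_ge0.
(* If the coefficients of [G z] and [G z0] differ by at most [d], the quadratic forms differ by at
   most half of the lower bound [m]. *)
pose d := (m / 2) / (N + 1).
have d0 : 0 < d by rewrite divr_gt0// ?divr_gt0// ltr_wpDl.
have Nd : (\sum_(k : I) \sum_(l : I) d) <= m / 2.
  have -> : \sum_(k : I) \sum_(l : I) d = N * d.
    rewrite mulr_suml; apply: eq_bigr => k _; rewrite mulr_suml.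
    by apply: eq_bigr => l _; rewrite mul1r.
  rewrite /d mulrCA -[leRHS]mulr1 ler_pM2l ?divr_gt0//.
  by rewrite ler_pdivrMr ?mul1r ?lerDl// ltr_wpDl.
have close : \forall z \near z0, forall k l : I,
    `|G z (b k) (b l) - G z0 (b k) (b l)| <= d.
  have nkl (kl : I * I) : \forall z \near z0,
      `|G z (b kl.1) (b kl.2)
        - G z0 (b kl.1) (b kl.2)| <= d.
    have /cvgrPdist_le/(_ d d0) := cont (b kl.1) (b kl.2).
    by apply: filterS => z; rewrite distrC.
  by have := near_forall nkl; apply: filterS => z zkl k l; exact: zkl (k, l).
pose B : R := \sum_(k : I) \sum_(l : I)
  \sum_(k' : I) \sum_(l' : I) `|G z0 (b k') (b l')|.
have B0 : 0 <= B by do 4 (apply: sumr_ge0 => ? _).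
exists (2 / m + B + m / 2).
  by rewrite ltr_wpDl ?divr_gt0// addr_ge0// ltW// divr_gt0.
near=> z => u.
have zd : forall k l : I,
    `|G z (b k) (b l) - G z0 (b k) (b l)| <= d.
  by near: z.
have du : `|G z u u - G z0 u u| <= m / 2 * `|u| ^+ 2.
  apply: le_trans (@bilinear_bound _ _ _ _ _ bc
    (fun u v => G z u v - G z0 u v) d _ _ _ u) _ => //.
  - by move=> a u' v w; rewrite !lin mulrBr opprD addrACA.
  - by move=> u' v; rewrite !(sym _ u').
  - by rewrite ler_wpM2r ?sqr_ge0.
have Bu : G z0 u u <= B * `|u| ^+ 2.
  apply: le_trans (ler_norm _) _.
  apply: (bilinear_bound bc (lin z0) (sym z0)) => k l.
  rewrite (bigD1 k)//= (bigD1 l)//= -addrA lerDl addr_ge0//.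
    exact: sumr_ge0.
  by apply: sumr_ge0 => ? _; exact: sumr_ge0.
have mu := mG u.
have s0 : 0 <= `|u| ^+ 2 by rewrite sqr_ge0.
set s := `|u| ^+ 2 in du Bu mu s0 *.
move: du; rewrite ler_norml => /andP[du1 du2].
have lo : m / 2 * s <= G z u u by lra.
have G0 : 0 <= G z u u by rewrite (le_trans _ lo)// mulr_ge0// divr_ge0// ltW.
split.
  apply: (@le_trans _ _ (2 / m * G z u u)).
    have := ler_wpM2l (ltW (divr_gt0 (ltr0n R 2) m0)) lo.
    by have -> : 2 / m * (m / 2 * s) = s by field; rewrite gt_eqF.
  by rewrite ler_wpM2r// -addrA lerDl addr_ge0// ltW// divr_gt0.
apply: (@le_trans _ _ ((B + m / 2) * s)); first lra.
by rewrite ler_wpM2r// -addrA lerDr ltW// divr_gt0.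
Unshelve. all: by end_near. Qed.

End MetricLower.

(** * Curves read in a fixed chart *)

Section CurveInChart.
Context {R : realType} {E : normedModType R}.
Context (I : finType) (b : I -> E) (c : I -> E -> R) (bc : coordinates b c).
Context (M : topologicalType) (B : set (chart M E)) (hB : smooth_atlas B).
Context (S : charted M E) (SB : atlas S `<=` B) (hS : smooth_manifold S).

Lemma C1_comp_curve (F : normedModType R) (U : set E) (h : R -> E) (k : E -> F) (t : R) :
  open U -> U (h t) -> Ck 1 U k ->
  (\forall s \near t, derivable h s 1) -> {for t, continuous (derive1 h)} ->
  (\forall s \near t, is_derive s (1 : R) (k \o h) ('d k (h s) (derive1 h s))) /\
  {for t, continuous (derive1 (k \o h))}.
Proof.
move=> oU Ut Ck dh ch.
have dht : differentiable h t by apply/derivable1_diffP; exact: nbhs_singleton dh.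
have hct : {for t, continuous h} := differentiable_continuous dht.
have nU : \forall s \near t, U (h s).
  by apply: hct; exact: open_nbhs_nbhs.
have nd : \forall s \near t, is_derive s (1 : R) (k \o h) ('d k (h s) (derive1 h s)).
  apply: filterS2 nU dh => s Us ds.
  have dhs : differentiable h s by exact/derivable1_diffP.
  have dk : differentiable k (h s) := C1_diff Ck Us.
  have dkh : differentiable (k \o h) s by exact: differentiable_comp.
  apply: DeriveDef; first exact/derivable1_diffP.
  by rewrite deriveE// diff_comp//= derive1E deriveE.
split => //.
have e : {near t, (fun s => \sum_j c j (derive1 h s) *: 'D_(b j) k (h s)) =1
    derive1 (k \o h)}.
  apply: filterS2 nU nd => s Us [_ kE].
  rewrite [RHS]derive1E kE.
  have dk : differentiable k (h s) := C1_diff Ck Us.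
  by rewrite -(diff_coordinates bc).
rewrite /prop_for /continuous_at -(nbhs_singleton e).
apply: cvg_trans (near_eq_cvg e) _; apply: cvg_bigsum => j; apply: cvgZ.
  have cc : continuous (c j) by exact: (@coordinates_continuous _ _ _ _ _ j bc).
  apply: (@cvg_comp _ _ _ (derive1 h) (c j)); first exact: ch.
  exact: cc.
apply: (@cvg_comp _ _ _ h ('D_(b j) k)); first exact: hct.
exact: (C1_derive Ck Ut).
Qed.

Lemma C1_curve_continuous (k : R -> M) (t : R) : C1_curve S k -> t \in `[0, 1] ->
  {for t, continuous k}.
Proof.
move=> Ck tI; have [dom der _] := Ck t tI.
set e0 := chart_at S (k t) in dom der *.
have te := atlas_chart hB (chart_at_B SB hS (k t)).
have dht : differentiable (chart_map e0 \o k) t.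
  by apply/derivable1_diffP; exact: nbhs_singleton der.
have hct : {for t, continuous (chart_map e0 \o k)} := differentiable_continuous dht.
have e : {near t, chart_inv e0 \o (chart_map e0 \o k) =1 k}.
  by apply: filterS dom => s ds; rewrite /= (chart_mapK te).
rewrite /prop_for /continuous_at -(nbhs_singleton e).
apply: cvg_trans (near_eq_cvg e) _; apply: cvg_comp; first exact: hct.
by apply: (chart_inv_continuous te); apply: chart_map_image; exact: chart_at_dom hS _.
Qed.

(** The preferred chart used in [velocity] may jump with [t]. Reading the curve in one chart [e]
    around [k t] gives a derivative that is continuous at [t], to which the fundamental theorem of
    calculus can be applied. *)
Lemma C1_curve_chart (k : R -> M) (t : R) e : C1_curve S k -> t \in `[0, 1] ->
  B e -> chart_dom e (k t) ->
  [/\ is_derive t (1 : R) (chart_map e \o k) (to_chart S e (k t) (velocity S k t)),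
   \forall s \near t, derivable (chart_map e \o k) s (1 : R) &
  {for t, continuous (derive1 (chart_map e \o k))}].
Proof.
move=> Ck tI Be ekt; have [dom der cd] := Ck t tI.
set e0 := chart_at S (k t) in dom der cd *.
have Be0 : B e0 := chart_at_B SB hS (k t).
have te := atlas_chart hB Be; have te0 := atlas_chart hB Be0.
have oU : open (chart_image e0 (chart_dom e)).
  by apply: chart_image_open => //; exact: chart_dom_open.
have Ut : chart_image e0 (chart_dom e) ((chart_map e0 \o k) t).
  by apply: image_in => //; exact: chart_at_dom hS _.
have [nd ct] := C1_comp_curve oU Ut (transition_C1 hB Be0 Be) der cd.
have ne : {near t, transition e0 e \o (chart_map e0 \o k) =1 chart_map e \o k}.
  by apply: filterS dom => s ds; rewrite /transition /= (chart_mapK te0).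
split.
- by apply: near_eq_is_derive ne _; exact: nbhs_singleton nd.
- have := near_join ne; apply: filterS2 nd => s [ds _] nes.
  exact: near_eq_derivable nes ds.
have ne' : {near t, derive1 (transition e0 e \o (chart_map e0 \o k)) =1
    derive1 (chart_map e \o k)}.
  have : \forall s \near t, {near s, transition e0 e \o (chart_map e0 \o k) =1
    chart_map e \o k} by exact: near_join ne.
  by apply: filterS => s hs; rewrite !derive1E; exact: near_eq_derive.
rewrite /prop_for /continuous_at -(nbhs_singleton ne').
exact: cvg_trans (near_eq_cvg ne') ct.
Qed.

Lemma C1_curve_coord (k : R -> M) (t : R) e i : C1_curve S k -> t \in `[0, 1] ->
  B e -> chart_dom e (k t) ->
  is_derive t (1 : R) (fun s => c i (chart_map e (k s)))
    (c i (to_chart S e (k t) (velocity S k t))) /\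
  {for t, continuous (derive1 (fun s => c i (chart_map e (k s))))}.
Proof.
move=> Ck tI Be ekt; have [dk nk ck] := C1_curve_chart Ck tI Be ekt.
have lin : linear (c i) by case: bc => lin _ _ a u v; exact: lin.
have ci : continuous (c i) by exact: (@coordinates_continuous _ _ _ _ _ i bc).
have Ci : Defs.Ck 1 setT (c i) by exact: C1_linear.
have [nd cd] := C1_comp_curve openT Logic.I Ci nk ck.
split; last exact: cd.
have := nbhs_singleton nd.
have [_ E1] := dk; rewrite derive1E E1.
by rewrite (diff_linear ((chart_map e \o k) t) (to_chart S e (k t) (velocity S k t)) lin ci).
Qed.

End CurveInChart.

(** * Paths leaving a chart ball *)

(* The increment is compared with the integral of any pointwise majorant of the
   derivative, which need not be measurable. *)
Lemma derive_increment_le {R : realType} (F : R -> R) (t C : R) (N : R -> R) :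
  0 <= t <= 1 -> 0 < C ->
  (forall s : R, s \in `[0, t] -> derivable F s 1) ->
  (forall s : R, s \in `[0, t] -> {for s, continuous (derive1 F)}) ->
  (forall s, 0 <= N s) ->
  (forall s : R, s \in `[0, t] -> `|derive1 F s| <= C * N s) ->
  (`|F t - F 0|%:E <= C%:E * \int[lebesgue_measure]_(s in `[0%R, 1%R]) (N s)%:E)%E.
Proof.
move=> /andP[t0 t1] C0 dF cF N0 FN.
have [->|tn0] := eqVneq t 0.
  rewrite subrr normr0 mule_ge0// ?lee_fin ?(ltW C0)//.
  by apply: integral_ge0 => s _; rewrite lee_fin.
have {}t0 : 0 < t by rewrite lt0r tn0.
have cFt : {within `[0, t], continuous (derive1 F)}.
  by apply: continuous_in_subspaceT => s; rewrite inE => sI; exact: cF.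
have cFs (s : R) : s \in `[0, t] -> {for s, continuous F}.
  by move=> sI; apply: differentiable_continuous; apply/derivable1_diffP; exact: dF.
have LR : derivable_oo_LRcontinuous F 0 t.
  split.
  - by move=> s sI; apply: dF; exact: subset_itv_oo_cc.
  - by apply: cvg_at_right_filter; apply: cFs; rewrite in_itv/= lexx ltW.
  - by apply: cvg_at_left_filter; apply: cFs; rewrite in_itv/= lexx ltW.
pose f : R -> R := derive1 F.
have FTC : (\int[lebesgue_measure]_(s in `[0%R, t]) (f s)%:E = (F t)%:E - (F 0)%:E)%E.
  by apply: continuous_FTC2.
have iF := continuous_compact_integrable (@segment_compact _ 0 t) cFt.
have /integrableP[mF _] := iF; have /integrableP[mA _] := integrable_abse iF.
have -> : `|F t - F 0|%:E = `|\int[lebesgue_measure]_(s in `[0%R, t]) (f s)%:E|%E.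
  by rewrite FTC -EFinB.
rewrite -lee_pdivrMl//.
apply: (@le_trans _ _ ((C^-1)%:E * \int[lebesgue_measure]_(s in `[0%R, t]) `|(f s)%:E|)%E).
  rewrite lee_pmul2l// ?lte_fin ?invr_gt0//.
  exact: le_abse_integral.
rewrite -ge0_integralZl//; last by rewrite lee_fin invr_ge0 ltW.
apply: ge0_integral_le.
- by move=> s; rewrite /= !in_itv/= => /andP[-> st]; exact: le_trans st t1.
- by move=> s _; rewrite mule_ge0// lee_fin invr_ge0 ltW.
- by move=> s _; rewrite lee_fin.
- by move=> s sI; rewrite -EFinM lee_fin ler_pdivrMl// FN.
Qed.

Section LocalDistance.
Context {R : realType} {n : nat}.
Local Notation E := 'rV[R]_n.
Context (M : topologicalType) (hM : hausdorff_space M).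
Context (B : set (chart M E)) (hB : smooth_atlas B).
Context (S : charted M E) (SB : atlas S `<=` B) (hS : smooth_manifold S).
Context (g : M -> E -> E -> R) (hg : riemannian_metric S g).
Let bc := @rV_coordinates R n.

Section ExitTime.
Context (e : chart M E) (Be : B e) (z0 : E) (r0 C : R).
Hypotheses (C0 : 0 < C) (im : [set z | `|z - z0| <= r0] `<=` chart_image e setT).
Hypothesis bd : forall x v, chart_dom e x -> `|chart_map e x - z0| <= r0 ->
  `|to_chart S e x v| <= C * rnorm g x v.

Let te := atlas_chart hB Be.
Let U := [set x | chart_dom e x /\ `|chart_map e x - z0| < r0].
Let K r := [set x | chart_dom e x /\ `|chart_map e x - z0| <= r].

Lemma chart_ball_open : open U.
Proof.
have -> : U = chart_dom e `&` [set x | `|chart_map e x - z0| < r0] by [].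
rewrite openE => x [ex xr]; rewrite /interior.
apply: filterI; first by apply: open_nbhs_nbhs; split => //; exact: chart_dom_open.
have cf : {for x, continuous (fun x => `|chart_map e x - z0|)}.
  apply: (@continuous_comp _ _ _ (chart_map e) (fun z => `|z - z0|)).
    exact: chart_map_continuous.
  exact: dist_continuous.
exact: (cf _ (lt_nbhsl xr)).
Qed.

(** Closed in all of M, not only in the chart domain: it is the image of a compact ball in a
    Hausdorff space. A curve therefore cannot leave it through a limit point outside of the
    chart. *)
Lemma chart_ball_closed r : r <= r0 -> closed (K r).
Proof.
move=> rr0; have -> : K r = chart_inv e @` [set z | `|z - z0| <= r].
  apply/seteqP; split => [x [ex xr]|_ [z /= zr <-]].
    by exists (chart_map e x) => //; rewrite (chart_mapK te).
  have iz : chart_image e setT z by apply: im; exact: le_trans zr rr0.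
  by split; [exact: chart_image_dom te _ iz|rewrite (chart_invK te)].
apply: compact_closed => //; apply: continuous_compact; last exact: closed_ball_rV_compact.
apply: continuous_in_subspaceT => z /[!inE] zr.
by apply: (chart_inv_continuous te); apply: im; exact: le_trans zr rr0.
Qed.

(** The norm is a maximum over coordinates, so the scalar estimate [derive_increment_le] applied to
    each coordinate loses no constant. *)
Lemma curve_stays_estimate (k : R -> M) (t : R) : C1_curve S k -> t \in `[0, 1] ->
  (forall s : R, s \in `[0, t] -> U (k s)) ->
  (`|chart_map e (k t) - chart_map e (k 0)|%:E <= C%:E * curve_length S g k)%E.
Proof.
move=> Cc tI kU; move: (tI); rewrite in_itv/= => /andP[t0 t1].
have sI (s : R) : s \in `[0, t] -> s \in `[0, 1].
  by rewrite !in_itv/= => /andP[-> st]; exact: le_trans st t1.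
have L0 : (0 <= curve_length S g k)%E := curve_length_ge0 S g k.
have [->|Lfin] := eqVneq (curve_length S g k) +oo%E.
  by rewrite gt0_muley ?leey// lte_fin.
have fl : curve_length S g k \is a fin_num by rewrite ge0_fin_numE// ltey.
rewrite -(fineK fl) -EFinM lee_fin; apply: rV_norm_le.
  by apply: mulr_ge0; [exact: ltW|exact: fine_ge0].
move=> i; rewrite -lee_fin EFinM (fineK fl).
pose F (s : R) : R := chart_map e (k s) 0 i.
have dF (s : R) : s \in `[0, t] ->
    is_derive s (1 : R) F ((to_chart S e (k s) (velocity S k s)) 0 i) /\
    {for s, continuous (derive1 F)}.
  move=> st; have [eks _] := kU s st.
  exact: (C1_curve_coord bc hB SB hS i Cc (sI s st) Be eks).
have -> : (chart_map e (k t) - chart_map e (k 0)) 0 i = F t - F 0.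
  by rewrite !mxE.
apply: derive_increment_le => //.
- by move=> s st; have [ds _] := dF s st; exact: (@ex_derive _ _ _ _ _ _ _ ds).
- by move=> s /dF[].
- by move=> s; exact: sqrtr_ge0.
- move=> s st; have [[_ +] _] := dF s st; rewrite derive1E => ->.
  have [eks /ltW kr] := kU s st; apply: le_trans (bd _ eks kr).
  by case: bc => _ + _; exact.
Qed.

(** Continuity method. [J] is the set of times up to which the curve stays in the open ball [U]. The
    length estimate puts the points reached on [J] in the smaller closed ball [K r], so the supremum
    [T] of [J] belongs to [J]; if [T < 1], openness of [U] extends [J] beyond [T]. *)
Lemma curve_stays (k : R -> M) (l r : R) : C1_curve S k ->
  (curve_length S g k <= l%:E)%E -> chart_dom e (k 0) ->
  `|chart_map e (k 0) - z0| + C * l <= r -> r < r0 ->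
  chart_dom e (k 1) /\ `|chart_map e (k 1) - chart_map e (k 0)| <= C * l.
Proof.
move=> Cc Ll ek0 k0r rr0.
have l0 : 0 <= l by rewrite -lee_fin (le_trans _ Ll)// curve_length_ge0.
have KU x : K r x -> U x by move=> [ex xr]; split => //; exact: le_lt_trans xr rr0.
have Cl0 : 0 <= C * l by apply: mulr_ge0 => //; exact: ltW.
have k0K : K r (k 0) by split => //; apply: le_trans k0r; rewrite lerDl.
pose J := [set t : R | t \in `[0, 1] /\ forall s : R, s \in `[0, t] -> U (k s)].
have est (t : R) : J t -> `|chart_map e (k t) - chart_map e (k 0)| <= C * l.
  move=> [tI tU]; have := curve_stays_estimate Cc tI tU.
  rewrite -lee_fin => /le_trans; apply; by rewrite EFinM lee_pmul2l.
have JK (t : R) : J t -> K r (k t).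
  move=> Jt; have [tI tU] := Jt; split.
    by have [] : U (k t) by apply: tU; move: tI; rewrite !in_itv/= lexx => /andP[->].
  rewrite -(subrK (chart_map e (k 0)) (chart_map e (k t))) -addrA addrC.
  apply: le_trans (ler_normD _ _) _; apply: le_trans k0r; rewrite lerD2l; exact: est.
have J0 : J 0.
  split; first by rewrite in_itv/= lexx ler01.
  move=> s; rewrite in_itv/= -eq_le => /eqP <-; exact: KU.
have ubJ : ubound J 1 by move=> t [+ _]; rewrite in_itv/= => /andP[].
have hsJ : has_sup J by split; [exists 0|exists 1].
pose T := sup J.
have T0 : 0 <= T by apply: sup_upper_bound.
have T1 : T <= 1 by apply: ge_sup => //; exists 0.
have TI : T \in `[0, 1] by rewrite in_itv/= T0.
have below (s : R) : 0 <= s -> s < T -> J s.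
  move=> s0 sT; have e0 : 0 < T - s by rewrite subr_gt0.
  have [t [tI tU] st] := sup_adherent e0 hsJ.
  have {}st : s < t by move: st; rewrite -/T opprB addrC subrK.
  move: tI; rewrite in_itv/= => /andP[t0 t1].
  split; first by rewrite in_itv/= s0 (le_trans (ltW st)).
  move=> u; rewrite in_itv/= => /andP[u0 us]; apply: tU.
  by rewrite in_itv/= u0 (le_trans us)// ltW.
have ckT : {for T, continuous k} := C1_curve_continuous hB SB hS Cc TI.
have kTK : K r (k T).
  have [->//|Tn0] := eqVneq T 0.
  have {}Tn0 : 0 < T by rewrite lt0r Tn0.
  have cK := chart_ball_closed (ltW rr0).
  apply: (@closed_cvg _ _ (at_left T) _ k (K r) cK); last exact: cvg_at_left_filter.
  near=> s; apply: JK; apply: below; last by near: s; exact: nbhs_left_lt.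
  by apply: ltW; near: s; exact: nbhs_left_gt.
have JT : J T.
  split => // s; rewrite in_itv/= => /andP[s0]; rewrite le_eqVlt => /predU1P[->|sT].
    exact: KU.
  by apply/KU/JK; exact: below.
suff T1' : T = 1 by rewrite -T1'; split; [have [] := kTK|exact: est].
apply/eqP; rewrite eq_le T1/= leNgt; apply/negP => Tlt1.
have nU : \forall s \near T, U (k s).
  by apply: ckT; apply: open_nbhs_nbhs; split; [exact: chart_ball_open|exact: KU].
have [d /= d0 dU] := (nbhs_ballP _ _).1 nU.
pose T' := Num.min (T + d / 2) 1.
have TT' : T < T' by rewrite lt_min Tlt1 ltrDl divr_gt0.
have JT' : J T'.
  split; first by rewrite in_itv/= (le_trans T0 (ltW TT'))/= ge_min lexx orbT.
  move=> s; rewrite in_itv/= => /andP[s0 sT'].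
  have [sT|Ts] := leP s T; first by have [_] := JT; apply; rewrite in_itv/= s0.
  apply: dU; rewrite /ball/= distrC ger0_norm ?subr_ge0 ?(ltW Ts)//.
  rewrite ltrBlDl; apply: le_lt_trans sT' _; rewrite gt_min; apply/orP; left.
  by rewrite ltrD2l ltr_pdivrMr// mulr_natr mulr2n ltrDl.
by have := sup_upper_bound hsJ JT'; rewrite leNgt TT'.
Unshelve. all: by end_near. Qed.

(** Induction on the path with a length budget: the first curve spends [l1] and moves the starting
    point by at most [C * l1], so the remaining path satisfies the same hypothesis with the same [r]
    and the budget [l2]. *)
Lemma path_stays (p : seq (R -> M)) x y (l r : R) : piecewise_C1 S x p y ->
  (\sum_(k <- p) curve_length S g k <= l%:E)%E -> chart_dom e x ->
  `|chart_map e x - z0| + C * l <= r -> r < r0 ->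
  chart_dom e y /\ `|chart_map e y - chart_map e x| <= C * l.
Proof.
elim: p x l => [|k p IH] x l /=.
  move=> <- + ex _ _; rewrite big_nil lee_fin => l0.
  split => //; rewrite subrr normr0; apply: mulr_ge0 => //; exact: ltW.
move=> [Cc kx kp]; rewrite big_cons => Ll ex xr rr0.
have L1 := curve_length_ge0 S g k; have L2 := path_length_ge0 S g p.
have f1 : curve_length S g k \is a fin_num.
  by rewrite ge0_fin_numE// (le_lt_trans (leeDl _ L2))// (le_lt_trans Ll)// ltry.
have f2 : (\sum_(c <- p) curve_length S g c)%E \is a fin_num.
  by rewrite ge0_fin_numE// (le_lt_trans (leeDr _ L1))// (le_lt_trans Ll)// ltry.
set l1 := fine (curve_length S g k).
set l2 := fine (\sum_(c <- p) curve_length S g c)%E.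
have l12 : l1 + l2 <= l by rewrite -lee_fin EFinD /l1 /l2 !fineK.
have l20 : 0 <= l2 by exact: fine_ge0.
have kL1 : (curve_length S g k <= l1%:E)%E by rewrite /l1 fineK.
have l10 : 0 <= l1 by exact: fine_ge0.
have kr1 : `|chart_map e (k 0) - z0| + C * l1 <= r.
  by rewrite kx; apply: le_trans xr; rewrite lerD2l ler_pM2l//; lra.
have ek0 : chart_dom e (k 0) by rewrite kx.
have [ek1 ek] := curve_stays Cc kL1 ek0 kr1 rr0.
rewrite kx in ek.
have L2l : (\sum_(c <- p) curve_length S g c <= l2%:E)%E by rewrite /l2 fineK.
have [|ey eyk] := IH (k 1) l2 kp L2l ek1 _ rr0.
  rewrite -(subrK (chart_map e x) (chart_map e (k 1))) -addrA.
  have := ler_normD (chart_map e (k 1) - chart_map e x) (chart_map e x - z0).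
  have : C * (l1 + l2) <= C * l by rewrite ler_pM2l.
  lra.
split => //.
rewrite -(subrK (chart_map e (k 1)) (chart_map e y)) -addrA.
have := ler_normD (chart_map e y - chart_map e (k 1)) (chart_map e (k 1) - chart_map e x).
have : C * (l1 + l2) <= C * l by rewrite ler_pM2l.
lra.
Qed.

Lemma rdist_stays x y (r : R) : chart_dom e x ->
  (`|chart_map e x - z0|%:E + C%:E * rdist S g x y <= r%:E)%E -> r < r0 ->
  chart_dom e y /\
  (`|chart_map e y - chart_map e x|%:E <= C%:E * rdist S g x y)%E.
Proof.
move=> ex xr rr0; have d0 := rdist_ge0 S g x y.
have fd : rdist S g x y \is a fin_num.
  rewrite ge0_fin_numE// ltNge leye_eq; apply/eqP => de.
  by move: xr; rewrite de gt0_muley ?lte_fin// addey// leye_eq.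
set d := fine (rdist S g x y).
have dE : rdist S g x y = d%:E by rewrite /d fineK.
(* The infimum need not be attained: a path of length below [d + h] is used, and the margin [r0 - r]
   pays for [C * h]. *)
have key (h : R) : 0 < h -> C * h < r0 - r ->
    chart_dom e y /\ `|chart_map e y - chart_map e x| <= C * (d + h).
  move=> h0 hr.
  have [_ [p px <-] lp] := @lb_ereal_inf_adherent _ _ _ h0 fd.
  apply: (path_stays px _ ex _ (_ : r + C * h < r0)); last by lra.
    by rewrite EFinD -dE ltW.
  by rewrite mulrDr addrA lerD2r -lee_fin EFinD EFinM -dE.
have e0 : 0 < (r0 - r) / (2 * C) by rewrite divr_gt0 ?mulr_gt0// subr_gt0.
split.
  have [] // := key _ e0.
  rewrite (_ : C * _ = (r0 - r) / 2); [lra|by field; rewrite gt_eqF].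
rewrite dE -EFinM lee_fin; apply/ler_addgt0Pr => h h0.
pose h' := Num.min (h / C) ((r0 - r) / (2 * C)).
have h'0 : 0 < h' by rewrite lt_min divr_gt0.
have [|_ le] := key h' h'0.
  apply: (@le_lt_trans _ _ (C * ((r0 - r) / (2 * C)))).
    by rewrite ler_pM2l// ge_min lexx orbT.
  rewrite (_ : C * _ = (r0 - r) / 2); [lra|by field; rewrite gt_eqF].
apply: le_trans le _; rewrite mulrDr lerD2l.
by rewrite -ler_pdivlMl// ge_min mulrC lexx.
Qed.

End ExitTime.
End LocalDistance.

(** * Local and uniform metric estimates *)

Section LocalEstimates.
Context {R : realType} {n : nat}.
Local Notation E := 'rV[R]_n.
Context (M : topologicalType) (hM : hausdorff_space M).
Context (B : set (chart M E)) (hB : smooth_atlas B).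
Context (S : charted M E) (SB : atlas S `<=` B) (hS : smooth_manifold S).
Context (g : M -> E -> E -> R) (hg : riemannian_metric S g).
Let bc := @rV_coordinates R n.

Lemma near_chart_map e x0 (P : E -> Prop) : B e -> chart_dom e x0 ->
  (\forall z \near chart_map e x0, P z) ->
  \forall x \near x0, chart_dom e x /\ P (chart_map e x).
Proof.
move=> Be ex0 nP; have te := atlas_chart hB Be.
have n1 : nbhs x0 (chart_dom e).
  by apply: open_nbhs_nbhs; split => //; exact: chart_dom_open.
have n2 := chart_map_continuous te ex0 nP.
by apply: filterS2 n1 n2.
Qed.

Lemma near_chart_ball e x0 r : B e -> chart_dom e x0 -> 0 < r ->
  \forall x \near x0, chart_dom e x /\ `|chart_map e x - chart_map e x0| < r.
Proof.
move=> Be ex0 r0.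
apply: (@near_chart_map e x0 (fun z => `|z - chart_map e x0| < r)) => //.
by apply/nbhs_ballP; exists r => //= z; rewrite -ball_normE /= distrC.
Qed.

Lemma near_dom_chart e x0 : B e -> chart_dom e x0 ->
  \forall x \near x0, chart_dom e x.
Proof.
by move=> Be ex0; apply: filterS (near_chart_ball Be ex0 ltr01) => x [].
Qed.

Lemma dtrans_bounded e e' x0 : B e -> B e' -> chart_dom e x0 -> chart_dom e' x0 ->
  exists2 C : R, 0 < C & \forall x \near x0, forall u, `|dtrans e e' x u| <= C * `|u|.
Proof.
move=> Be Be' ex0 ex0'.
have te := atlas_chart hB Be; have te' := atlas_chart hB Be'.
have oU : open (chart_image e (chart_dom e')).
  by apply: chart_image_open => //; exact: chart_dom_open.
have [C C0 nC] := C1_diff_bounded bc oU (image_in ex0 ex0') (transition_C1 hB Be Be').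
exists C => //; apply: filterS (near_chart_map Be ex0 nC) => x [ex xC] u.
exact: xC.
Qed.

Lemma dtrans_lipschitz e e' x0 : B e -> B e' -> chart_dom e x0 -> chart_dom e' x0 ->
  exists2 C : R, 0 < C & exists2 V : set M, nbhs x0 V & forall x y u, V x -> V y ->
    `|dtrans e e' x u - dtrans e e' y u| <=
    C * `|chart_map e x - chart_map e y| * `|u|.
Proof.
move=> Be Be' ex0 ex0'.
have te := atlas_chart hB Be; have te' := atlas_chart hB Be'.
have oU : open (chart_image e (chart_dom e')).
  by apply: chart_image_open => //; exact: chart_dom_open.
have [C [r [C0 r0 lip]]] := C1_diff_lipschitz bc bc oU (image_in ex0 ex0')
  (transition_C1 hB Be Be') (fun v => transition_derive_C1 hB v Be Be').
exists C => //; eexists; first exact: (near_chart_ball Be ex0 r0).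
by move=> x y u [_ xr] [_ yr]; exact: lip.
Qed.

(** Smoothness of the metric is given in the charts of [atlas S], while [e] is any chart of [B]. The
    comparison is made in the preferred chart [e0] and carried over by the derivatives of the
    transition maps, bounded near [x0]. *)
Lemma metric_chart e x0 : B e -> chart_dom e x0 ->
  exists2 C : R, 0 < C & \forall x \near x0, chart_dom e x /\ forall v,
    `|to_chart S e x v| <= C * rnorm g x v /\ rnorm g x v <= C * `|to_chart S e x v|.
Proof.
move=> Be ex0; have [lin sym pos sm] := hg.
pose e0 := chart_at S x0.
have Se0 : atlas S e0 := chart_at_atlas hS x0.
have Be0 := SB Se0; have e0x0 : chart_dom e0 x0 := chart_at_dom hS x0.
have te0 := atlas_chart hB Be0.
pose G z u v := let x := chart_inv e0 z in g x (of_chart S e0 x u) (of_chart S e0 x v).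
have linG z a u v w : G z (a *: u + v) w = a * G z u w + G z v w.
  by rewrite /G /of_chart linearP lin.
have symG z u v : G z u v = G z v u by exact: sym.
have G0 : exists2 m : R, 0 < m & forall u, m * `|u| ^+ 2 <= G (chart_map e0 x0) u u.
  apply: (definite_lower_bound bc); [exact: linG|exact: symG| |].
    move=> u u0; rewrite /G /= (chart_mapK te0)//; apply: pos.
    apply: contra u0 => /eqP h; rewrite -(to_chartK hB SB hS u Be0 e0x0) h.
    by rewrite /to_chart linear0.
  exact: unit_sphere_rV_compact.
have cG u v : {for chart_map e0 x0, continuous (fun z => G z u v)}.
  by apply: (sm e0 Se0 u v 0); exact: chart_map_image.
have [C C0 nC] := metric_equivalence bc linG symG G0 cG.
have [C1 C10 n1] := dtrans_bounded Be0 Be e0x0 ex0.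
have [C2 C20 n2] := dtrans_bounded Be Be0 ex0 e0x0.
have sC0 : 0 < Num.sqrt C by rewrite sqrtr_gt0.
exists (Num.sqrt C * (C1 + C2)); first by rewrite mulr_gt0// addr_gt0.
have nd := near_dom_chart Be ex0.
have nG := near_chart_map Be0 e0x0 nC.
near=> x.
have ex : chart_dom e x by near: x.
have [e0x xG] : chart_dom e0 x /\ forall u : E,
    `|u| ^+ 2 <= C * G (chart_map e0 x) u u /\ G (chart_map e0 x) u u <= C * `|u| ^+ 2.
  by near: x.
have x1 : forall u, `|dtrans e0 e x u| <= C1 * `|u| by near: x.
have x2 : forall u, `|dtrans e e0 x u| <= C2 * `|u| by near: x.
split=> // v; set u := to_chart S e0 x v.
have gv : G (chart_map e0 x) u u = g x v v.
  by rewrite /G /= (chart_mapK te0)// (of_chartK hB SB hS).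
have gpos : 0 <= g x v v.
  have [->|v0] := eqVneq v 0; last exact/ltW/pos.
  have := lin x 1 0 0 0; rewrite scale1r addr0 mul1r => /eqP.
  by rewrite -subr_eq subrr => /eqP <-.
have [u1 u2] := xG u; rewrite gv in u1 u2.
have ru : rnorm g x v <= Num.sqrt C * `|u|.
  rewrite /rnorm -[`|u|]normr_id -(sqrtr_sqr `|u|) -sqrtrM ?(ltW C0)//.
  by rewrite ler_wsqrtr.
have ur : `|u| <= Num.sqrt C * rnorm g x v.
  rewrite /rnorm -sqrtrM ?(ltW C0)// -[leLHS]normr_id -(sqrtr_sqr `|u|).
  by rewrite ler_wsqrtr.
split.
  rewrite -(to_chart_trans hB SB hS v Be0 Be e0x ex) -/u.
  apply: le_trans (x1 u) _; rewrite [leRHS]mulrAC mulrC.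
  apply: ler_pM => //; first exact: ltW.
  by rewrite lerDl ltW.
apply: le_trans ru _.
rewrite /u -(to_chart_trans hB SB hS v Be Be0 ex e0x) -mulrA ler_pM2l//.
by apply: le_trans (x2 _) _; rewrite ler_wpM2r// lerDr ltW.
Unshelve. all: by end_near. Qed.

Lemma rdist_le_chart e x0 : atlas S e -> chart_dom e x0 ->
  exists2 C : R, 0 < C & exists2 V : set M, nbhs x0 V & forall x y, V x -> V y ->
    (rdist S g x y <= (C * `|chart_map e x - chart_map e y|)%:E)%E.
Proof.
move=> Se ex0; have Be := SB Se; have te := atlas_chart hB Be.
have oi : open (chart_image e setT) by case: te.
have [r /= r0 rP] := (nbhs_ballP _ _).1
  (open_nbhs_nbhs (conj oi (chart_map_image ex0))).
pose K := [set z : E | `|z - chart_map e x0| <= r / 2].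
have Kim : K `<=` chart_image e setT.
  move=> z /= zr; apply: rP; rewrite -ball_normE /= distrC (le_lt_trans zr)//.
  by rewrite ltr_pdivrMr// mulr_natr mulr2n ltrDl.
have Kconv z1 z2 t : K z1 -> K z2 -> t \in `[0, 1] -> K (segment z1 z2 t).
  rewrite /K /= in_itv/= => k1 k2 /andP[t0 t1].
  rewrite (_ : segment z1 z2 t - chart_map e x0 =
    (1 - t) *: (z1 - chart_map e x0) + t *: (z2 - chart_map e x0)).
    apply: le_trans (ler_normD _ _) _; rewrite !normrZ !ger0_norm ?subr_ge0//.
    have h1 : (1 - t) * `|z1 - chart_map e x0| <= (1 - t) * (r / 2).
      by rewrite ler_wpM2l ?subr_ge0.
    have h2 : t * `|z2 - chart_map e x0| <= t * (r / 2) by rewrite ler_wpM2l.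
    lra.
  rewrite /segment scalerBl scale1r.
  have -> : z2 - z1 = (z2 - chart_map e x0) - (z1 - chart_map e x0).
    by rewrite [in RHS]opprB [in RHS]addrA subrK.
  by rewrite scalerBr addrAC -[RHS]addrA; congr (_ + _); rewrite addrC.
have [C C0 CP] := segment_rdist_compact bc hg Se (@closed_ball_rV_compact R n _ _)
  Kim Kconv (fun z Kz => regular_chart hB SB hS Se (Kim z Kz)).
exists C => //; eexists.
  by apply: (near_chart_ball Be ex0 (_ : 0 < r / 2)); rewrite divr_gt0.
move=> x y [ex /ltW xr] [ey /ltW yr].
by have := CP _ _ xr yr; rewrite !(chart_mapK te).
Qed.

(** Besides the estimate, this turns smallness of [rdist] into membership in a prescribed
    neighbourhood [W]. One radius serves all [x] near [x0], as the compactness argument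
    [uniform_near_diagonal] requires. *)
Lemma rdist_ge_chart e x0 W : B e -> chart_dom e x0 -> nbhs x0 W ->
  exists C r : R, [/\ 0 < C, 0 < r & \forall x \near x0, forall y,
    (rdist S g x y < r%:E)%E -> W y /\
    (`|chart_map e x - chart_map e y|%:E <= C%:E * rdist S g x y)%E].
Proof.
move=> Be ex0 nW; have te := atlas_chart hB Be.
have [C C0 nC] := metric_chart Be ex0.
have nWC : \forall z \near chart_map e x0, chart_image e setT z /\ W (chart_inv e z) /\
    forall v, `|to_chart S e (chart_inv e z) v| <= C * rnorm g (chart_inv e z) v.
  have ci := chart_inv_continuous te (chart_map_image ex0).
  have n1 : nbhs (chart_map e x0) (chart_image e setT).
    by apply: open_nbhs_nbhs; split; [case: te|exact: chart_map_image].
  have n2 : \forall x \near x0, W x /\ forall v, `|to_chart S e x v| <= C * rnorm g x v.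
    by apply: filterS2 nW nC => x Wx [_ xC]; split => // v; have [] := xC v.
  move: ci; rewrite /prop_for /continuous_at (chart_mapK te ex0) => ci.
  by apply: filterS2 n1 (ci _ n2) => z iz [].
have [r /= r0 rP] := (nbhs_ballP _ _).1 nWC.
have r20 : 0 < r / 2 by rewrite divr_gt0.
have r2r : r / 2 < r by rewrite ltr_pdivrMr// mulr_natr mulr2n ltrDl.
have im : [set z | `|z - chart_map e x0| <= r / 2] `<=` chart_image e setT.
  move=> z /= zr; have [] // := rP z _.
  by rewrite -ball_normE /= distrC (le_lt_trans zr).
have bd x v : chart_dom e x -> `|chart_map e x - chart_map e x0| <= r / 2 ->
    `|to_chart S e x v| <= C * rnorm g x v.
  move=> ex xr; have [] := rP (chart_map e x) _.
    by rewrite -ball_normE /= distrC (le_lt_trans xr).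
  by rewrite (chart_mapK te)// => _ [_]; exact.
(* Starting within [r / 8] of the centre and spending at most [r / 8] along a path, one stays within
   [r / 4], with a margin inside the ball of radius [r / 2] on which the bounds hold. *)
exists C, (r / 8 / C); split => //; first by rewrite !divr_gt0.
have r80 : 0 < r / 8 by rewrite divr_gt0.
apply: filterS (near_chart_ball Be ex0 r80) => x [ex xr] y xy.
have xr' : (`|chart_map e x - chart_map e x0|%:E + C%:E * rdist S g x y <= (r / 4)%:E)%E.
  have -> : r / 4 = r / 8 + C * (r / 8 / C) by field; rewrite gt_eqF.
  rewrite EFinD leeD ?lee_fin ?(ltW xr)//.
  by rewrite EFinM lee_pmul2l// ltW.
have [|ey yx] := rdist_stays hM hB SB hS Be C0 im bd ex xr'.
  by rewrite ltr_pM2l// ltf_pV2 ?posrE// ltr_nat.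
split; last by rewrite distrC.
suff yb : ball (chart_map e x0) r (chart_map e y).
  by have [_ [Wy _]] := rP _ yb; rewrite (chart_mapK te) in Wy.
rewrite -ball_normE /= distrC (le_lt_trans _ r2r)//.
have d0 := rdist_ge0 S g x y.
have fd : rdist S g x y \is a fin_num.
  by rewrite ge0_fin_numE// (lt_trans xy)// ltry.
move: xr' yx; rewrite -(fineK fd) -EFinM -EFinD !lee_fin => h1 h2.
have := ler_normD (chart_map e y - chart_map e x) (chart_map e x - chart_map e x0).
rewrite addrA subrK; move: r0; lra.
Qed.

Section Maps.
Context (f : M -> M) (hf : C1_map S f).

Lemma in_charts_C1_lipschitz x0 (e := chart_at S x0) (e' := chart_at S (f x0)) :
  exists2 C : R, 0 < C & exists2 V : set M, nbhs x0 V & forall x y, V x -> V y ->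
    `|chart_map e' (f x) - chart_map e' (f y)| <= C * `|chart_map e x - chart_map e y|.
Proof.
have Se := chart_at_atlas hS x0; have Se' := chart_at_atlas hS (f x0).
have Be := SB Se; have Be' := SB Se'.
have te := atlas_chart hB Be; have te' := atlas_chart hB Be'.
have ex0 := chart_at_dom hS x0; have fx0 := chart_at_dom hS (f x0).
have [cf Cf] := hf.
have oU : open (chart_image e (f @^-1` chart_dom e')).
  apply: chart_image_open => //; apply: open_comp; last exact: chart_dom_open.
  by move=> z _; exact: cf.
have iU : chart_image e (f @^-1` chart_dom e') (chart_map e x0) by exists x0.
have [C [r [C0 r0 lip]]] := C1_lipschitz bc bc oU iU (Cf _ _ Se Se').
exists C => //; eexists; first exact: (near_chart_ball Be ex0 r0).
move=> x y [ex xr] [ey yr]; have := lip _ _ xr yr.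
by rewrite /in_charts /= !(chart_mapK te).
Qed.

Lemma map_rdist_le (x0 : M) : exists2 C : R, 0 < C & exists2 V : set M, nbhs x0 V &
  forall x y, V x -> V y ->
    (rdist S g (f x) (f y) <=
     (C * `|chart_map (chart_at S x0) x - chart_map (chart_at S x0) y|)%:E)%E.
Proof.
have [C C0 [V nV VP]] := in_charts_C1_lipschitz x0.
have [C' C'0 [V' nV' VP']] := rdist_le_chart (chart_at_atlas hS (f x0))
  (chart_at_dom hS (f x0)).
exists (C' * C); first exact: mulr_gt0.
exists (V `&` f @^-1` V'); first by apply: filterI => //; case: hf => cf _; exact: cf.
move=> x y [Vx Vx'] [Vy Vy']; apply: le_trans (VP' _ _ Vx' Vy') _.
by rewrite lee_fin -mulrA ler_pM2l//; exact: VP.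
Qed.

Lemma tangent_map_bounded (x0 : M) : exists2 C : R, 0 < C & exists2 V : set M, nbhs x0 V &
  forall (x : M) v, V x -> rnorm g (f x) (tangent_map S f x v) <= C * rnorm g x v.
Proof.
pose e := chart_at S x0; pose e' := chart_at S (f x0).
have Se : atlas S e := chart_at_atlas hS x0.
have Se' : atlas S e' := chart_at_atlas hS (f x0).
have Be := SB Se; have Be' := SB Se'.
have te := atlas_chart hB Be; have te' := atlas_chart hB Be'.
have ex0 : chart_dom e x0 := chart_at_dom hS x0.
have fx0 : chart_dom e' (f x0) := chart_at_dom hS (f x0).
have [cf Cf] := hf.
have oU : open (chart_image e (f @^-1` chart_dom e')).
  apply: chart_image_open => //; apply: open_comp; last exact: chart_dom_open.
  by move=> z _; exact: cf.
have iU : chart_image e (f @^-1` chart_dom e') (chart_map e x0) by exists x0.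
have [C C0 nC] := C1_diff_bounded bc oU iU (Cf _ _ Se Se').
have [C1 C10 n1] := metric_chart Be ex0.
have [C2 C20 n2] := metric_chart Be' fx0.
exists (C2 * C * C1); first by rewrite !mulr_gt0.
have n2' : \forall x \near x0, chart_dom e' (f x) /\ forall v,
    `|to_chart S e' (f x) v| <= C2 * rnorm g (f x) v /\
    rnorm g (f x) v <= C2 * `|to_chart S e' (f x) v|.
  exact: (near_comp (cf x0) n2).
exists (fun x => (forall u, `|'d (in_charts e e' f) (chart_map e x) u| <= C * `|u|) /\
  (chart_dom e x /\ forall v, `|to_chart S e x v| <= C1 * rnorm g x v) /\
  (chart_dom e' (f x) /\ forall v,
    rnorm g (f x) v <= C2 * `|to_chart S e' (f x) v|)).
  apply: filterI; first by apply: filterS (near_chart_map Be ex0 nC) => x [].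
  apply: filterI.
    by apply: filterS n1 => x [ex xP]; split => // v; have [] := xP v.
  by apply: filterS n2' => x [ex xP]; split => // v; have [] := xP v.
move=> x v [xC [[ex x1] [e'x x2]]].
apply: le_trans (x2 _) _; rewrite -!mulrA ler_pM2l//.
have [_ ->] := diff_at_charts hB SB hS (C1_map_diff_at hB SB hS x hf) Be Be' ex e'x.
by apply: le_trans (xC _) _; rewrite ler_pM2l.
Qed.

End Maps.
End LocalEstimates.

(** * From local to uniform constants by compactness *)

Section Uniform.
Context {R : realType} {n : nat}.
Local Notation E := 'rV[R]_n.
Context (M : topologicalType) (cM : compact [set: M]).
Context (S : charted M E) (g : M -> E -> E -> R).

(** Compactness is given by cluster points of filters. Without a finite subcover, the sets whose
    complement is covered by finitely many [W p] form a proper filter; it contains the complement of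
    every [W x], so no [x] is a cluster point. *)
Lemma finite_subcover (W : M -> set M) : (forall p, nbhs p (W p)) ->
  exists s : seq M, forall x, exists2 p, p \in s & W p x.
Proof.
move=> nW; apply: contrapT => nocov.
pose F : set_system M := fun A => exists s : seq M,
  forall x, ~ A x -> exists2 p, p \in s & W p x.
have FF : Filter F.
  split; first by exists [::] => x /(_ Logic.I).
  - move=> A A' [s sP] [s' sP']; exists (s ++ s') => x /not_andP[/sP|/sP'][p ps px];
      by exists p => //; rewrite mem_cat ps ?orbT.
  - by move=> A A' AA' [s sP]; exists s => x nA'; apply: sP => /AA'.
have PF : ProperFilter F.
  by split => // -[s sP]; apply: nocov; exists s => x; exact: sP.
have [|x [_ xF]] := cM PF; first exact: filterT.
have FW : F (~` W x).
  by exists [:: x] => y /contrapT Wy; exists x; rewrite ?inE.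
by have [y []] := xF _ _ FW (nW x).
Qed.

(* A Lebesgue number for [rdist]. *)
Lemma uniform_near_diagonal (P : R -> M -> M -> Prop) :
  (forall C C' x y, 0 < C -> C <= C' -> P C x y -> P C' x y) ->
  (forall p : M, exists C r : R, [/\ 0 < C, 0 < r &
     \forall x \near p, forall y, (rdist S g x y < r%:E)%E -> P C x y]) ->
  exists C r : R, [/\ 0 < C, 0 < r &
    forall x y, (rdist S g x y < r%:E)%E -> P C x y].
Proof.
move=> mono loc.
have loc' (p : M) : exists CrW : R * R * set M, [/\ 0 < CrW.1.1, 0 < CrW.1.2,
    nbhs p CrW.2 &
    forall x y, CrW.2 x -> (rdist S g x y < CrW.1.2%:E)%E -> P CrW.1.1 x y].
  have [C [r [C0 r0 nP]]] := loc p.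
  exists (C, r, [set x | forall y, (rdist S g x y < r%:E)%E -> P C x y]).
  by split => //= x y xP; exact: xP.
have [F FP] := choice loc'.
have [s sP] := @finite_subcover (fun p => (F p).2) (fun p => let: And4 _ _ h _ := FP p in h).
have [C [C0 CP]] : exists C : R, 0 < C /\ forall p, p \in s -> (F p).1.1 <= C.
  elim: s {sP} => [|p s [C [C0 CP]]]; first by exists 1.
  exists (Num.max C (F p).1.1); split; first by rewrite lt_max C0.
  by move=> q; rewrite inE le_max => /predU1P[->|/CP ->//]; rewrite lexx orbT.
have [r [r0 rP]] : exists r : R, 0 < r /\ forall p, p \in s -> r <= (F p).1.2.
  elim: s {sP CP} => [|p s [r [r0 rP]]]; first by exists 1.
  exists (Num.min r (F p).1.2); split; first by rewrite lt_min r0; case: (FP p).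
  by move=> q; rewrite inE ge_min => /predU1P[->|/rP ->//]; rewrite lexx orbT.
exists C, r; split => // x y xy; have [p ps px] := sP x.
have [h0 _ _ h] := FP p; apply: mono h0 (CP p ps) _; apply: h => //.
by apply: lt_le_trans xy _; rewrite lee_fin; exact: rP.
Qed.

End Uniform.

(** * Subspaces as graphs *)

Section RowSpace.
Context {R : realType} {n : nat}.

Lemma row_spaceP q (A : 'M[R]_(q, n)) v :
  reflect (exists u, v = u *m A) (v \in row_space A).
Proof.
apply: (iffP memv_imgP) => [[u _ ->]|[u ->]]; first by exists u; rewrite lfunE.
by exists u; rewrite ?memvf// lfunE.
Qed.

Lemma row_space_sub q q' (A : 'M[R]_(q, n)) (A' : 'M[R]_(q', n)) :
  (row_space A <= row_space A')%VS -> exists U, A = U *m A'.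
Proof.
move=> AA'.
have rowP i : exists u, row i A = u *m A'.
  apply/row_spaceP; apply: (subvP AA'); apply/row_spaceP.
  by exists (delta_mx 0 i); rewrite rowE.
have [u uP] := choice rowP; exists (\matrix_i u i).
by apply/row_matrixP => i; rewrite uP row_mul rowK.
Qed.

Lemma row_space_mulmx q (U : 'M[R]_q) (A : 'M[R]_(q, n)) : U \in unitmx ->
  row_space (U *m A) = row_space A.
Proof.
move=> uU; apply/vspaceP => v; apply/row_spaceP/row_spaceP => -[u ->].
  by exists (u *m U); rewrite mulmxA.
by exists (u *m invmx U); rewrite mulmxA mulmxKV.
Qed.

Lemma row_space_lin1 q (A : 'M[R]_(q, n)) (f : {linear 'rV[R]_n -> 'rV[R]_n}) :
  (linfun f @: row_space A)%VS = row_space (A *m lin1_mx f).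
Proof.
apply/vspaceP => v; apply/memv_imgP/row_spaceP => [[w /row_spaceP[u ->] ->]|[u ->]].
  by exists u; rewrite lfunE/= mulmxA mul_rV_lin1.
exists (u *m A); first by apply/row_spaceP; exists u.
by rewrite lfunE/= mulmxA mul_rV_lin1.
Qed.

Lemma vspace_rowsK q (V : {vspace 'rV[R]_n}) : \dim V = q ->
  row_space (vspace_rows q V) = V.
Proof.
move=> dV; subst q.
have rowE' (u : 'rV[R]_(\dim V)) :
    u *m vspace_rows (\dim V) V = \sum_i u 0 i *: (vbasis V)`_i.
  rewrite mulmx_sum_row; apply: eq_bigr => i _; congr (_ *: _).
  by apply/rowP => j; rewrite !mxE.
apply/vspaceP => v; apply/row_spaceP/idP => [[u ->]|vV].
  rewrite rowE'; apply: memv_suml => i _; apply: memvZ.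
  by apply: vbasis_mem; rewrite mem_nth// size_tuple.
exists (\row_i coord (vbasis V) i v); rewrite rowE' {1}(coord_vbasis vV).
by apply: eq_bigr => i _; rewrite mxE.
Qed.

Lemma row_free_dim q (A : 'M[R]_(q, n)) : row_free A <-> \dim (row_space A) = q.
Proof.
have dE := limg_ker_dim (linfun (mulmxr A : 'rV[R]_q -> 'rV[R]_n)) fullv.
rewrite dimvf dim_matrix mul1r capfv in dE.
have kE v : (v \in lker (linfun (mulmxr A : 'rV[R]_q -> 'rV[R]_n))) = (v *m A == 0).
  by rewrite memv_ker lfunE.
split=> [fA|dA].
  suff k0 : (lker (linfun (mulmxr A : 'rV[R]_q -> 'rV[R]_n)) = 0)%VS.
    by rewrite k0 dimv0 add0n in dE.
  apply/eqP; rewrite -subv0; apply/subvP => v; rewrite kE memv0 => /eqP vA.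
  by apply/eqP/(row_free_inj fA); rewrite vA mul0mx.
apply: inj_row_free => v vA; move: dE; rewrite -/(row_space A) dA.
move/eqP; rewrite -[X in _ == X]add0n eqn_add2r dimv_eq0 => /eqP k0.
by apply/eqP; rewrite -memv0 -k0 kE vA.
Qed.

End RowSpace.

(** * Affine charts of the Grassmannian and coordinate planes *)

Section Frames.
Context {R : realType} {n q r : nat}.
Hypothesis qrn : (q + r = n)%N.

(* [Nl] and [Nr] read off the coordinates in the basis given by [P] and [Q]. *)
Definition frame (P : 'M[R]_(q, n)) (Q : 'M[R]_(r, n))
    (Nl : 'M[R]_(n, q)) (Nr : 'M[R]_(n, r)) :=
  [/\ P *m Nl = 1%:M, P *m Nr = 0, Q *m Nl = 0, Q *m Nr = 1%:M &
      Nl *m P + Nr *m Q = 1%:M].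

Lemma frame_exists P Q : row_free (col_mx P Q) -> exists Nl Nr, frame P Q Nl Nr.
Proof.
move=> fPQ; have full : row_full (col_mx P Q).
  by rewrite /row_full (eqP fPQ) qrn.
pose N := pinvmx (col_mx P Q); exists (lsubmx N), (rsubmx N).
have h1 : N *m col_mx P Q = 1%:M by exact: mulVpmx.
have h2 : col_mx P Q *m N = 1%:M by exact: mulmxVp.
rewrite -(hsubmxK N) mul_col_row scalar_mx_block in h2.
have [h3 h4 h5 h6] := eq_block_mx h2.
by split => //; rewrite -mul_row_col hsubmxK.
Qed.

Lemma frame_row_free P Q Nl Nr : frame P Q Nl Nr -> row_free (col_mx P Q).
Proof.
case=> h1 h2 h3 h4 _; apply/row_freeP; exists (row_mx Nl Nr).
by rewrite mul_col_row h1 h2 h3 h4 -scalar_mx_block.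
Qed.

Section Coordinates.
Context (P : 'M[R]_(q, n)) (Q : 'M[R]_(r, n)) (Nl : 'M[R]_(n, q)) (Nr : 'M[R]_(n, r)).
Hypothesis PQ : frame P Q Nl Nr.

Lemma frame_graphl X : (P + X *m Q) *m Nl = 1%:M.
Proof. by case: PQ => h1 _ h3 _ _; rewrite mulmxDl h1 -mulmxA h3 mulmx0 addr0. Qed.

Lemma frame_graphr X : (P + X *m Q) *m Nr = X.
Proof. by case: PQ => _ h2 _ h4 _; rewrite mulmxDl h2 -mulmxA h4 mulmx1 add0r. Qed.

Lemma frame_graph_free X : row_free (P + X *m Q).
Proof. by apply/row_freeP; exists Nl; exact: frame_graphl. Qed.

(** [B *m Nl] and [B *m Nr] are the components of the rows of [B] along [P] and [Q]. The plane is a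
    graph over the row space of [P] exactly when the first is invertible, and [X] is then the
    slope. *)
Lemma affine_chartP (B : 'M[R]_(q, n)) X : row_free B ->
  in_affine_chart P Q (row_space B) X <->
  B *m Nl \in unitmx /\ X = invmx (B *m Nl) *m (B *m Nr).
Proof.
move=> fB; rewrite /in_affine_chart; split=> [BX|[u ->]].
  have [U BU] : exists U, B = U *m (P + X *m Q).
    by apply: row_space_sub; rewrite BX.
  have BNl : B *m Nl = U by rewrite BU -mulmxA frame_graphl mulmx1.
  have BNr : B *m Nr = U *m X by rewrite BU -mulmxA frame_graphr.
  have uU : U \in unitmx.
    rewrite -row_free_unit; apply: inj_row_free => v vU.
    by apply: (row_free_inj fB); rewrite BU mulmxA vU !mul0mx.
  by rewrite BNl BNr; split => //; rewrite mulKmx.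
have [_ _ _ _ h] := PQ.
rewrite -[in LHS](mulmx1 B) -h mulmxDr !mulmxA.
rewrite -[RHS](row_space_mulmx _ u) mulmxDr; congr row_space.
by rewrite !mulmxA mulmxV// mul1mx.
Qed.

Lemma affine_chart_unique V X X' : in_affine_chart P Q V X ->
  in_affine_chart P Q V X' -> X = X'.
Proof.
move=> ->; case/affine_chartP; first exact: frame_graph_free.
by move=> _; rewrite frame_graphl invmx1 mul1mx frame_graphr.
Qed.

Lemma affine_chart_xget V X : in_affine_chart P Q V X ->
  xget 0 [set X | in_affine_chart P Q V X] = X.
Proof. by move=> VX; apply: xget_unique => // Y VY; exact: affine_chart_unique VY VX. Qed.

Lemma affine_chart_coordE (B : 'M[R]_(q, n)) : row_free B -> B *m Nl \in unitmx ->
  xget 0 [set X | in_affine_chart P Q (row_space B) X] =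
  invmx (B *m Nl) *m (B *m Nr).
Proof. by move=> fB u; apply: affine_chart_xget; apply/affine_chartP. Qed.

End Coordinates.

(** In the application [r] is [n - q], so [n] equals [q + r] only propositionally; the two blocks of
    indices go through a cast. *)
Definition lord (i : 'I_q) : 'I_n := cast_ord qrn (lshift r i).
Definition rord (k : 'I_r) : 'I_n := cast_ord qrn (rshift q k).

Lemma lord_inj : injective lord.
Proof. by move=> i j /cast_ord_inj /lshift_inj. Qed.

Lemma rord_inj : injective rord.
Proof. by move=> i j /cast_ord_inj /rshift_inj. Qed.

Lemma lrord_neq i k : (lord i == rord k) = false.
Proof.
by apply/negP => /eqP/cast_ord_inj/eqP; rewrite eq_lrshift.
Qed.

Variant lrord_spec : 'I_n -> Type :=
  | LOrd i : lrord_spec (lord i)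
  | ROrd k : lrord_spec (rord k).

Lemma lrordP j : lrord_spec j.
Proof.
have -> : j = cast_ord qrn (cast_ord (esym qrn) j) by rewrite cast_ordKV.
by case: (split_ordP (cast_ord (esym qrn) j)) => i ->; constructor.
Qed.

Lemma sum_lrord (F : 'I_n -> R) : \sum_j F j = \sum_i F (lord i) + \sum_k F (rord k).
Proof.
rewrite (reindex (cast_ord qrn)) /=; first exact: big_split_ord.
by exists (cast_ord (esym qrn)) => j _; rewrite ?cast_ordK ?cast_ordKV.
Qed.

(** Permutations index the coordinate charts redundantly, but by a finite type. The rows of [selP s]
    and [selQ s] form the standard basis in the order [s], so the matrices [Nl] and [Nr] of the
    frame are mere transposes. *)
Definition selP (s : {perm 'I_n}) : 'M[R]_(q, n) := \matrix_(i, j) (s (lord i) == j)%:R.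
Definition selQ (s : {perm 'I_n}) : 'M[R]_(r, n) := \matrix_(i, j) (s (rord i) == j)%:R.

Lemma mul_selP_tr m (A : 'M[R]_(m, n)) s i j :
  (A *m (selP s)^T) i j = A i (s (lord j)).
Proof.
rewrite !mxE (bigD1 (s (lord j)))//= !mxE eqxx mulr1 big1 ?addr0// => k kj.
by rewrite !mxE eq_sym (negbTE kj) mulr0.
Qed.

Lemma mul_selQ_tr m (A : 'M[R]_(m, n)) s i j :
  (A *m (selQ s)^T) i j = A i (s (rord j)).
Proof.
rewrite !mxE (bigD1 (s (rord j)))//= !mxE eqxx mulr1 big1 ?addr0// => k kj.
by rewrite !mxE eq_sym (negbTE kj) mulr0.
Qed.

Lemma perm_frame s : frame (selP s) (selQ s) (selP s)^T (selQ s)^T.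
Proof.
have li := inj_eq lord_inj; have ri := inj_eq rord_inj; have pi := inj_eq (@perm_inj _ s).
split; try by apply/matrixP => i j;
  rewrite ?mul_selP_tr ?mul_selQ_tr !mxE ?pi ?li ?ri ?lrord_neq ?[rord _ == _]eq_sym ?lrord_neq.
apply/matrixP => i j; rewrite !mxE -(permKV s i) -(permKV s j).
set i' := s^-1%g i; set j' := s^-1%g j; rewrite pi.
under eq_bigr do rewrite !mxE !pi.
under [X in _ + X]eq_bigr do rewrite !mxE !pi.
rewrite -(sum_lrord (fun l => (l == i')%:R * (l == j')%:R)).
rewrite (bigD1 i')//= eqxx mul1r big1 ?addr0// => k /negbTE ->.
by rewrite mul0r.
Qed.

Lemma perm_extend (f : 'I_q -> 'I_n) : injective f ->
  exists s : {perm 'I_n}, forall i, s (lord i) = f i.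
Proof.
move=> finj; pose C := ~: (f @: 'I_q).
have cC : #|C| = r.
  by rewrite cardsCs finset.setCK card_imset// !card_ord -qrn addKn.
pose h (j : 'I_n) := match fintype.split (cast_ord (esym qrn) j) with
  | inl i => f i | inr k => enum_val (cast_ord (esym cC) k) end.
have hl i : h (lord i) = f i.
  rewrite /h /lord cast_ordK; case: splitP => [j /= ij|k /= ik]; first by congr f; apply/val_inj.
  by have := ltn_ord i; rewrite ik ltnNge leq_addr.
have hr k : h (rord k) = enum_val (cast_ord (esym cC) k).
  rewrite /h /rord cast_ordK; case: splitP => [j /= kj|k' /= /addnI kk].
    by have := ltn_ord j; rewrite -kj ltnNge leq_addr.
  by congr (enum_val (cast_ord _ _)); apply/val_inj.
have fh i k : f i != h (rord k).
  rewrite hr; have := enum_valP (cast_ord (esym cC) k); rewrite inE.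
  by apply: contra => /eqP <-; apply: imset_f.
have hinj : injective h.
  move=> j j'; case: (lrordP j) => i; case: (lrordP j') => i'; rewrite ?hl.
  - by move/finj ->.
  - by move/eqP; rewrite (negbTE (fh _ _)).
  - by move/esym/eqP; rewrite (negbTE (fh _ _)).
  - by rewrite !hr => /enum_val_inj/cast_ord_inj ->.
by exists (perm hinj) => i; rewrite permE.
Qed.

Lemma minor_exists (B : 'M[R]_(q, n)) : row_free B ->
  exists s, B *m (selP s)^T \in unitmx.
Proof.
move=> fB; have fullB : row_full B^T by rewrite /row_full mxrank_tr.
have [s sf] := perm_extend (@fullrankfun_inj _ _ _ _ fullB).
exists s; rewrite -unitmx_tr.
have -> : (B *m (selP s)^T)^T = rowsub (fullrankfun fullB) B^T.
  by apply/matrixP => i j; rewrite mxE mul_selP_tr !mxE sf.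
exact: fullrowsub_unit.
Qed.

Lemma mx_entry_le m p (A : 'M[R]_(m, p)) i j : `|A i j| <= `|A|.
Proof.
rewrite [leRHS]/Num.Def.normr/= mx_normrE; exact: (le_bigmax _ _ (i, j)).
Qed.

Lemma mx_norm_le m p (A : 'M[R]_(m, p)) (C : R) : 0 <= C ->
  (forall i j, `|A i j| <= C) -> `|A| <= C.
Proof.
move=> C0 AC; rewrite [leLHS]/Num.Def.normr/= mx_normrE.
by apply: bigmax_le => // -[i j] _ /=.
Qed.

Lemma mx_norm_mul m p l (A : 'M[R]_(m, p)) (B : 'M[R]_(p, l)) :
  `|A *m B| <= p%:R * `|A| * `|B|.
Proof.
apply: mx_norm_le => [|i j]; first by rewrite !mulr_ge0.
rewrite mxE (le_trans (ler_norm_sum _ _ _))//.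
apply: (@le_trans _ _ (\sum_(k < p) `|A| * `|B|)).
  by apply: ler_sum => k _; rewrite normrM ler_pM// mx_entry_le.
by rewrite sumr_const card_ord -mulrA mulr_natl.
Qed.

(* Among the coordinate charts, take one maximizing the minor of [B]: by Cramer's
   rule the entries of [X] are quotients of minors. *)
Lemma graph_bounded (B : 'M[R]_(q, n)) : row_free B ->
  exists s X, `|X| <= 1 /\ row_space B = row_space (selP s + X *m selQ s).
Proof.
move=> fB; have [s0 us0] := minor_exists fB.
pose m s := `|\det (B *m (selP s)^T)|.
case: (@Order.TotalTheory.arg_maxP _ _ _ s0 xpredT m) => // s _ smax.
set A := B *m (selP s)^T.
have uA : A \in unitmx.
  rewrite unitmxE unitfE -normr_gt0; apply: lt_le_trans (smax s0 isT).
  by rewrite normr_gt0 -unitfE -unitmxE.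
pose X := invmx A *m (B *m (selQ s)^T).
exists s, X; split; last by apply/(affine_chartP (perm_frame s)).
apply: mx_norm_le => // i k.
pose s' := (tperm (lord i) (rord k) * s)%g.
pose A' := B *m (selP s')^T.
have A'i l : A' l i = (B *m (selQ s)^T) l k.
  by rewrite mul_selP_tr mul_selQ_tr permM tpermL.
have A'j l j : j != i -> A' l j = A l j.
  move=> ji; rewrite !mul_selP_tr permM tpermD//.
    by rewrite (inj_eq lord_inj) eq_sym.
  by rewrite eq_sym lrord_neq.
have cof l : cofactor A' l i = cofactor A l i.
  rewrite /cofactor; congr (_ * \det (row' l _)).
  by apply/matrixP => a b; rewrite [LHS]mxE [RHS]mxE A'j// eq_sym neq_lift.
have dX : \det A' = \det A * X i k.
  rewrite (expand_det_col A' i) /X /invmx uA -scalemxAl [in RHS]mxE mulrA mulfV; last first.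
    by rewrite -unitfE -unitmxE.
  rewrite mul1r mxE; apply: eq_bigr => l _.
  by rewrite A'i cof [\adj A i l]mxE mulrC.
have : m s' <= m s := smax s' isT.
rewrite /m -/A' -/A dX normrM.
by rewrite ger_pMr// normr_gt0 -unitfE -unitmxE.
Qed.

Lemma sel_mul_norm m (A : 'M[R]_(m, n)) s :
  `|A *m (selP s)^T| <= `|A| /\ `|A *m (selQ s)^T| <= `|A|.
Proof.
by split; apply: mx_norm_le => // i j; rewrite ?mul_selP_tr ?mul_selQ_tr mx_entry_le.
Qed.

Lemma sel_norm_le m (A : 'M[R]_(m, n)) s :
  `|A| <= `|A *m (selP s)^T| + `|A *m (selQ s)^T|.
Proof.
apply: mx_norm_le => [|i j]; first exact: addr_ge0.
rewrite -(permKV s j); case: (lrordP (s^-1%g j)) => k.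
  by rewrite -mul_selP_tr ler_wpDr// mx_entry_le.
by rewrite -mul_selQ_tr ler_wpDl// mx_entry_le.
Qed.

(** One-sided closeness is enough because the dimensions agree. Vectors of [W] almost satisfy the
    equation of the graph of [X1] ([off]), so they are controlled by their component along [selP s]
    ([wle]), the bound [2^-1] absorbing the defect. The projection is thus injective on [W], which
    is a graph. The factors [1 + q%:R] come from multiplying by [X1]. *)
Lemma graph_perturbation s (X1 : 'M[R]_(q, r)) (W : {vspace 'rV[R]_n}) (d : R) :
  `|X1| <= 1 -> \dim W = q -> 0 <= d -> (1 + q%:R) * d <= 2^-1 ->
  (forall w, w \in W -> exists2 v, v \in row_space (selP s + X1 *m selQ s) &
     `|w - v| <= d * `|w|) ->
  exists2 X2 : 'M[R]_(q, r), W = row_space (selP s + X2 *m selQ s) &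
    `|X2 - X1| <= 2 * (1 + q%:R) ^+ 2 * d.
Proof.
move=> X11 dW d0 dsmall WV.
have PQ := perm_frame s.
have q0 : 0 <= q%:R :> R by [].
have off w : w \in W ->
    `|w *m (selQ s)^T - w *m (selP s)^T *m X1| <= (1 + q%:R) * d * `|w|.
  move=> wW; have [v /row_spaceP[u vE] wv] := WV w wW.
  have vX : v *m (selQ s)^T = v *m (selP s)^T *m X1.
    have vl : v *m (selP s)^T = u by rewrite vE -mulmxA (frame_graphl PQ) mulmx1.
    by rewrite vl vE -mulmxA (frame_graphr PQ).
  have -> : w *m (selQ s)^T - w *m (selP s)^T *m X1 =
      (w - v) *m (selQ s)^T - (w - v) *m (selP s)^T *m X1.
    by rewrite !mulmxBl vX opprB addrA subrK.
  apply: le_trans (ler_normB _ _) _.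
  have [h1 h2] := sel_mul_norm (w - v) s.
  have h3 := mx_norm_mul ((w - v) *m (selP s)^T) X1.
  have h4 : q%:R * `|(w - v) *m (selP s)^T| * `|X1| <= q%:R * `|w - v|.
    rewrite -mulrA ler_wpM2l// -[leRHS]mulr1 ler_pM//.
  have h5 : q%:R * `|w - v| <= q%:R * (d * `|w|) by rewrite ler_wpM2l.
  rewrite -mulrA mulrDl mul1r; move: h1 h2 h3 h4 h5 wv; lra.
have wle w : w \in W -> `|w| <= 2 * (1 + q%:R) * `|w *m (selP s)^T|.
  move=> wW; have h1 := sel_norm_le w s; have h2 := off w wW.
  have h3 : `|w *m (selQ s)^T| <= `|w *m (selQ s)^T - w *m (selP s)^T *m X1| +
      `|w *m (selP s)^T *m X1|.
    by rewrite -[in leLHS](subrK (w *m (selP s)^T *m X1) (w *m (selQ s)^T)) ler_normD.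
  have h4 := mx_norm_mul (w *m (selP s)^T) X1.
  have h5 : q%:R * `|w *m (selP s)^T| * `|X1| <= q%:R * `|w *m (selP s)^T|.
    by rewrite -[leRHS]mulr1 ler_wpM2l// mulr_ge0.
  have h6 : (1 + q%:R) * d * `|w| <= 2^-1 * `|w| by rewrite ler_wpM2r.
  move: h1 h2 h3 h4 h5 h6; lra.
pose B := vspace_rows q W.
have BW : row_space B = W by exact: vspace_rowsK.
have fB : row_free B by apply/row_free_dim; rewrite BW.
have uB : B *m (selP s)^T \in unitmx.
  rewrite -row_free_unit; apply: inj_row_free => v vB.
  have vW : v *m B \in W by rewrite -BW; apply/row_spaceP; exists v.
  have := wle _ vW; rewrite -mulmxA vB normr0 mulr0 normr_le0 => /eqP vB0.
  by apply: (row_free_inj fB); rewrite vB0 mul0mx.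
pose X2 := invmx (B *m (selP s)^T) *m (B *m (selQ s)^T).
have WX2 : W = row_space (selP s + X2 *m selQ s).
  by rewrite -BW; apply/(affine_chartP PQ).
exists X2 => //; apply: mx_norm_le => [|i j].
  by rewrite mulr_ge0// mulr_ge0// sqr_ge0.
(* The vector of [W] above the [i]-th basis vector: its defect from the graph of [X1] is row [i] of
   [X2 - X1]. *)
pose w := (delta_mx 0 i : 'rV[R]_q) *m (selP s + X2 *m selQ s).
have wW : w \in W by rewrite WX2; apply/row_spaceP; exists (delta_mx 0 i).
have wP : w *m (selP s)^T = delta_mx 0 i by rewrite -mulmxA (frame_graphl PQ) mulmx1.
have wQ : w *m (selQ s)^T = delta_mx 0 i *m X2 by rewrite -mulmxA (frame_graphr PQ).
have := off w wW; rewrite wP wQ -mulmxBr => h1.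
have h2 := wle w wW; rewrite wP in h2.
have d1 : `|delta_mx 0 i : 'rV[R]_q| <= 1.
  by apply: mx_norm_le => // a b; rewrite mxE; case: (_ && _); rewrite ?normr1 ?normr0.
have h3 : `|(X2 - X1) i j| <= `|(delta_mx 0 i : 'rV[R]_q) *m (X2 - X1)|.
  have := mx_entry_le ((delta_mx 0 i : 'rV[R]_q) *m (X2 - X1)) 0 j.
  by rewrite -[X in fun_of_matrix X 0 j]rowE mxE.
have h4 : `|w| <= 2 * (1 + q%:R) by apply: le_trans h2 _; rewrite -[leRHS]mulr1 ler_wpM2l// mulr_ge0// addr_ge0.
have h5 : (1 + q%:R) * d * `|w| <= (1 + q%:R) * d * (2 * (1 + q%:R)).
  by rewrite ler_wpM2l// mulr_ge0// addr_ge0.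
apply: le_trans h3 (le_trans h1 (le_trans h5 _)).
by rewrite le_eqVlt; apply/orP; left; apply/eqP; ring.
Qed.

(** The radius 2 exceeds the bound 1 of [graph_bounded], which leaves room to perturb a plane inside
    the same coordinate chart. *)
Definition graph_step (V W : {vspace 'rV[R]_n}) :=
  exists s (X1 X2 : 'M[R]_(q, r)), [/\ `|X1| <= 2, `|X2| <= 2,
    V = row_space (selP s + X1 *m selQ s) & W = row_space (selP s + X2 *m selQ s)].

Fixpoint graph_chain (k : nat) (V W : {vspace 'rV[R]_n}) : Prop :=
  if k is k'.+1 then exists U, graph_step V U /\ graph_chain k' U W else V = W.

Lemma graph_chain_cat k l V U W : graph_chain k V U -> graph_chain l U W ->
  graph_chain (k + l) V W.
Proof.
elim: k V => [|k IH] V /=; first by move=> ->.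
by move=> [V' [VV' V'U]] UW; exists V'; split => //; exact: IH.
Qed.

Lemma graph_step_sym V W : graph_step V W -> graph_step W V.
Proof. by move=> [s [X1 [X2 []]]]; exists s, X2, X1. Qed.

Lemma graph_chain_sym k V W : graph_chain k V W -> graph_chain k W V.
Proof.
elim: k V => [|k IH] V /=; first by move=> ->.
move=> [U [VU UW]]; have := graph_chain_cat (IH _ UW) (_ : graph_chain 1 U V).
rewrite addn1; apply; exists V; split => //; exact: graph_step_sym.
Qed.

Lemma selP_spaceP (s : {perm 'I_n}) (v : 'rV[R]_n) :
  reflect (forall k, v 0 (s (rord k)) = 0) (v \in row_space (selP s)).
Proof.
have [_ h2 _ _ h5] := perm_frame s.
apply: (iffP (row_spaceP _ _)) => [[u ->] k|v0].
  by rewrite -mul_selQ_tr -mulmxA h2 mulmx0 mxE.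
exists (v *m (selP s)^T); rewrite -[LHS]mulmx1 -h5 mulmxDr !mulmxA.
suff -> : v *m (selQ s)^T = 0 by rewrite mul0mx addr0.
by apply/matrixP => i k; rewrite ord1 mul_selQ_tr v0 mxE.
Qed.

(** The intermediate plane has the sum of the old and the new basis vector in place of the one to be
    exchanged. It is a graph over both coordinate planes, with the same elementary matrix [X] as
    coordinate. *)
Lemma swap_chain s i k :
  graph_chain 2 (row_space (selP s)) (row_space (selP (tperm (lord i) (rord k) * s)%g)).
Proof.
set s' := (_ * s)%g; pose X : 'M[R]_(q, r) := delta_mx i k.
have X2 : `|X| <= 2.
  by apply: mx_norm_le => // a b; rewrite mxE; case: (_ && _); rewrite ?normr1 ?normr0// ler1n.
have n0 : `|0 : 'M[R]_(q, r)| <= 2 by rewrite normr0.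
have graph0 t : row_space (selP t) = row_space (selP t + (0 : 'M[R]_(q, r)) *m selQ t).
  by rewrite mul0mx addr0.
exists (row_space (selP s + X *m selQ s)); split; first by exists s, 0, X; rewrite -graph0.
exists (row_space (selP s')); split => //; exists s', X, 0; rewrite -graph0; split => //.
congr row_space; apply/matrixP => a j.
have XQ (t : {perm 'I_n}) : (X *m selQ t) a j = (a == i)%:R * (t (rord k) == j)%:R.
  rewrite mxE (bigD1 k)//= !mxE eqxx andbT big1 ?addr0// => l lk.
  by rewrite !mxE (negbTE lk) andbF mul0r.
rewrite mxE [RHS]mxE !XQ !mxE !permM.
have [->|ai] := eqVneq a i; first by rewrite tpermL tpermR !mul1r addrC.
rewrite !mul0r !addr0 tpermD// ?lrord_neq//.
- by rewrite (inj_eq lord_inj) eq_sym.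
- by rewrite eq_sym lrord_neq.
Qed.

(** A transposition inside one block of indices does not move the plane; a transposition between the
    two blocks is [swap_chain]. *)
Lemma tperm_chain s (a b : 'I_n) :
  exists j, graph_chain j (row_space (selP s)) (row_space (selP (tperm a b * s)%g)).
Proof.
case: (lrordP a) => i; case: (lrordP b) => k; last 1 first.
- exists 0%N; apply/vspaceP => v; apply/selP_spaceP/selP_spaceP => v0 l.
    by rewrite permM; case: tpermP => [_|_|_ _]; exact: v0.
  rewrite -[rord l](tpermK (rord i) (rord k)).
  by case: (tpermP (rord i) (rord k) (rord l)) => [_|_|_ _];
    rewrite -permM; exact: v0.
- exists 0%N; apply/vspaceP => v; apply/selP_spaceP/selP_spaceP => v0 l;
    have := v0 l; rewrite permM tpermD// ?lrord_neq//.
- by exists 2%N; exact: swap_chain.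
- by exists 2%N; rewrite tpermC; exact: swap_chain.
Qed.

(** By [graph_bounded] any plane is one step away from a coordinate plane, and coordinate planes are
    joined by decomposing permutations into transpositions. The number of permutations is finite,
    whence a uniform [N]. *)
Lemma graph_chain_bounded : exists N, forall V W : {vspace 'rV[R]_n},
  \dim V = q -> \dim W = q -> exists2 k, (k <= N)%N & graph_chain k V W.
Proof.
have to1 s : exists j, graph_chain j (row_space (selP 1%g)) (row_space (selP s)).
  have [ts -> _] := prod_tpermP s.
  elim: ts => [|[a b] ts [j jP]]; first by exists 0%N; rewrite big_nil.
  rewrite big_cons /=; have [l lP] := tperm_chain (\prod_(t <- ts) tperm t.1 t.2)%g a b.
  by exists (j + l)%N; exact: graph_chain_cat lP.
have [len lenP] := choice to1.
exists (2 * (1 + \max_s len s))%N => V W dV dW.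
have to1V U : \dim U = q -> exists2 k, (k <= 1 + \max_s len s)%N &
    graph_chain k U (row_space (selP 1%g)).
  move=> dU; have fU : row_free (vspace_rows q U).
    by apply/row_free_dim; rewrite vspace_rowsK.
  have [s [X [X1 UX]]] := graph_bounded fU; rewrite vspace_rowsK// in UX.
  exists (1 + len s)%N; first by rewrite leq_add2l leq_bigmax.
  apply: (@graph_chain_cat 1 _ _ (row_space (selP s))).
    exists (row_space (selP s)); split => //; exists s, X, 0; split => //.
    - by apply: le_trans X1 _; rewrite ler1n.
    - by rewrite normr0.
    - by rewrite mul0mx addr0.
  exact/graph_chain_sym/lenP.
have [k kN kV] := to1V V dV; have [l lN lW] := to1V W dW.
exists (k + l)%N; first by rewrite mul2n -addnn leq_add.
exact: graph_chain_cat (graph_chain_sym lW).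
Qed.

End Frames.

(** * Charts of the Grassmannian bundle *)

Section MatrixC1.
Context {R : realType} {E : normedModType R} (U : set E) (oU : open U).

Definition mxC1 m p (A : E -> 'M[R]_(m, p)) := forall i j, Ck 1 U (fun y => A y i j).

Lemma mxC1_cst m p (A : 'M[R]_(m, p)) : mxC1 (fun=> A).
Proof. by move=> i j; exact: C1_cst. Qed.

Lemma mxC1_add m p (A B : E -> 'M[R]_(m, p)) : mxC1 A -> mxC1 B ->
  mxC1 (fun y => A y + B y).
Proof.
move=> CA CB i j; apply: (C1_ext oU _ (C1D (CA i j) (CB i j) oU)) => y _.
by rewrite mxE.
Qed.

Lemma mxC1_mul m p l (A : E -> 'M[R]_(m, p)) (B : E -> 'M[R]_(p, l)) :
  mxC1 A -> mxC1 B -> mxC1 (fun y => A y *m B y).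
Proof.
move=> CA CB i j.
apply: (@C1_ext _ _ _ U (fun y => \sum_k A y i k * B y k j)) => //.
  by move=> y _; rewrite mxE.
by apply: C1_sum => // k; apply: C1M.
Qed.

Lemma mxC1_det m (A : E -> 'M[R]_m) : mxC1 A -> Ck 1 U (fun y => \det (A y)).
Proof.
move=> CA; rewrite /determinant; apply: C1_sum => // s.
apply: (@C1M _ _ _ (fun=> (-1) ^+ s) (fun y => \prod_i A y i (s i))) => //.
  exact: C1_cst.
by apply: C1_prod.
Qed.

Lemma mxC1_inv m (A : E -> 'M[R]_m) : mxC1 A -> (forall y, U y -> A y \in unitmx) ->
  mxC1 (fun y => invmx (A y)).
Proof.
move=> CA uA i j.
apply: (@C1_ext _ _ _ U (fun y => (\det (A y))^-1 * cofactor (A y) j i)) => //.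
  by move=> y /uA uy; rewrite /invmx uy !mxE.
have C1 : Ck 1 U (fun y => (\det (A y))^-1).
  apply: C1V => //; first exact: mxC1_det.
  by move=> y /uA; rewrite unitmxE unitfE.
apply: C1M; [exact: C1| |exact: oU]; rewrite /cofactor.
apply: (@C1M _ _ _ (fun=> (-1) ^+ (j + i)) (fun y => \det (row' j (col' i (A y)))));
  [exact: C1_cst| |exact: oU].
apply: mxC1_det => a b; apply: (C1_ext oU _ (CA (lift j a) (lift i b))) => y _.
by rewrite !mxE.
Qed.

End MatrixC1.

Section LinearContinuity.
Context {R : realType}.

Lemma linear_coordinates_continuous (E F : normedModType R) (I : finType)
    (b : I -> E) (c : I -> E -> R) (f : E -> F) :
  coordinates b c -> linear f -> continuous f.
Proof.
move=> bc lf; pose fM := GRing.isLinear.Build _ _ _ _ _ lf.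
pose fL : {linear E -> F} := HB.pack f fM.
have -> : f = fun u => \sum_k c k u *: f (b k).
  apply/funext => u; have [_ _ e] := bc.
  rewrite -[f]/(fL : E -> F) {1}(e u) linear_sum.
  by apply: eq_bigr => k _; rewrite linearZ.
apply: continuous_bigsum => k u; apply: cvgZr_tmp.
have cc : continuous (c k) by exact: (@coordinates_continuous _ _ _ _ _ k bc).
exact: cc.
Qed.

(** Needed for the model space of the bundle: [K] is a closed subset of the image of a ball of row
    vectors under the linear map [phi]. *)
Lemma coordinates_compact (E : normedModType R) (I : finType)
    (b : I -> E) (c : I -> E -> R) (K : set E) (r : R) :
  coordinates b c -> closed K ->
  (forall z, K z -> `|z| <= r) -> compact K.
Proof.
move=> [lin bd e] clK Kr.
pose phi (u : 'rV[R]_#|I|) : E := \sum_k u 0 (enum_rank k) *: b k.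
have cphi : continuous phi.
  apply: (linear_coordinates_continuous (rV_coordinates #|I|)) => a u v.
  rewrite /phi scaler_sumr -big_split /=; apply: eq_bigr => k _.
  by rewrite !mxE scalerDl scalerA.
apply: (@subclosed_compact _ _ (phi @` [set u | `|u - 0| <= r])) => //.
  apply: continuous_compact; last exact: closed_ball_rV_compact.
  exact: continuous_subspaceT.
move=> z Kz; exists (\row_i c (enum_val i) z).
  rewrite /= subr0; apply: rV_norm_le => [|i]; first exact: le_trans (Kr z Kz).
  by rewrite mxE; apply: le_trans (bd _ _) (Kr z Kz).
by rewrite /phi [RHS]e; apply: eq_bigr => k _; rewrite mxE enum_rankK.
Qed.

End LinearContinuity.

Section GrassCharts.
Context {R : realType} {n q : nat} (qn : (q <= n)%N).
Local Notation E := 'rV[R]_n.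
Local Notation EG := ('rV[R]_n * 'M[R]_(q, n - q))%type.
Context (M : topologicalType).
Context (B : set (chart M E)) (hB : smooth_atlas B).
Context (S : charted M E) (SB : atlas S `<=` B) (hS : smooth_manifold S).

Let qrn : (q + (n - q) = n)%N := subnKC qn.
Let bc := @rV_coordinates R n.
Let bcG := @prod_coordinates R n q (n - q).

Fact jac_key : unit. Proof. exact: tt. Qed.
(** Tangent vectors are rows, so this is the transpose of the usual Jacobian matrix and the chain
    rule reads from left to right. *)
Definition jac (e e' : chart M E) (z : E) : 'M[R]_n :=
  locked_with jac_key (lin1_mx ('d (transition e e') z)).

Definition to_plane (e : chart M E) (x : M) (V : {vspace E}) : {vspace E} :=
  locked_with jac_key (linfun (to_chart S e x) @: V)%VS.

Definition of_plane (e : chart M E) (x : M) (V : {vspace E}) : {vspace E} :=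
  locked_with jac_key (linfun (of_chart S e x) @: V)%VS.

Lemma to_planeE e x V : (linfun (to_chart S e x) @: V)%VS = to_plane e x V.
Proof. by rewrite /to_plane locked_withE. Qed.

Lemma of_planeE e x V : (linfun (of_chart S e x) @: V)%VS = of_plane e x V.
Proof. by rewrite /of_plane locked_withE. Qed.

Lemma mul_jac e e' x (u : 'rV[R]_n) :
  u *m jac e e' (chart_map e x) = dtrans e e' x u.
Proof. by rewrite /jac locked_withE mul_rV_lin1. Qed.

Lemma to_plane_row_space m e x (A : 'M[R]_(m, n)) : to_plane e x (row_space A) =
  row_space (A *m jac (chart_at S x) e (chart_map (chart_at S x) x)).
Proof. rewrite -to_planeE /jac (locked_withE jac_key).
exact: (row_space_lin1 A ('d (transition (chart_at S x) e) (chart_map (chart_at S x) x))). Qed.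

Lemma of_plane_row_space m e x (A : 'M[R]_(m, n)) : of_plane e x (row_space A) =
  row_space (A *m jac e (chart_at S x) (chart_map e x)).
Proof. rewrite -of_planeE /jac (locked_withE jac_key).
exact: (row_space_lin1 A ('d (transition e (chart_at S x)) (chart_map e x))). Qed.

Lemma jacE e e' z i j : differentiable (transition e e') z ->
  jac e e' z i j = 'D_(delta_mx 0 i) (transition e e') z 0 j.
Proof. by move=> d; rewrite /jac locked_withE mxE deriveE. Qed.

Lemma limg_dim_le (f : 'End(E)) (V : {vspace E}) : (\dim (f @: V)%VS <= \dim V)%N.
Proof. by rewrite -(limg_ker_dim f V) leq_addl. Qed.

Lemma dim_to_plane_le e x V : (\dim (to_plane e x V) <= \dim V)%N.
Proof. by rewrite /to_plane locked_withE; exact: limg_dim_le. Qed.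

Lemma dim_of_plane_le e x V : (\dim (of_plane e x V) <= \dim V)%N.
Proof. by rewrite /of_plane locked_withE; exact: limg_dim_le. Qed.

Lemma jac_mul e e' e'' x : B e -> B e' -> B e'' ->
  chart_dom e x -> chart_dom e' x -> chart_dom e'' x ->
  jac e e' (chart_map e x) *m jac e' e'' (chart_map e' x) = jac e e'' (chart_map e x).
Proof.
move=> Be Be' Be'' ex e'x e''x; apply/row_matrixP => i; rewrite !rowE mulmxA.
have h1 := mul_jac e e' x (delta_mx 0 i).
have h2 := mul_jac e' e'' x (dtrans e e' x (delta_mx 0 i)).
have h3 := mul_jac e e'' x (delta_mx 0 i).
have h4 := dtrans_comp hB (delta_mx 0 i) Be Be' Be'' ex e'x e''x.
exact: (etrans (congr1 (fun w => w *m _) h1) (etrans h2 (etrans h4 (esym h3)))).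
Qed.

Lemma jac_id e x : B e -> chart_dom e x -> jac e e (chart_map e x) = 1%:M.
Proof.
move=> Be ex; apply/row_matrixP => i; rewrite !rowE (mul_jac e e x) mulmx1.
exact: (dtrans_id hB).
Qed.

Lemma plane_transition m e e' x (A : 'M[R]_(m, n)) : B e -> B e' ->
  chart_dom e x -> chart_dom e' x ->
  to_plane e' x (of_plane e x (row_space A)) = row_space (A *m jac e e' (chart_map e x)).
Proof.
move=> Be Be' ex e'x; rewrite of_plane_row_space to_plane_row_space -mulmxA.
have B0 := chart_at_B SB hS x; have d0 := chart_at_dom hS x.
by rewrite (jac_mul Be B0 Be' ex d0 e'x).
Qed.

Lemma to_of_plane e x V : B e -> chart_dom e x -> to_plane e x (of_plane e x V) = V.
Proof.
move=> Be ex; rewrite -(vspace_rowsK (erefl (\dim V))) (plane_transition _ Be Be ex ex).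
by rewrite (jac_id Be ex) mulmx1.
Qed.

Lemma of_to_plane e x V : B e -> chart_dom e x -> of_plane e x (to_plane e x V) = V.
Proof.
move=> Be ex; rewrite -(vspace_rowsK (erefl (\dim V))).
have B0 := chart_at_B SB hS x; have d0 := chart_at_dom hS x.
rewrite to_plane_row_space of_plane_row_space -mulmxA.
by rewrite (jac_mul B0 Be B0 d0 ex d0) (jac_id B0 d0) mulmx1.
Qed.

Lemma dim_of_plane e x V : B e -> chart_dom e x -> \dim (of_plane e x V) = \dim V.
Proof.
move=> Be ex; apply/eqP; rewrite eqn_leq dim_of_plane_le /=.
by have := dim_to_plane_le e x (of_plane e x V); rewrite to_of_plane.
Qed.

Lemma dim_to_plane e x V : B e -> chart_dom e x -> \dim (to_plane e x V) = \dim V.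
Proof.
move=> Be ex; apply/eqP; rewrite eqn_leq dim_to_plane_le /=.
by have := dim_of_plane_le e x (to_plane e x V); rewrite of_to_plane.
Qed.

Lemma to_chart_at_plane x V : to_plane (chart_at S x) x V = V.
Proof.
have B0 := chart_at_B SB hS x; have d0 := chart_at_dom hS x.
rewrite -(vspace_rowsK (erefl (\dim V))) to_plane_row_space.
by rewrite (jac_id B0 d0) mulmx1.
Qed.

Lemma grass_mapE e P Q (p : M * {vspace E}) : chart_map (grass_chart S e P Q) p =
  (chart_map e p.1, xget (0 : 'M[R]_(q, n - q)) [set X | in_affine_chart P Q (to_plane e p.1 p.2) X]).
Proof. by rewrite -to_planeE. Qed.

Lemma grass_invE e P Q (y : EG) : chart_inv (grass_chart S e P Q) y =
  (chart_inv e y.1, of_plane e (chart_inv e y.1) (row_space (P + y.2 *m Q))).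
Proof. by rewrite -of_planeE. Qed.

Lemma grass_domE e (P : 'M[R]_(q, n)) (Q : 'M[R]_(n - q, n)) (p : M * {vspace E}) :
  chart_dom (grass_chart S e P Q) p <->
  [/\ chart_dom e p.1, \dim p.2 = q & exists X, in_affine_chart P Q (to_plane e p.1 p.2) X].
Proof. by rewrite -to_planeE. Qed.

Section OneChart.
Context (e : chart M E) (Se : atlas S e).
Context (P : 'M[R]_(q, n)) (Q : 'M[R]_(n - q, n)).
Context (Nl : 'M[R]_(n, q)) (Nr : 'M[R]_(n, n - q)) (PQ : frame P Q Nl Nr).
Let Be := SB Se.
Let te := atlas_chart hB Be.
Local Notation ge := (grass_chart S e P Q).

Lemma grass_chart_invK z X : chart_image e setT z ->
  chart_dom ge (chart_inv ge (z, X)) /\ chart_map ge (chart_inv ge (z, X)) = (z, X).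
Proof.
move=> iz; have ex := chart_image_dom te iz.
have planeE : in_affine_chart P Q (to_plane e (chart_inv e z)
    (of_plane e (chart_inv e z) (row_space (P + X *m Q)))) X.
  by rewrite to_of_plane.
rewrite grass_invE grass_domE grass_mapE /=; split.
  split => //; last by exists X.
  rewrite dim_of_plane//; apply/row_free_dim; exact: frame_graph_free PQ X.
by rewrite (chart_invK te iz) (affine_chart_xget PQ planeE).
Qed.

(** Read in the preferred chart [e0] of M, the plane with coordinate [X] has the basis
    [(P + X *m Q) *m jac e e0 z]. By [affine_chartP] its new coordinate is a rational function of
    [X] and of the first derivatives of the transition map. These are C^1, so the coordinate change
    is C^1 where the denominator [h] does not vanish. *)
Lemma grass_regular z X : chart_image e setT z -> regular_at (grass_bundle S q) ge (z, X).
Proof.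
move=> iz; have ex := chart_image_dom te iz.
have [domzX mapzX] := grass_chart_invK X iz.
split=> //; set p := chart_inv ge (z, X); set x := chart_inv e z in ex.
have px : p.1 = x by [].
pose e0 := chart_at S x.
have Be0 : B e0 := chart_at_B SB hS x.
have e0x : chart_dom e0 x := chart_at_dom hS x.
have dV : \dim p.2 = q by have /grass_domE[] := domzX.
pose P0 := vspace_rows q p.2; pose Q0 := vspace_rows (n - q) (p.2 ^C)%VS.
have P0V : row_space P0 = p.2 by exact: vspace_rowsK.
have dVC : \dim (p.2 ^C)%VS = (n - q)%N.
  by rewrite dimv_compl dimvf dim_matrix mul1r dV.
have Q0V : row_space Q0 = (p.2 ^C)%VS by exact: vspace_rowsK.
have fP0 : row_free P0 by apply/row_free_dim; rewrite P0V.
have fQ0 : row_free Q0 by apply/row_free_dim; rewrite Q0V.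
have f0 : row_free (col_mx P0 Q0).
  apply: inj_row_free => v; rewrite -[v]hsubmxK mul_row_col => v0.
  have aP : lsubmx v *m P0 \in p.2 by rewrite -P0V; apply/row_spaceP; exists (lsubmx v).
  have bQ : rsubmx v *m Q0 \in (p.2 ^C)%VS.
    by rewrite -Q0V; apply/row_spaceP; exists (rsubmx v).
  have aQ : lsubmx v *m P0 = - (rsubmx v *m Q0) by apply/eqP; rewrite -addr_eq0 v0.
  have a0 : lsubmx v *m P0 = 0.
    apply/eqP; rewrite -memv0 -(capv_compl p.2) memv_cap aP /= aQ.
    by rewrite memvN.
  have b0 : rsubmx v *m Q0 = 0 by apply/eqP; rewrite -oppr_eq0 -aQ a0.
  have -> : lsubmx v = 0 by apply: (row_free_inj fP0); rewrite a0 mul0mx.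
  have -> : rsubmx v = 0 by apply: (row_free_inj fQ0); rewrite b0 mul0mx.
  by rewrite row_mx0.
have [N0l [N0r PQ0]] := frame_exists qrn f0.
pose O := [set y : EG | chart_image e (chart_dom e0) y.1].
have oO1 : open (chart_image e (chart_dom e0)).
  by apply: chart_image_open => //; exact: chart_dom_open (atlas_chart hB Be0).
have cfst : continuous (fst : EG -> E) by move=> y; exact: cvg_fst.
have oO : open O by apply: open_comp => // y _; exact: cfst.
have CJ : mxC1 O (fun y : EG => jac e e0 y.1).
  move=> i j; have C1 := transition_derive_C1 hB (delta_mx 0 i) Be Be0.
  have C2 := C1_coord bc j oO1 C1.
  have Cfst : Ck 1 O (fst : EG -> E) by apply: C1_linear.
  apply: (C1_ext oO _ (C1_comp bc Cfst C2 _ oO)) => // y Oy.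
  by rewrite /= jacE//; exact: (C1_diff (transition_C1 hB Be Be0) Oy).
have CX : mxC1 O (fun y : EG => P + y.2 *m Q).
  apply: mxC1_add => //; first exact: mxC1_cst.
  apply: mxC1_mul => //; last exact: mxC1_cst.
  have Cid : Ck 1 O (idfun : EG -> EG) by apply: C1_linear => // y; exact: cvg_id.
  by move=> i j; exact: (C1_coord bcG (inr (i, j)) oO Cid).
have CA (l : nat) (N : 'M[R]_(n, l)) :
    mxC1 O (fun y : EG => (P + y.2 *m Q) *m jac e e0 y.1 *m N).
  exact: (mxC1_mul oO (mxC1_mul oO CX CJ) (mxC1_cst _ N)).
pose h (y : EG) := \det ((P + y.2 *m Q) *m jac e e0 y.1 *m N0l).
have Ch : Ck 1 O h by exact: mxC1_det.
pose U := [set y | O y /\ h y != 0].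
have oU : open U.
  rewrite openE => y [Oy hy]; rewrite /interior; apply: filterI.
    exact: open_nbhs_nbhs.
  apply: (@near_comp _ _ h y (fun t => t != 0) (C1_continuous Ch Oy)).
  by apply: open_nbhs_nbhs; split; [exact: open_neq|].
have dome0 y : O y -> chart_dom e (chart_inv e y.1) /\ chart_dom e0 (chart_inv e y.1).
  move=> /(chart_imageP te)[iy ey]; split => //; exact: chart_image_dom te _ iy.
have planeE y : O y -> to_plane e0 (chart_inv e y.1)
    (of_plane e (chart_inv e y.1) (row_space (P + y.2 *m Q))) =
    row_space ((P + y.2 *m Q) *m jac e e0 y.1).
  move=> Oy; have [ey e0y] := dome0 y Oy.
  rewrite (plane_transition _ Be Be0 ey e0y) (chart_invK te)//.
  by have /(chart_imageP te)[] := Oy.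
have graph_dim y : \dim (row_space (P + y.2 *m Q)) = q.
  by apply/row_free_dim; exact: frame_graph_free PQ y.2.
have freeE y : O y -> row_free ((P + y.2 *m Q) *m jac e e0 y.1).
  move=> Oy; have [ey e0y] := dome0 y Oy; apply/row_free_dim; rewrite -(planeE _ Oy).
  by rewrite (dim_to_plane _ Be0 e0y) (dim_of_plane _ Be ey) graph_dim.
have unitE y : U y -> (P + y.2 *m Q) *m jac e e0 y.1 *m N0l \in unitmx.
  by move=> [_ hy]; rewrite unitmxE unitfE.
have OzX : O (z, X) by apply/(chart_imageP te); split.
(* At the base point the plane is the row space of [P0] itself, with coordinate 0 in the preferred
   chart, so the denominator is invertible there. *)
have UzX : U (z, X).
  split => //; rewrite -unitfE -unitmxE.
  have /(affine_chartP PQ0 _ (freeE _ OzX))[] //: in_affine_chart P0 Q0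
      (row_space ((P + X *m Q) *m jac e e0 z)) 0.
  rewrite /in_affine_chart -(planeE _ OzX) mul0mx addr0 P0V.
  by rewrite /p grass_invE; exact: to_chart_at_plane.
exists U; split => //.
- move=> y Uy; have [Oy _] := Uy; have [ey e0y] := dome0 y Oy.
  rewrite grass_invE; apply/grass_domE; split => //=.
    by rewrite (dim_of_plane _ Be ey) graph_dim.
  eexists; rewrite (planeE _ Oy); apply/(affine_chartP PQ0 _ (freeE _ Oy)).
  by split; [exact: unitE|reflexivity].
have UO : U `<=` O by move=> y [].
pose tau (y : EG) : EG := (transition e e0 y.1,
  invmx ((P + y.2 *m Q) *m jac e e0 y.1 *m N0l) *m
  ((P + y.2 *m Q) *m jac e e0 y.1 *m N0r)).
apply: (C1_ext oU (f := tau)) => [y Uy|].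
  have [Oy _] := Uy; have [ey e0y] := dome0 y Oy.
  rewrite /comp grass_invE grass_mapE /= (planeE _ Oy).
  by rewrite (affine_chart_coordE PQ0 (freeE _ Oy) (unitE _ Uy)).
apply: (C1_of_coord bcG oU) => -[i|[i j]] /=.
  have C2 := C1_coord bc i oO1 (transition_C1 hB Be Be0).
  have Cfst : Ck 1 U (fst : EG -> E) by apply: C1_linear.
  by apply: (C1_comp bc Cfst C2 _ oU) => y [].
have CU (l : nat) (N : 'M[R]_(n, l)) :
    mxC1 U (fun y : EG => (P + y.2 *m Q) *m jac e e0 y.1 *m N).
  by move=> a b; exact: C1_sub UO (CA l N a b).
by apply: (mxC1_mul oU); [apply: (mxC1_inv oU)|].
Qed.

End OneChart.
End GrassCharts.

(** * Distances in the Grassmannian bundle *)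

Section GrassLocal.
Context {R : realType} {n q : nat} (qn : (q <= n)%N).
Local Notation E := 'rV[R]_n.
Local Notation EG := ('rV[R]_n * 'M[R]_(q, n - q))%type.
Context (M : topologicalType).
Context (B : set (chart M E)) (hB : smooth_atlas B).
Context (S : charted M E) (SB : atlas S `<=` B) (hS : smooth_manifold S).
Context (gG : M * {vspace E} -> EG -> EG -> R)
  (hgG : riemannian_metric (grass_bundle S q) gG).
Let qrn : (q + (n - q) = n)%N := subnKC qn.
Local Notation dG := (rdist (grass_bundle S q) gG).
Local Notation sP := (selP qrn).
Local Notation sQ := (selQ qrn).

Lemma grass_segment_perm (p : M) (s : {perm 'I_n}) (e := chart_at S p) :
  exists C r : R, [/\ 0 < C, 0 < r & forall x y, chart_dom e x -> chart_dom e y ->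
    `|chart_map e x - chart_map e p| < r -> `|chart_map e y - chart_map e p| < r ->
    forall X1 X2 : 'M[R]_(q, n - q), `|X1| <= 2 -> `|X2| <= 2 ->
    (dG (x, of_plane S e x (row_space (sP s + X1 *m sQ s)))
        (y, of_plane S e y (row_space (sP s + X2 *m sQ s))) <=
     (C * (`|chart_map e x - chart_map e y| + `|X1 - X2|))%:E)%E].
Proof.
have Se : atlas S e := chart_at_atlas hS p; have Be := SB Se.
have te := atlas_chart hB Be; have ep : chart_dom e p := chart_at_dom hS p.
have oi : open (chart_image e setT) by case: te.
have [r /= r0 rP] := (nbhs_ballP _ _).1
  (open_nbhs_nbhs (conj oi (chart_map_image ep))).
have PQ := perm_frame qrn (R := R) s.
set ge := grass_chart S e (sP s) (sQ s).
have r20 : 0 < r / 2 by rewrite divr_gt0.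
have r2r : r / 2 < r by rewrite ltr_pdivrMr// mulr_natr mulr2n ltrDl.
(* Convex and compact: the radius [r / 2] keeps it over the image of [e], and the radius 2 is that
   of [graph_step]. *)
pose K := [set y : EG | `|y.1 - chart_map e p| <= r / 2 /\ `|y.2| <= 2].
have Kim1 (y : EG) : K y -> chart_image e setT y.1.
  by move=> [yr _]; apply: rP; rewrite -ball_normE /= distrC (le_lt_trans yr).
have Kim : K `<=` chart_image ge setT.
  move=> [z X] Ky; have [d m] := grass_chart_invK hB SB hS Se PQ X (Kim1 _ Ky).
  by exists (chart_inv ge (z, X)).
have cK : compact K.
  apply: (@coordinates_compact _ _ _ _ _ _ (r / 2 + `|chart_map e p| + 2)
    (prod_coordinates n q (n - q))).
    have -> : K = [set y : EG | `|y.1 - chart_map e p| <= r / 2] `&`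
      [set y : EG | `|y.2| <= 2] by [].
    apply: closedI.
      have cf : continuous (fun y : EG => `|y.1 - chart_map e p|).
        move=> y; apply: (@cvg_comp _ _ _ fst (fun z : E => `|z - chart_map e p|)).
          exact: cvg_fst.
        exact: dist_continuous.
      by move/continuous_closedP : cf => /(_ [set t | t <= r / 2]); apply; exact: closed_le.
    have cf : continuous (fun y : EG => `|y.2|).
      move=> y; apply: (@cvg_comp _ _ _ snd (fun X : 'M[R]_(q, n - q) => `|X|)).
        exact: cvg_snd.
      exact: norm_continuous.
    by move/continuous_closedP : cf => /(_ [set t | t <= 2]); apply; exact: closed_le.
  move=> [z X] [/= zr X2]; rewrite prod_normE /= ge_max; apply/andP; split; last first.
    by apply: le_trans X2 _; rewrite lerDr addr_ge0// ltW.
  have := ler_normD (z - chart_map e p) (chart_map e p); rewrite subrK; lra.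
have Kconv z1 z2 t : K z1 -> K z2 -> t \in `[0, 1] -> K (segment z1 z2 t).
  have conv (V : normedModType R) (u1 u2 a : V) (l : R) : 0 <= t -> t <= 1 ->
      `|u1 - a| <= l -> `|u2 - a| <= l -> `|u1 + t *: (u2 - u1) - a| <= l.
    move=> t0 t1 h1 h2; have -> : u1 + t *: (u2 - u1) - a = (1 - t) *: (u1 - a) + t *: (u2 - a).
      have -> : u2 - u1 = (u2 - a) - (u1 - a) by rewrite [in RHS]opprB [in RHS]addrA subrK.
      by rewrite scalerBr scalerBl scale1r addrAC -[RHS]addrA; congr (_ + _); rewrite addrC.
    apply: le_trans (ler_normD _ _) _; rewrite !normrZ !ger0_norm ?subr_ge0//.
    have h3 : (1 - t) * `|u1 - a| <= (1 - t) * l by rewrite ler_wpM2l ?subr_ge0.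
    have h4 : t * `|u2 - a| <= t * l by rewrite ler_wpM2l.
    lra.
  rewrite in_itv/= => -[k1 k1'] [k2 k2'] /andP[t0 t1]; split; first exact: conv.
  by have := conv _ z1.2 z2.2 0 2 t0 t1; rewrite !subr0; exact.
have Kreg (y : EG) : K y -> regular_at (grass_bundle S q) ge y.
  by case: y => z X Ky; exact: (grass_regular qn hB SB hS Se PQ X (Kim1 _ Ky)).
have At : atlas (grass_bundle S q) ge.
  by exists e, (sP s), (sQ s); split => //; exact: frame_row_free PQ.
have [C C0 CP] := segment_rdist_compact (prod_coordinates n q (n - q)) hgG At cK Kim Kconv Kreg.
exists C, (r / 2); split => // x y ex ey /ltW xr /ltW yr X1 X2 X12 X22.
have Kx : K (chart_map e x, X1) by split.
have Ky : K (chart_map e y, X2) by split.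
have := CP _ _ Kx Ky; rewrite /ge !grass_invE /= (chart_mapK te ex) (chart_mapK te ey).
move=> /le_trans; apply; rewrite lee_fin ler_pM2l// prod_normE /= ge_max.
by rewrite lerDl lerDr !normr_ge0.
Qed.

Lemma grass_segment (p : M) (e := chart_at S p) :
  exists2 C : R, 0 < C & exists2 V : set M, nbhs p V & forall x y, V x -> V y ->
  [/\ chart_dom e x, `|chart_map e x - chart_map e p| < 1 &
    forall s (X1 X2 : 'M[R]_(q, n - q)), `|X1| <= 2 -> `|X2| <= 2 ->
    (dG (x, of_plane S e x (row_space (sP s + X1 *m sQ s)))
        (y, of_plane S e y (row_space (sP s + X2 *m sQ s))) <=
     (C * (`|chart_map e x - chart_map e y| + `|X1 - X2|))%:E)%E].
Proof.
have Be : B e := chart_at_B SB hS p; have ep : chart_dom e p := chart_at_dom hS p.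
have [C Cr] := choice (grass_segment_perm p).
have [r CrP] := choice Cr.
have C0 s : 0 < C s by have [] := CrP s.
have ns s : \forall x \near p, chart_dom e x /\ `|chart_map e x - chart_map e p| < r s.
  by have [_ r0 _] := CrP s; exact: (near_chart_ball hB Be ep r0).
exists (\sum_s C s + 1); first by rewrite ltr_wpDl// sumr_ge0// => s _; exact: ltW.
exists [set x | (forall s, chart_dom e x /\ `|chart_map e x - chart_map e p| < r s) /\
  chart_dom e x /\ `|chart_map e x - chart_map e p| < 1].
  by apply: filterI; [exact: near_forall|exact: (near_chart_ball hB Be ep ltr01)].
move=> x y [xr [ex x1]] [yr [ey y1]]; split => // s X1 X2 h1 h2.
have [_ _ h] := CrP s; have [_ xs] := xr s; have [_ ys] := yr s.
apply: le_trans (h x y ex ey xs ys X1 X2 h1 h2) _.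
rewrite lee_fin ler_wpM2r ?addr_ge0// (bigD1 s)//= -addrA lerDl addr_ge0//.
by apply: sumr_ge0 => t _; exact: ltW.
Qed.

Lemma mem_to_plane e x (V : {vspace E}) (w : E) : w \in V -> to_chart S e x w \in to_plane S e x V.
Proof. by move=> wV; rewrite -to_planeE; apply/memv_imgP; exists w; rewrite ?lfunE. Qed.

Lemma to_planeP e x (V : {vspace E}) (v : E) : v \in to_plane S e x V -> exists2 w, w \in V & v = to_chart S e x w.
Proof. by rewrite -to_planeE => /memv_imgP[w wV ->]; exists w; rewrite ?lfunE. Qed.

Definition close_planes (e : chart M E) x y (V W : {vspace E}) (d : R) :=
  forall w, w \in W -> exists2 v, v \in V &
    `|to_chart S e y w - to_chart S e x v| <= d * `|to_chart S e y w|.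

(** For small [d] both planes are graphs in one coordinate chart and are joined by a segment. For
    large [d] it suffices that any two planes over the neighbourhood are at distance at most [D],
    since [D] is then at most a multiple of [d]. *)
Lemma grass_local (p : M) (e := chart_at S p) :
  exists2 C : R, 0 < C & exists2 U : set M, nbhs p U & forall x y, U x -> U y ->
  chart_dom e x /\ forall V W, \dim V = q -> \dim W = q ->
    (dG (x, V) (y, W) <= C%:E)%E /\
    forall d, 0 <= d -> close_planes e x y V W d ->
      (dG (x, V) (y, W) <= (C * (`|chart_map e x - chart_map e y| + d))%:E)%E.
Proof.
have Be : B e := chart_at_B SB hS p.
have [C C0 [U nU UP]] := grass_segment p.
have [N NP] := @graph_chain_bounded R n q (n - q) qrn.
(* [C * 2] pays for moving the base point with a fixed coordinate; then at most [N] steps in the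
   fibre over [y], each between coordinates of norm at most 2, cost [C * 4] each. *)
pose D : R := C * 2 + N%:R * (C * 4).
have D0 : 0 < D by rewrite ltr_wpDr ?mulr_gt0// mulr_ge0// mulr_ge0// ltW.
(* The constant of [graph_perturbation]; the condition [Q1 * d <= 1] keeps the coordinate [Y] below
   within norm 2. *)
pose Q1 : R := 2 * (1 + q%:R) ^+ 2.
have Q10 : 0 < Q1 by rewrite mulr_gt0// exprn_gt0// ltr_wpDr.
exists (D + D * Q1 + C * (1 + Q1)).
  exact: (addr_gt0 (addr_gt0 D0 (mulr_gt0 D0 Q10)) (mulr_gt0 C0 (addr_gt0 ltr01 Q10))).
have pos1 : 0 <= C * (1 + Q1) by rewrite mulr_ge0 ?ltW// addr_gt0.
have pos2 : 0 <= D * Q1 by rewrite mulr_ge0 ?ltW.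
exists U => // x y Ux Uy.
have [ex x1 xyP] := UP x y Ux Uy; have [ey y1 _] := UP y x Uy Ux.
have yyP := UP y y Uy Uy; split => // V W dV dW.
have xy2 : `|chart_map e x - chart_map e y| <= 2.
  have := ler_normB (chart_map e x - chart_map e p) (chart_map e y - chart_map e p).
  rewrite opprB addrA subrK; lra.
have graphV : exists s X, `|X| <= 1 /\ to_plane S e x V = row_space (sP s + X *m sQ s).
  have dV' : \dim (to_plane S e x V) = q by rewrite (dim_to_plane hB SB hS).
  have fV : row_free (vspace_rows q (to_plane S e x V)).
    by apply/row_free_dim; rewrite vspace_rowsK.
  have [s [X [X1 VX]]] := graph_bounded qrn fV.
  by exists s, X; split => //; rewrite -VX vspace_rowsK.
have [s [X [X1 VX]]] := graphV.
have VE : V = of_plane S e x (row_space (sP s + X *m sQ s)).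
  by rewrite -VX (of_to_plane hB SB hS).
have X2 : `|X| <= 2 by apply: le_trans X1 _; rewrite ler1n.
have chainP k V1 W1 : graph_chain qrn k V1 W1 ->
    (dG (y, of_plane S e y V1) (y, of_plane S e y W1) <= (k%:R * (C * 4))%:E)%E.
  elim: k V1 => [|k IH] V1 /=; first by move=> ->; rewrite rdist_xx mul0r.
  move=> [U1 [[t [Y1 [Y2 [Y12 Y22 -> ->]]]] U1W1]].
  apply: le_trans (rdist_triangle _ _ _ (y, of_plane S e y (row_space (sP t + Y2 *m sQ t))) _) _.
  have -> : k.+1%:R * (C * 4) = C * 4 + k%:R * (C * 4) by rewrite -natr1 mulrDl mul1r addrC.
  rewrite EFinD; apply: leeD; last exact: IH.
  have [_ _ /(_ t Y1 Y2 Y12 Y22)] := yyP; move=> /le_trans; apply.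
  rewrite subrr normr0 add0r lee_fin ler_pM2l//.
  by have := ler_normB Y1 Y2; lra.
have bdd : (dG (x, V) (y, W) <= D%:E)%E.
  apply: le_trans (rdist_triangle _ _ _ (y, of_plane S e y (row_space (sP s + X *m sQ s))) _) _.
  rewrite {1}VE /D EFinD leeD//.
    apply: le_trans (xyP s X X X2 X2) _.
    by rewrite subrr normr0 addr0 lee_fin ler_pM2l.
  have [k kN kP] : exists2 k, (k <= N)%N & graph_chain qrn k
      (row_space (sP s + X *m sQ s)) (to_plane S e y W).
    apply: NP; last by rewrite (dim_to_plane hB SB hS).
    by rewrite -VX (dim_to_plane hB SB hS).
  have := chainP _ _ _ kP; rewrite (of_to_plane hB SB hS)// => /le_trans; apply.
  by rewrite lee_fin ler_wpM2r ?ler_nat// mulr_ge0// ltW.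
split.
  by apply: le_trans bdd _; rewrite lee_fin -addrA lerDl addr_ge0.
move=> d d0 VW; have n0 := normr_ge0 (chart_map e x - chart_map e y).
have [dsmall|dbig] := leP (Q1 * d) 1; last first.
  apply: le_trans bdd _; rewrite lee_fin.
  apply: (@le_trans _ _ (D * Q1 * d)); first by rewrite -mulrA -[leLHS]mulr1 ler_pM2l// ltW.
  have h1 : 0 <= D * d by rewrite mulr_ge0// ltW.
  have h2 : 0 <= C * (1 + Q1) * d by rewrite mulr_ge0.
  have h3 : 0 <= (D + D * Q1 + C * (1 + Q1)) * `|chart_map e x - chart_map e y|.
    by rewrite mulr_ge0// -addrA addr_ge0 ?(ltW D0)// addr_ge0.
  by rewrite mulrDr ler_wpDl// [leRHS]mulrDl -[leLHS]addr0 lerD// [leRHS]mulrDl lerDr.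
have q0 : 0 <= q%:R :> R by [].
have dsmall' : (1 + q%:R) * d <= 2^-1.
  have : (1 + q%:R) * d <= (1 + q%:R) ^+ 2 * d.
    by rewrite ler_wpM2r// expr2 ler_peMr ?addr_ge0// lerDl.
  move: dsmall; rewrite /Q1; lra.
have dW' : \dim (to_plane S e y W) = q by rewrite (dim_to_plane hB SB hS).
have [|Y WY XY] := graph_perturbation (qrn := qrn) (s := s) X1 dW' d0 dsmall'.
  move=> w /to_planeP[w0 w0W ->]; have [v vV vw] := VW w0 w0W.
  by exists (to_chart S e x v) => //; rewrite -VX; exact: mem_to_plane.
have Y2 : `|Y| <= 2.
  have := ler_normD (Y - X) X; rewrite subrK; move: XY; rewrite -/Q1; lra.
have WE : W = of_plane S e y (row_space (sP s + Y *m sQ s)).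
  by rewrite -WY (of_to_plane hB SB hS).
rewrite VE WE; apply: le_trans (xyP s X Y X2 Y2) _; rewrite lee_fin.
rewrite distrC in XY; rewrite -/Q1 in XY.
apply: (@le_trans _ _ (C * (1 + Q1) * (`|chart_map e x - chart_map e y| + d))); last first.
  by rewrite ler_wpM2r ?addr_ge0// lerDr addr_ge0// ltW.
rewrite -mulrA ler_pM2l//.
have h1 : 0 <= Q1 * `|chart_map e x - chart_map e y| by rewrite mulr_ge0// ltW.
lra.
Qed.

(** * Planes over points at finite distance *)

Section Far.
Context (cM : compact [set: M]) (g : M -> E -> E -> R).

Lemma curve_clopen (k : R -> M) (A : set M) : C1_curve S k -> open A -> open (~` A) ->
  A (k 0) -> A (k 1).
Proof.
move=> kC oA oA' Ak0.
have ck : {within `[0%R, 1%R], continuous k}.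
  apply: continuous_in_subspaceT => t /set_mem /= tI.
  have kt := @C1_curve_continuous _ _ _ B hB S SB hS k t kC; apply: kt.
  by rewrite inE in tI.
have I0 : (0 : R) \in `[0%R, 1%R] by rewrite in_itv/= lexx ler01.
have I1 : (1 : R) \in `[0%R, 1%R] by rewrite in_itv/= lexx ler01.
have cI : connected (`[0%R, 1%R] : set R) by exact: segment_connected.
have ckI := connected_continuous_connected cI ck.
have : (k @` `[0%R, 1%R] `&` A) = k @` `[0%R, 1%R].
  apply: ckI.
  - by exists (k 0); split => //; exists 0.
  - by exists A.
  - by exists A => //; rewrite -[A]classical_sets.setCK; exact: open_closedC.
have k1 : (k @` `[0%R, 1%R]) (k 1) by exists 1.
by move=> eA; rewrite -eA in k1; case: k1.
Qed.

(** Finiteness of the distance is used only to get a path joining the points, whose length gives no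
    bound. The cover sets linked to the first one by successive intersections have an open and
    closed union, which the path cannot leave; a chain of cover sets without repetition has at most
    [N] members. *)
Lemma grass_far : exists2 D : R, 0 < D & forall x y, (rdist S g x y < +oo)%E ->
  forall V W, \dim V = q -> \dim W = q -> (dG (x, V) (y, W) <= D%:E)%E.
Proof.
have loc (p : M) : exists CU : R * set M, [/\ 0 < CU.1, nbhs p CU.2 &
    forall x y, CU.2 x -> CU.2 y -> forall V W, \dim V = q -> \dim W = q ->
    (dG (x, V) (y, W) <= (CU.1)%:E)%E].
  have [C C0 [U nU UP]] := grass_local p; exists (C, U); split => // x y Ux Uy V W dV dW.
  by have [_ /(_ V W dV dW)[]] := UP x y Ux Uy.
have [F FP] := choice loc.
have [s sP] := @finite_subcover _ cM (fun p => ((F p).2)°)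
  (fun p => nbhs_interior (let: And3 _ h _ := FP p in h)).
pose N := size s; pose U (i : 'I_N) := ((F (tnth (in_tuple s) i)).2)°.
have oU i : open (U i) by exact: open_interior.
have Ucov x : exists i, U i x.
  have [p ps px] := sP x; have iN : (index p s < N)%N by rewrite index_mem.
  by exists (Ordinal iN); rewrite /U (tnth_nth p) /= nth_index.
pose C := \sum_(i < N) (F (tnth (in_tuple s) i)).1.
have Fi0 (i : 'I_N) : 0 < (F (tnth (in_tuple s) i)).1 by have [] := FP (tnth (in_tuple s) i).
have C0 : 0 <= C by apply: sumr_ge0 => i _; exact: ltW.
have UC i x y V W : U i x -> U i y -> \dim V = q -> \dim W = q ->
    (dG (x, V) (y, W) <= C%:E)%E.
  move=> /interior_subset Ux /interior_subset Uy dV dW.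
  have [_ _ h] := FP (tnth (in_tuple s) i); apply: le_trans (h x y Ux Uy V W dV dW) _.
  by rewrite lee_fin /C (bigD1 i)//= lerDl sumr_ge0// => j _; exact: ltW.
pose adj : rel 'I_N := fun i j => `[< exists z, U i z /\ U j z >].
have pathC l i x y V W : path adj i l -> U i x -> U (last i l) y ->
    \dim V = q -> \dim W = q -> (dG (x, V) (y, W) <= ((size l).+1%:R * C)%:E)%E.
  elim: l i x V => [|j l IH] i x V /=.
    by move=> _ Ux Uy dV dW; rewrite mul1r; exact: (UC i).
  move=> /andP[/asboolP[z [Uz Ujz]] jl] Ux Uy dV dW.
  (* Any q-plane over [z] may be the intermediate point; the same subspace [V] of the model space,
     read in T_zM, is one. *)
  apply: le_trans (rdist_triangle _ _ _ (z, V) _) _.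
  have -> : (size l).+2%:R * C = C + (size l).+1%:R * C by rewrite -natr1 mulrDl mul1r addrC.
  rewrite EFinD; apply: leeD; first exact: (UC i).
  exact: (IH j).
have connC i j x y V W : connect adj i j -> U i x -> U j y ->
    \dim V = q -> \dim W = q -> (dG (x, V) (y, W) <= (N%:R * C)%:E)%E.
  move=> /connectP[l il ->] Ux Uy dV dW.
  case: (shortenP il) Uy => l' il' ul' _ Uy.
  apply: le_trans (pathC l' i x y V W il' Ux Uy dV dW) _.
  rewrite lee_fin ler_wpM2r// ler_nat -[(size l').+1]/(size (i :: l')).
  by rewrite -(card_uniqP ul') -[leqRHS]card_ord max_card.
exists (N%:R * C + 1); first by rewrite ltr_wpDl// mulr_ge0.
move=> x y; rewrite /rdist => /ereal_inf_lt[_ [p xpy _] _] V W dV dW.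
have [i Ux] := Ucov x.
pose A := \bigcup_(j in [set j | connect adj i j]) U j.
pose A' := \bigcup_(j in [set j | ~ connect adj i j]) U j.
have AA' : ~` A = A'.
  apply/seteqP; split => z.
    by have [j Uz] := Ucov z => Az; exists j => //= ij; apply: Az; exists j.
  move=> [j /= ij Uz] [k /= ik Uz']; apply: ij; apply: connect_trans ik _.
  by apply: connect1; apply/asboolP; exists z.
have oA : open A by apply: bigcup_open => j _.
have oA' : open (~` A) by rewrite AA'; apply: bigcup_open => j _.
have : A y.
  have : A x by exists i => //; exact: connect0.
  elim: p x xpy {Ux} => [|c p IH] x /=; first by move=> ->.
  by move=> [cC <- cy] Ac0; apply: IH cy _; exact: curve_clopen Ac0.
move=> [j ij Uy]; apply: le_trans (connC i j x y V W ij Ux Uy dV dW) _.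
by rewrite lee_fin lerDl.
Qed.
End Far.

End GrassLocal.

(** * Moduli of continuity *)

Section Moduli.
Context {R : realType}.
Implicit Types (w f : R -> R) (t s a e : R).

Definition concave_on_pos f := forall s t a, 0 <= s -> 0 <= t -> 0 <= a -> a <= 1 ->
  a * f s + (1 - a) * f t <= f (a * s + (1 - a) * t).

Definition nondecreasing_on_pos f := forall s t, 0 <= s -> s <= t -> f s <= f t.


Lemma concave_scale f t a : concave_on_pos f -> 0 <= f 0 -> 0 <= t -> 0 <= a -> a <= 1 ->
  a * f t <= f (a * t).
Proof.
move=> cf f0 t0 a0 a1; have := cf t 0 a t0 (lexx _) a0 a1; rewrite mulr0 addr0.
have h : 0 <= (1 - a) * f 0 by rewrite mulr_ge0// subr_ge0.
lra.
Qed.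

(** Subadditivity: [s] and [t - s] are fractions of [t] adding up to 1, and [concave_scale] applies
    to both. *)
Lemma concave_increment f s t : concave_on_pos f -> 0 <= f 0 -> 0 <= s -> s <= t ->
  f t <= f s + f (t - s).
Proof.
move=> cf f0 s0; rewrite le_eqVlt => /predU1P[<-|st]; first by rewrite subrr lerDl.
have t0 : 0 < t by exact: le_lt_trans st.
have [h0 h1] : 0 <= s / t /\ s / t <= 1.
  by rewrite divr_ge0 ?(ltW t0)// ler_pdivrMr// mul1r ltW.
have := concave_scale cf f0 (ltW t0) h0 h1.
have [k0 k1] : 0 <= 1 - s / t /\ 1 - s / t <= 1 by split; lra.
have := concave_scale cf f0 (ltW t0) k0 k1.
by rewrite !mulrBl !mul1r divfK ?gt_eqF//; lra.
Qed.

(** By [concave_increment] the increments of [f] are bounded by its values near 0, so smallness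
    there gives continuity at every point. *)
Lemma concave_continuous f : concave_on_pos f -> nondecreasing_on_pos f -> 0 <= f 0 ->
  (forall e, 0 < e -> exists2 d, 0 < d & f d < e) -> {within `[0, +oo[, continuous f}.
Proof.
move=> cf nf f0 fe; apply/subspace_continuousP => t; rewrite /= in_itv/= andbT => t0.
apply/cvgrPdist_lt => e e0; have [d d0 fd] := fe e e0.
suff : \forall s \near t, 0 <= s -> `|f t - f s| < e.
  by apply: filterS => s h; rewrite /= in_itv/= andbT; exact: h.
apply/nbhs_ballP; exists d => //= s std s0; rewrite /ball /= in std.
rewrite ltr_norml; have [st|ts] := leP s t.
  have := concave_increment cf f0 s0 st; have := nf _ _ s0 st.
  have : f (t - s) <= f d by apply: nf; [lra|move: std; rewrite ger0_norm; lra].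
  lra.
have := concave_increment cf f0 t0 (ltW ts); have := nf _ _ t0 (ltW ts).
have : f (s - t) <= f d by apply: nf; [lra|move: std; rewrite ler0_norm; lra].
lra.
Qed.

Lemma modulus_nondecreasing w : modulus_of_continuity w -> nondecreasing_on_pos w.
Proof.
by move=> [_ _ _ inc _] s t s0; rewrite le_eqVlt => /predU1P[->//|st]; rewrite ltW// inc.
Qed.

Lemma modulus_small w e : modulus_of_continuity w -> 0 < e -> exists2 d, 0 < d & w d < e.
Proof.
move=> [w0 wp /subspace_continuousP cw _ _] e0.
have := cw 0; rewrite /= in_itv/= lexx => /(_ isT)/cvgrPdist_lt/(_ e e0) h.
have {}h : \forall s \near (0 : R), s \in `[0, +oo[ -> `|w 0 - w s| < e := h.
have [r /= r0 rP] := (nbhs_ballP _ _).1 h.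
exists (r / 2); first by rewrite divr_gt0.
have := rP (r / 2); rewrite /ball /= sub0r normrN ger0_norm ?divr_ge0 ?ltW// in_itv/= andbT.
rewrite w0 sub0r normrN => h'; apply: le_lt_trans (ler_norm _) _; apply: h'.
  by rewrite ltr_pdivrMr// mulr_natr mulr2n ltrDl.
by rewrite divr_ge0 ?ltW.
Qed.

Section Series.
Context (w : R -> R) (hw : modulus_of_continuity w) (th : R) (th0 : 0 < th) (th1 : th < 1)
  (K : R) (K1 : 1 <= K).

Let K0 : 0 < K. Proof. exact: lt_le_trans K1. Qed.
Let Kk k : 0 < K ^+ k. Proof. by rewrite exprn_gt0. Qed.

(** Bounded by [w 1], so the series of its dilations converges for every [K] as soon as [th < 1].
    Truncating the argument preserves monotonicity and concavity, though not strict monotonicity. *)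
Definition trunc t := w (Num.min t 1).

Lemma trunc_ge0 t : 0 <= t -> 0 <= trunc t.
Proof. by move=> t0; have [_ h _ _ _] := hw; apply: h; rewrite le_min t0 ler01. Qed.

Lemma trunc_le t : 0 <= t -> trunc t <= w 1.
Proof.
by move=> t0; apply: (modulus_nondecreasing hw); rewrite // ?le_min ?t0 ?ler01// ge_min lexx orbT.
Qed.

Lemma trunc_nd : nondecreasing_on_pos trunc.
Proof.
move=> s t s0 st; apply: (modulus_nondecreasing hw) => //; first by rewrite le_min s0 ler01.
by rewrite le_min !ge_min st lexx orbT.
Qed.

Lemma trunc_concave : concave_on_pos trunc.
Proof.
move=> s t a s0 t0 a0 a1; have [_ wp _ _ cw] := hw.
have b0 : 0 <= 1 - a by rewrite subr_ge0.
have m0 (u : R) : 0 <= u -> 0 <= Num.min u 1 by move=> u0; rewrite le_min u0 ler01.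
apply: le_trans (cw _ _ a (m0 _ s0) (m0 _ t0) a0 a1) _.
apply: (modulus_nondecreasing hw) => //; first by rewrite addr_ge0 ?mulr_ge0 ?m0.
rewrite le_min; apply/andP; split.
  by rewrite lerD// ler_wpM2l// ge_min lexx.
have h1 : a * Num.min s 1 <= a * 1 by rewrite ler_wpM2l// ge_min lexx orbT.
have h2 : (1 - a) * Num.min t 1 <= (1 - a) * 1 by rewrite ler_wpM2l// ge_min lexx orbT.
lra.
Qed.

Definition dilate_sum t (N : nat) := \sum_(k < N) th ^+ k * trunc (K ^+ k * t).

Let B := w 1 / (1 - th).
Let tk k : 0 <= th ^+ k. Proof. by rewrite exprn_ge0// ltW. Qed.

Lemma dilate_sumS t N : dilate_sum t N.+1 = trunc t + th * dilate_sum (K * t) N.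
Proof.
rewrite /dilate_sum big_ord_recl /= !expr0 !mul1r; congr (_ + _).
rewrite mulr_sumr; apply: eq_bigr => k _.
by rewrite /bump /= add1n exprS -mulrA (exprSr K) -mulrA.
Qed.

Lemma dilate_sum_le t N : 0 <= t -> dilate_sum t N <= B.
Proof.
(* [B] is the fixed point of the recursion [dilate_sumS] when the first term is bounded by [w 1]. *)
have BE : w 1 + th * B = B by rewrite /B; field; rewrite subr_eq0 gt_eqF.
have B0 : 0 <= B.
  by rewrite divr_ge0 ?subr_ge0 ?(ltW th1)//; have [_ wp _ _ _] := hw; exact: wp.
elim: N t => [|N IH] t t0; first by rewrite /dilate_sum big_ord0.
rewrite dilate_sumS -BE lerD ?trunc_le// ler_wpM2l ?(ltW th0)//.
by apply: IH; rewrite mulr_ge0// ltW.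
Qed.

Lemma dilate_sum_homo t : 0 <= t -> {homo dilate_sum t : m k / (m <= k)%N >-> m <= k}.
Proof.
move=> t0; apply: homo_leq => // [m n p|N]; first exact: le_trans.
by rewrite /dilate_sum big_ord_recr /= lerDl mulr_ge0// trunc_ge0// mulr_ge0// ltW.
Qed.

Lemma dilate_sum_cvg t : 0 <= t -> cvgn (dilate_sum t).
Proof.
move=> t0; apply: nondecreasing_is_cvgn; first exact: dilate_sum_homo.
by exists B => _ [N _ <-]; exact: dilate_sum_le.
Qed.

Definition dilate_series t := limn (dilate_sum t).

Lemma dilate_series_ge t N : 0 <= t -> dilate_sum t N <= dilate_series t.
Proof.
move=> t0; apply: nondecreasing_cvgn_le; [exact: dilate_sum_homo|exact: dilate_sum_cvg].
Qed.

Lemma dilate_series_le t x : 0 <= t -> (forall N, dilate_sum t N <= x) -> dilate_series t <= x.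
Proof. by move=> t0 h; apply: limr_le; [exact: dilate_sum_cvg|exact: nearW]. Qed.

Lemma dilate_series_rec t : 0 <= t -> dilate_series t <= trunc t + th * dilate_series (K * t).
Proof.
move=> t0; have Kt0 : 0 <= K * t by rewrite mulr_ge0// ltW.
apply: dilate_series_le => // N; apply: le_trans (dilate_sum_homo t0 (leqnSn N)) _.
by rewrite dilate_sumS lerD2l ler_wpM2l ?(ltW th0)// dilate_series_ge.
Qed.

Lemma dilate_series_ge0 t : 0 <= t -> 0 <= dilate_series t.
Proof. by move=> t0; have := dilate_series_ge 0 t0; rewrite /dilate_sum big_ord0. Qed.

Lemma dilate_series_leB t : 0 <= t -> dilate_series t <= B.
Proof. by move=> t0; apply: dilate_series_le => // N; exact: dilate_sum_le. Qed.

Lemma dilate_series0 : dilate_series 0 = 0.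
Proof.
apply/eqP; rewrite eq_le dilate_series_ge0// andbT; apply: dilate_series_le => // N.
rewrite /dilate_sum big1// => k _; rewrite mulr0 /trunc min_l ?ler01//.
by have [-> _ _ _ _] := hw; rewrite mulr0.
Qed.

Lemma dilate_series_nd : nondecreasing_on_pos dilate_series.
Proof.
move=> s t s0 st; have t0 : 0 <= t := le_trans s0 st.
apply: dilate_series_le => // N; apply: le_trans (dilate_series_ge N t0).
apply: ler_sum => k _; rewrite ler_wpM2l// trunc_nd ?mulr_ge0 ?(ltW (Kk k))//.
by rewrite ler_wpM2l// ltW.
Qed.

Lemma dilate_series_concave : concave_on_pos dilate_series.
Proof.
move=> s t a s0 t0 a0 a1; have b0 : 0 <= 1 - a by rewrite subr_ge0.
set u := a * s + (1 - a) * t; have u0 : 0 <= u by rewrite addr_ge0 ?mulr_ge0.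
have cs := dilate_sum_cvg s0; have ct := dilate_sum_cvg t0.
have c : (fun N => a * dilate_sum s N + (1 - a) * dilate_sum t N) @ \oo -->
    a * dilate_series s + (1 - a) * dilate_series t.
  by apply: cvgD; apply: cvgM => //; exact: cvg_cst.
rewrite -(cvg_lim _ c)//; apply: limr_le; first by apply/cvg_ex; eexists; exact: c.
apply: nearW => N; apply: le_trans (dilate_series_ge N u0).
rewrite /dilate_sum /= !mulr_sumr -big_split /=; apply: ler_sum => k _.
rewrite mulrCA (mulrCA (1 - a)) -mulrDr ler_wpM2l//.
have -> : K ^+ k * u = a * (K ^+ k * s) + (1 - a) * (K ^+ k * t) by rewrite /u; ring.
by apply: trunc_concave => //; rewrite mulr_ge0// ltW.
Qed.

(** Unfolding [dilate_series_rec] [N] times leaves a tail of at most [th ^+ N * B]; the finitely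
    many terms before it are made small by shrinking [d]. *)
Lemma dilate_series_small e : 0 < e -> exists2 d, 0 < d & dilate_series d < e.
Proof.
move=> e0; have B0 : 0 <= B by apply: le_trans (dilate_series_leB (lexx 0)); exact: dilate_series_ge0.
have approx N e' : 0 < e' -> exists2 d, 0 < d & dilate_series d <= e' + th ^+ N * B.
  elim: N e' => [|N IH] e' e'0.
    exists 1 => //; rewrite expr0 mul1r; apply: le_trans (dilate_series_leB ler01) _.
    by rewrite lerDr ltW.
  have e2 : 0 < e' / 2 by rewrite divr_gt0.
  have [d1 d10 d1P] := IH _ e2; have [d2 d20 d2P] := modulus_small hw e2.
  have m0 : 0 < Num.min (d1 / K) d2 by rewrite lt_min d20 divr_gt0.
  exists (Num.min (d1 / K) d2) => //.
  apply: le_trans (dilate_series_rec (ltW m0)) _.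
  have h1 : trunc (Num.min (d1 / K) d2) <= w d2.
    apply: (modulus_nondecreasing hw) => //; first by rewrite le_min (ltW m0) ler01.
    by rewrite !ge_min lexx orbT.
  have h2 : dilate_series (K * Num.min (d1 / K) d2) <= dilate_series d1.
    apply: dilate_series_nd; first by rewrite mulr_ge0// ltW.
    by rewrite mulrC -ler_pdivlMr// ge_min lexx.
  have h3 : th * dilate_series (K * Num.min (d1 / K) d2) <= th * (e' / 2 + th ^+ N * B).
    by rewrite ler_wpM2l ?(ltW th0)// (le_trans h2).
  have h4 : th * (e' / 2) <= 1 * (e' / 2) by rewrite ler_wpM2r// ltW.
  rewrite exprS -mulrA; rewrite mulrDr in h3; lra.
have e2 : 0 < e / 2 by rewrite divr_gt0.
have nth1 : `|th| < 1 by rewrite ger0_norm// ltW.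
have [N NP] : exists N, th ^+ N * B < e / 2.
  have /cvgrPdist_lt/(_ _ e2)[N _ /(_ N (leqnn N))] := cvg_geometric B nth1.
  by rewrite /= sub0r normrN => h; exists N; rewrite mulrC; exact: le_lt_trans (ler_norm _) h.
have [d d0 dP] := approx N _ e2; exists d => //; lra.
Qed.

End Series.

(** * Dini summability over dyadic scales *)

Section Dyadic.
Implicit Types (j J : nat).
Let p j : R := 2^-1 ^+ j.
Let I j : set R := `]p j.+1, p j].
Local Notation mu := (@lebesgue_measure R).

Let p0 j : 0 < p j. Proof. by rewrite exprn_gt0// invr_gt0. Qed.
Let p1 j : p j <= 1. Proof. by rewrite exprn_ile1// ?invr_ge0// invf_le1// ler1n. Qed.
Let pS j : p j.+1 = p j / 2. Proof. by rewrite /p exprSr. Qed.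

Lemma dyadic_cover t : 0 < t -> t <= 1 -> exists j, I j t.
Proof.
move=> t0 t1; have [N NP] : exists N, p N < t.
  have h : `|2^-1 : R| < 1 by rewrite ger0_norm ?invr_ge0// invf_lt1// ltr1n.
  have /cvgrPdist_lt/(_ _ t0)[N _ /(_ N (leqnn N))] := cvg_geometric 1 h.
  by rewrite /= mul1r sub0r normrN => /(le_lt_trans (ler_norm _)) h'; exists N.
elim: N NP => [|N IH] NP; first by move: NP; rewrite /p expr0 ltNge t1.
have [|tN] := ltP (p N) t; first exact: IH.
by exists N; rewrite /I /= in_itv/= NP.
Qed.

Let step j (c : R) t : \bar R := (c * \1_(I j) t)%:E.

Let step_measurable j c (D : set R) : measurable_fun (D : set (measurableTypeR R)) (step j c : measurableTypeR R -> \bar R).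
Proof.
apply/measurable_EFinP; apply: measurable_funM; first exact: measurable_cst.
by apply: measurable_indic; exact: measurable_itv.
Qed.

Let step_ge0 j c t : 0 <= c -> (0 <= step j c t)%E.
Proof. by move=> c0; rewrite lee_fin mulr_ge0. Qed.

Let step_integral j c : 0 <= c ->
  (\int[mu]_(t in `]0%R, 1%R]) step j c t)%E = (c * p j.+1)%:E.
Proof.
move=> c0; rewrite /step; under eq_integral do rewrite EFinM.
rewrite ge0_integralZl_EFin//; last first.
  by apply/measurable_EFinP; apply: measurable_indic; exact: measurable_itv.
rewrite integral_indic//; last exact: measurable_itv.
have -> : I j `&` `]0, 1] = I j.
  apply/setIidPl => t; rewrite /I /= !in_itv/= => /andP[h1 h2].
  by rewrite (lt_trans (p0 _) h1) (le_trans h2 (p1 _)).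
suff muI : mu (I j) = (p j.+1)%:E by apply: etrans (congr1 (mule c%:E) muI) _; rewrite -EFinM.
apply: etrans (lebesgue_measure_itv `]p j.+1, p j]) _ => /=.
rewrite lte_fin ifT; last by rewrite pS ltr_pdivrMr// mulr_natr mulr2n ltrDl.
by rewrite -EFinB; congr _%:E; rewrite pS; field.
Qed.

(** On []p j.+1, p j]], an interval of length [p j / 2], the integrand is at least
    [w (p j.+1) / p j]. Together with [dyadic_integral_lt] this reduces Dini summability to
    convergence of the sum of the [w (p j)]. *)
Lemma dyadic_sum_le w J : (forall t, 0 <= t -> 0 <= w t) -> nondecreasing_on_pos w ->
  ((\sum_(j < J) w (p j.+1) / 2)%:E <= \int[mu]_(t in `]0%R, 1%R]) (w t / t)%:E)%E.
Proof.
move=> w0 nw; pose c j := w (p j.+1) / p j.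
have c0 j : 0 <= c j by rewrite divr_ge0 ?w0// ltW.
have -> : (\sum_(j < J) w (p j.+1) / 2)%:E =
    (\int[mu]_(t in `]0%R, 1%R]) (\sum_(j <- index_enum 'I_J) step j (c j) t))%E.
  rewrite ge0_integral_sum//; last by move=> j t _; exact: step_ge0.
  rewrite -sumEFin; apply: eq_bigr => j _; rewrite step_integral// /c pS; congr _%:E.
  by field; rewrite gt_eqF.
apply: ge0_integral_le => // t; rewrite /= in_itv/= => /andP[t0 t1].
- by apply: sume_ge0 => j _; exact: step_ge0.
- by rewrite lee_fin divr_ge0 ?w0// ltW.
rewrite sumEFin lee_fin.
(* The first conjunct carries the induction: the first [J] intervals do not meet []0, p J]], so at
   most one term of the sum is nonzero. *)
suff [h1 h2] : (t <= p J -> \sum_(j < J) c j * \1_(I j) t = 0) /\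
  \sum_(j < J) c j * \1_(I j) t <= w t / t by [].
have wt0 : 0 <= w t / t by rewrite divr_ge0 ?w0// ltW.
elim: J => [|J [IH1 IH2]]; first by rewrite big_ord0.
rewrite big_ord_recr /=; have [tJ|Jt] := leP t (p J); last first.
  have -> : \1_(I J) t = 0 :> R.
    by rewrite indicE memNset// /I /= in_itv/= => /andP[_]; rewrite leNgt Jt.
  rewrite mulr0 addr0; split => // tJ; have := lt_le_trans Jt tJ.
  by rewrite pS => h; exfalso; have := p0 J; lra.
rewrite IH1// add0r indicE; have [Jt|tJ'] := leP t (p J.+1).
  by rewrite memNset ?mulr0// /I /= in_itv/= => /andP[]; rewrite ltNge Jt.
split; first by [].
rewrite mem_set /I/= ?in_itv/= ?tJ' ?tJ// mulr1 /c.
apply: ler_pM; [by apply: w0; exact: ltW|by rewrite invr_ge0 ltW| |].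
  by apply: nw; exact: ltW.
by rewrite lef_pV2 ?posrE.
Qed.

(** The comparison from above: the integrand lies below an infinite sum of step functions on the
    dyadic intervals, which cover []0, 1]] and can be integrated term by term. *)
Lemma dyadic_integral_lt w x : (forall t, 0 <= t -> 0 <= w t) -> nondecreasing_on_pos w ->
  (forall J, \sum_(j < J) w (p j) <= x) -> Dini_summable w.
Proof.
move=> w0 nw wx; pose c j := w (p j) / p j.+1.
have c0 j : 0 <= c j by rewrite divr_ge0 ?w0// ltW.
apply: (@le_lt_trans _ _ x%:E); last exact: ltry.
apply: (@le_trans _ _ (\int[mu]_(t in `]0%R, 1%R]) (\sum_(0 <= j <oo) step j (c j) t))%E).
  apply: ge0_integral_le => // t; rewrite /= in_itv/= => /andP[t0 t1].
  - by rewrite lee_fin divr_ge0 ?w0// ltW.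
  - by apply: nneseries_ge0 => j _ _; exact: step_ge0.
  have [j jt] := dyadic_cover t0 t1.
  apply: (@le_trans _ _ (step j (c j) t)).
    rewrite /step indicE mem_set// mulr1 lee_fin /c.
    move: jt; rewrite /I /= in_itv/= => /andP[h1 h2].
    apply: ler_pM; [by apply: w0; exact: ltW|by rewrite invr_ge0 ltW| |].
      by apply: nw => //; exact: ltW.
    by rewrite lef_pV2 ?posrE// ltW.
  apply: le_trans (nneseries_lim_ge j.+1 _); last by move=> i _ _; exact: step_ge0.
  by rewrite big_nat_recr//= leeDr// sume_ge0// => i _; exact: step_ge0.
rewrite integral_nneseries//; last by move=> j t _; exact: step_ge0.
apply: lime_le.
  by apply: is_cvg_nneseries => j _ _; apply: integral_ge0 => t _; exact: step_ge0.
apply: nearW => J; apply: le_trans (_ : (\sum_(j < J) w (p j))%:E <= _)%E; last by rewrite lee_fin.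
rewrite big_mkord -sumEFin; apply: lee_sum => j _.
by rewrite step_integral// /c divfK// gt_eqF.
Qed.

(* Summing [S t <= trunc w t + th * S (K * t)] over [t = 2 ^ - j] bounds the dyadic
   sum of [S] by a constant plus [th] times itself, since [K = 2 ^ m] shifts [j]. *)
Lemma dilate_modulus w m th : modulus_of_continuity w -> Dini_summable w ->
  0 < th -> th < 1 ->
  exists2 w', modulus_of_continuity w' /\ Dini_summable w' &
    (forall t, 0 <= t -> t <= w' t) /\
    forall t N, 0 <= t -> dilate_sum w th (2 ^+ m) t N <= w' t.
Proof.
move=> hw Dw th0 th1; pose K : R := 2 ^+ m.
have K1 : 1 <= K by rewrite exprn_ege1// ler1n.
have K0 : 0 < K by exact: lt_le_trans K1.
pose S := dilate_series w th K.
have S0 := dilate_series_ge0 hw th0 th1 K1; rewrite -/S in S0.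
have Snd := dilate_series_nd hw th0 th1 K1; rewrite -/S in Snd.
(* The added [t] makes the function strictly increasing, as a modulus must be, and lets it dominate
   Lipschitz terms later. *)
exists (fun t => S t + t); last first.
  split=> [t t0|t N t0]; first by rewrite lerDr S0.
  by apply: le_trans (dilate_series_ge hw th0 th1 K1 N t0) _; rewrite lerDl.
have nd : nondecreasing_on_pos (fun t => S t + t).
  by move=> s t s0 st; rewrite lerD// Snd.
have ge0 t : 0 <= t -> 0 <= S t + t by move=> t0; rewrite addr_ge0// S0.
have cc : concave_on_pos (fun t => S t + t).
  move=> s t a s0 t0 a0 a1.
  have := dilate_series_concave hw th0 th1 K1 s0 t0 a0 a1; rewrite -/S; lra.
split.
  split => //.
  - by rewrite addr0; exact: (dilate_series0 hw).
  - apply: concave_continuous => //; first exact: ge0.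
    move=> e e0; have e2 : 0 < e / 2 by rewrite divr_gt0.
    have [d d0 dP] := dilate_series_small hw th0 th1 K1 e2.
    have m0 : 0 < Num.min d (e / 2) by rewrite lt_min d0 e2.
    exists (Num.min d (e / 2)) => //.
    have h1 : S (Num.min d (e / 2)) <= S d by apply: Snd; [exact: ltW|rewrite ge_min lexx].
    have h2 : Num.min d (e / 2) <= e / 2 by rewrite ge_min lexx orbT.
    rewrite -/S in dP; lra.
  - by move=> s t s0 st; rewrite ler_ltD// Snd// ltW.
have [w00 wp _ _ _] := hw.
pose B := w 1 / (1 - th).
have SB t : 0 <= t -> S t <= B by move=> t0; exact: (dilate_series_leB hw th0 th1 K1).
have [x xP] : exists x, forall J, \sum_(j < J) w (p j) <= x.
  move: Dw; rewrite /Dini_summable; set X := (\int[_]_(_ in _) _)%E => Xlt.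
  have Xf : X \is a fin_num.
    rewrite ge0_fin_numE//; apply: integral_ge0 => t /=; rewrite in_itv/= => /andP[t0 _].
    by rewrite lee_fin divr_ge0 ?wp// ltW.
  have X0 J := dyadic_sum_le J wp (modulus_nondecreasing hw); rewrite -/X in X0.
  exists (w 1 + 2 * fine X) => -[|J].
    rewrite big_ord0 addr_ge0 ?wp// mulr_ge0//.
    by have := X0 0; rewrite big_ord0 -lee_fin fineK.
  rewrite big_ord_recl lerD//= /p ?expr0//.
  have := X0 J; rewrite -(fineK Xf) lee_fin -mulr_suml; rewrite ler_pdivrMr// mulrC.
  by under [X in (X <= _) -> _]eq_bigr do rewrite /p -add1n.
have xS J : \sum_(j < J) S (p j) <= (x + th * (m%:R * B)) / (1 - th).
  rewrite ler_pdivlMr ?subr_gt0//.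
  have rec : \sum_(j < J) S (p j) <= x + th * (m%:R * B + \sum_(j < J) S (p j)).
    apply: (@le_trans _ _ (\sum_(j < J) (w (p j) + th * S (K * p j)))).
      apply: ler_sum => j _; apply: le_trans (dilate_series_rec hw th0 th1 K1 (ltW (p0 j))) _.
      by rewrite lerD2r /trunc min_l.
    rewrite big_split /=; apply: lerD; first exact: xP.
    rewrite -mulr_sumr ler_wpM2l ?(ltW th0)//.
    have Kp j : K * p (m + j) = p j.
      by rewrite /p exprD mulrA -exprMn mulfV// expr1n mul1r.
    have S0p j : 0 <= S (K * p j) by rewrite S0// mulr_ge0 ?ltW.
    apply: (@le_trans _ _ (\sum_(j < m + J) S (K * p j))).
      by rewrite addnC big_split_ord /= lerDl sumr_ge0.
    rewrite big_split_ord /= lerD//.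
      rewrite -[m in leRHS]card_ord -sum1_card natr_sum mulr_suml; apply: ler_sum => j _.
      by rewrite mul1r SB// mulr_ge0 ?ltW.
    by apply: ler_sum => j _; rewrite Kp.
  lra.
apply: (@dyadic_integral_lt _ ((x + th * (m%:R * B)) / (1 - th) + 2)) => // J.
rewrite big_split /=; apply: lerD; first exact: xS.
have -> : \sum_(j < J) p j = 2 * (1 - p J).
  elim: J => [|J IH]; first by rewrite big_ord0 /p expr0 subrr mulr0.
  by rewrite big_ord_recr /= IH pS; field.
have := p0 J; lra.
Qed.

End Dyadic.

End Moduli.

(** * Cocycles with a dominated splitting *)

Section Cocycle.
Context {R : realType} {E : lmodType R} {X : Type} (L : set X) (f finv : X -> X).
Context (D : X -> E -> E) (it : nat -> X -> E -> E) (P : X -> E -> E).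
Context (nu : X -> E -> R) (Eu Es : X -> E -> Prop) (C lam Bd : R).
Hypotheses (finvK : cancel finv f) (Lf : forall x, L x -> L (f x))
  (Lfinv : forall x, L x -> L (finv x)).
Hypotheses (nu0 : forall x v, 0 <= nu x v)
  (nuD : forall x u v, nu x (u + v) <= nu x u + nu x v)
  (nuB : forall x u v, nu x (u - v) <= nu x u + nu x v).
Hypotheses (it0 : forall x v, it 0 x v = v)
  (itS : forall k x v, it k.+1 x v = it k (f x) (D x v))
  (itD : forall k x u v, it k x (u + v) = it k x u + it k x v).
Hypotheses (C0 : 0 < C) (lam0 : 0 < lam) (lam1 : lam < 1) (Bd0 : 0 <= Bd).
Hypotheses (stable : forall k x v, L x -> Es x v ->
    nu (iter k f x) (it k x v) <= C * lam ^+ k * nu x v)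
  (unstable : forall k x v, L x -> Eu x v ->
    nu x v <= C * lam ^+ k * nu (iter k f x) (it k x v))
  (bounded : forall x v, L x -> nu (f x) (D x v) <= Bd * nu x v).
Hypotheses (PEs : forall x v, L x -> Es x (P x v))
  (PEu : forall x v, L x -> Eu x (v - P x v))
  (PD : forall x u v, P x (u + v) = P x u + P x v)
  (PE : forall x v, L x -> P (f x) (D x v) = D x (P x v)).

Lemma it_bounded k x v : L x -> nu (iter k f x) (it k x v) <= Bd ^+ k * nu x v.
Proof.
elim: k x v => [|k IH] x v Lx; first by rewrite it0 mul1r.
rewrite iterSr itS exprSr -mulrA; apply: le_trans (IH _ _ (Lf Lx)) _.
by rewrite ler_wpM2l ?exprn_ge0// bounded.
Qed.

Lemma lam_small (a e : R) : 0 < e -> exists N, a * lam ^+ N < e.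
Proof.
move=> e0; have nlam : `|lam| < 1 by rewrite ger0_norm// ltW.
have /cvgrPdist_lt/(_ _ e0)[N _ /(_ N (leqnn N))] := cvg_geometric a nlam.
by rewrite /= sub0r normrN => /(le_lt_trans (ler_norm _)); exists N.
Qed.

(* For large [N] the map [it N] expands the unstable part of [v] by a factor 2
   and halves its stable part, so the unstable part is controlled by
   [it N x v], hence by [v]. *)
Lemma projection_bounded : exists2 Cp : R, 0 < Cp &
  forall x v, L x -> nu x (P x v) <= Cp * nu x v.
Proof.
have [N NP] := @lam_small C 2^-1 (ltac:(lra)).
exists (Bd ^+ N + 2); first by rewrite ltr_wpDl ?exprn_ge0.
move=> x v Lx; set s := P x v; set u := v - s.
have vE : v = u + s by rewrite subrK.
have l1 := le_trans (stable N Lx (PEs v Lx)) (ler_wpM2r (nu0 _ _) (ltW NP)).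
have l2 := le_trans (unstable N Lx (PEu v Lx)) (ler_wpM2r (nu0 _ _) (ltW NP)).
have l3 := it_bounded N v Lx.
have l4 : nu (iter N f x) (it N x u) <= nu (iter N f x) (it N x v) + nu (iter N f x) (it N x s).
  have -> : it N x u = it N x v - it N x s by rewrite vE itD addrK.
  exact: nuB.
have l5 : nu x s <= nu x v + nu x u.
  by have -> : s = v - u by rewrite vE addrAC subrr add0r.
rewrite -/s -/u in l1 l2; rewrite mulrDl.
have := nu0 x u; have := nu0 x s; have := nu0 x v; lra.
Qed.

Section Transport.
Context (w : R -> R) (hw : modulus_of_continuity w) (K : R) (K1 : 1 <= K).
Context (rho : X -> X -> R) (T : X -> X -> E -> E) (CT : R).
Hypotheses (rho0 : forall x y, 0 <= rho x y)
  (rhoK : forall x y, L x -> L y -> rho (finv x) (finv y) <= K * rho x y).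
Hypotheses (CT0 : 0 < CT)
  (Tb : forall x y v, L x -> L y -> nu x (T x y v) <= CT * nu y v)
  (Tstep : forall x y v, L x -> L y ->
    nu (f x) (T (f x) (f y) (D y v) - D x (T x y v)) <=
    CT * trunc w (K * rho (f x) (f y)) * nu y v)
  (Dsurj : forall x v, L x -> Eu x v -> exists2 v', Eu (finv x) v' & D (finv x) v' = v).

Let K0 : 0 < K. Proof. exact: lt_le_trans K1. Qed.

Lemma iter_finv k x : L x -> L (iter k finv x).
Proof. by move=> Lx; elim: k => //= k IH; exact: Lfinv. Qed.

Lemma iterK k x : iter k f (iter k finv x) = x.
Proof. by elim: k => // k IH; rewrite iterSr /= finvK. Qed.

Lemma rho_iter k x y : L x -> L y ->
  rho (iter k finv x) (iter k finv y) <= K ^+ k * rho x y.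
Proof.
move=> Lx Ly; elim: k => [|k IH] /=; first by rewrite mul1r.
apply: le_trans (rhoK (iter_finv k Lx) (iter_finv k Ly)) _.
by rewrite exprS -mulrA ler_wpM2l// ltW.
Qed.

(* Writing [x_k], [y_k], [v_k] for the backward orbits, the stable parts
   [s_k] of [T x_k y_k v_k] satisfy [s_k = D s_(k+1) + P e_k] with an error
   [e_k] bounded by the modulus of [D]; [it k] contracts [e_k] by [lam ^ k], and
   [v_k] is [lam ^ k] times smaller than [v], whence the ratio [lam ^ 2]. *)
Lemma transport_unstable : exists2 C' : R, 0 < C' & forall x y v W, L x -> L y ->
  Eu y v -> (forall N, dilate_sum w (lam ^+ 2) K (K * rho x y) N <= W) ->
  nu x (P x (T x y v)) <= C' * W * nu y v.
Proof.
have [Cp Cp0 CpP] := projection_bounded.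
pose A := C * C * Cp * CT; have A0 : 0 < A by rewrite !mulr_gt0.
have th0 k : 0 <= (lam ^+ 2) ^+ k by rewrite !exprn_ge0// ltW.
(* The telescoping stopped after [m] backward steps; the remainder is the stable part still to be
   pushed forward from time [m]. *)
have tele m x y v : L x -> L y -> Eu y v -> exists v', [/\ Eu (iter m finv y) v',
    it m (iter m finv y) v' = v &
    nu x (P x (T x y v)) <=
      A * dilate_sum w (lam ^+ 2) K (K * rho x y) m * nu y v +
      nu x (it m (iter m finv x) (P (iter m finv x) (T (iter m finv x) (iter m finv y) v')))].
  move=> Lx Ly Ev; elim: m => [|m [v' [Ev' v'E IH]]].
    by exists v; split; rewrite ?it0// /dilate_sum big_ord0 mulr0 mul0r add0r.
  have [Lxm Lym] := (iter_finv m Lx, iter_finv m Ly).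
  set xm := iter m finv x in IH Lxm *; set ym := iter m finv y in Ev' v'E IH Lym *.
  have [u Eu' uE] := Dsurj Lym Ev'.
  have uv : it m.+1 (finv ym) u = v by rewrite itS finvK uE.
  exists u; split => //=; rewrite -/xm -/ym; apply: le_trans IH _.
  have [Lx' Ly'] := (Lfinv Lxm, Lfinv Lym).
  set e := T xm ym v' - D (finv xm) (T (finv xm) (finv ym) u).
  have eb : nu xm e <= CT * trunc w (K * rho xm ym) * nu (finv ym) u.
    by have := Tstep u Lx' Ly'; rewrite !finvK uE.
  have -> : it m xm (P xm (T xm ym v')) =
      it m xm (P xm e) + it m.+1 (finv xm) (P (finv xm) (T (finv xm) (finv ym) u)).
    rewrite itS finvK -PE// finvK -itD -PD.
    by rewrite /e subrK.
  have xE : iter m f xm = x by exact: iterK.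
  have := nuD x (it m xm (P xm e)) (it m.+1 (finv xm) (P (finv xm) (T (finv xm) (finv ym) u))).
  suff : nu x (it m xm (P xm e)) <=
      A * ((lam ^+ 2) ^+ m * trunc w (K ^+ m * (K * rho x y))) * nu y v.
    by rewrite /dilate_sum big_ord_recr /= mulrDr mulrDl; lra.
  have h1 : nu x (it m xm (P xm e)) <= C * lam ^+ m * nu xm (P xm e).
    by rewrite -{1}xE; apply: stable => //; exact: PEs.
  have h2 := CpP xm e Lxm.
  have h3 : nu (finv ym) u <= C * lam ^+ m * nu y v.
    (* The expansion acts over [m.+1] steps; one factor [lam] is given up so that the power matches
       that of the stable contraction. *)
    have := unstable m.+1 Ly' Eu'; rewrite uv iterSr finvK iterK => /le_trans; apply.
    rewrite ler_wpM2r// ler_wpM2l ?(ltW C0)// exprS ler_piMl ?(ltW lam1)//.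
    by rewrite exprn_ge0// ltW.
  (* The extra factor [K] comes from [Tstep]: the maps [D] are compared at the preimages of [xm] and
     [ym], possibly farther apart by a factor [K]. *)
  have h4 : trunc w (K * rho xm ym) <= trunc w (K ^+ m * (K * rho x y)).
    apply: (trunc_nd hw); first by rewrite mulr_ge0// ltW.
    by rewrite mulrCA ler_wpM2l ?(ltW K0)// rho_iter.
  have t0 : 0 <= trunc w (K * rho xm ym) by apply: (trunc_ge0 hw); rewrite mulr_ge0// ltW.
  have Cl0 : 0 <= C * lam ^+ m by rewrite mulr_ge0 ?exprn_ge0// ltW.
  apply: le_trans h1 _.
  apply: (@le_trans _ _ (C * lam ^+ m * (Cp * (CT * trunc w (K ^+ m * (K * rho x y)) *
    (C * lam ^+ m * nu y v))))).
    rewrite ler_wpM2l//; apply: le_trans h2 _; rewrite ler_wpM2l ?(ltW Cp0)//.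
    apply: le_trans eb _; apply: ler_pM => //; first by rewrite mulr_ge0// ltW.
    by rewrite ler_wpM2l// ltW.
  by rewrite -exprM mulnC exprM expr2 /A le_eqVlt; apply/orP; left; apply/eqP; ring.
(* As [T] and [P] are bounded, the remainder is at most [A * nu y v * lam ^+ m], which tends to 0
   with [m]. *)
exists A => // x y v W Lx Ly Ev WP; apply/ler_addgt0Pr => eps eps0.
have [m mP] := lam_small (A * nu y v) eps0.
have [v' [Ev' v'E]] := tele m x y v Lx Ly Ev; move=> /le_trans; apply.
apply: lerD; first by rewrite ler_wpM2r// ler_wpM2l// ltW.
apply: le_trans _ (ltW mP).
have [Lxm Lym] := (iter_finv m Lx, iter_finv m Ly).
have h1 := stable m Lxm (PEs (T (iter m finv x) (iter m finv y) v') Lxm).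
rewrite iterK in h1; apply: le_trans h1 _.
have h2 := CpP _ (T (iter m finv x) (iter m finv y) v') Lxm.
have h3 := Tb v' Lxm Lym.
have h4 := unstable m Lym Ev'; rewrite v'E iterK in h4.
have lm0 : 0 <= lam ^+ m by rewrite exprn_ge0// ltW.
have lm1 : lam ^+ m <= 1 by rewrite exprn_ile1// ltW.
apply: (@le_trans _ _ (C * lam ^+ m * (Cp * (CT * (C * 1 * nu y v))))); last first.
  by rewrite /A le_eqVlt; apply/orP; left; apply/eqP; ring.
rewrite ler_wpM2l ?mulr_ge0 ?(ltW C0)//; apply: le_trans h2 _.
rewrite ler_wpM2l ?(ltW Cp0)//; apply: le_trans h3 _; rewrite ler_wpM2l ?(ltW CT0)//.
by apply: le_trans h4 _; rewrite ler_wpM2r// ler_wpM2l// ltW.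
Qed.

End Transport.
End Cocycle.

(** * Uniform constants on M *)

Section UniformConstants.
Context {R : realType} {n q : nat}.
Local Notation E := 'rV[R]_n.
Local Notation EG := ('rV[R]_n * 'M[R]_(q, n - q))%type.
Context (M : topologicalType) (hM : hausdorff_space M) (cM : compact [set: M]).
Context (S : charted M E) (hS : smooth_manifold S) (A : set (chart M E)).
Context (hA : smooth_atlas A) (hB : smooth_atlas (atlas S `|` A)).
Context (g : M -> E -> E -> R) (hg : riemannian_metric S g).
Context (gG : M * {vspace E} -> EG -> EG -> R)
  (hgG : riemannian_metric (grass_bundle S q) gG).
Local Notation dM := (rdist S g).
Local Notation dG := (rdist (grass_bundle S q) gG).
Let B := atlas S `|` A.
Let SB : atlas S `<=` B. Proof. by move=> e; left. Qed.
Let AB : A `<=` B. Proof. by move=> e; right. Qed.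

Lemma rdist_fin x y : (dM x y < +oo)%E -> exists2 t, 0 <= t & dM x y = t%:E.
Proof.
have := rdist_ge0 S g x y; case: (dM x y) => [t| |]//; rewrite lee_fin => t0 _.
by exists t.
Qed.

Lemma uniform_lipschitz (h : M -> M) : C1_map S h -> exists C r : R, [/\ 0 < C, 0 < r &
  forall x y, (dM x y < r%:E)%E -> (dM (h x) (h y) <= C%:E * dM x y)%E].
Proof.
move=> hh; apply: (uniform_near_diagonal cM).
  move=> C C' x y C0 CC' /le_trans; apply.
  by rewrite lee_wpmul2r ?lee_fin ?rdist_ge0.
move=> p; set e := chart_at S p.
have [C1 C10 [V nV VP]] := map_rdist_le hB SB hS hg hh p.
have [C2 [r [C20 r0 rP]]] := rdist_ge_chart hM hB SB hS hg (chart_at_B SB hS p)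
  (chart_at_dom hS p) nV.
exists (C1 * C2), r; split; rewrite ?mulr_gt0//; near=> x => y xyr.
have [Vy exy] : V y /\ (`|chart_map e x - chart_map e y|%:E <= C2%:E * dM x y)%E.
  by move: y xyr; near: x.
have Vx : V x by near: x.
apply: le_trans (VP x y Vx Vy) _.
have [t t0 tE] := rdist_fin (lt_trans xyr (ltry _)).
rewrite tE -!EFinM !lee_fin in exy *.
by rewrite -mulrA ler_pM2l.
Unshelve. all: by end_near. Qed.

(** A pointwise bound is a property of pairs that depends on [x] alone; the uniform bound is then
    read on the diagonal. *)
Lemma tangent_map_uniform (h : M -> M) : C1_map S h -> exists2 C : R, 0 < C &
  forall x v, rnorm g (h x) (tangent_map S h x v) <= C * rnorm g x v.
Proof.
move=> hh; have [||C [r [C0 r0 CP]]] := @uniform_near_diagonal _ _ _ cM S g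
    (fun C x y => forall v, rnorm g (h x) (tangent_map S h x v) <= C * rnorm g x v).
- move=> C C' x y C0 CC' CP v; apply: le_trans (CP v) _.
  by rewrite ler_wpM2r// sqrtr_ge0.
- move=> p; have [C C0 [V nV VP]] := tangent_map_bounded hB SB hS hg hh p.
  by exists C, 1; split => //; apply: filterS nV => x Vx y _ v; exact: VP.
exists C => // x v; apply: (CP x x); by rewrite rdist_xx lte_fin.
Qed.

Definition comparable_norms (C : R) (a : chart M E) x :=
  forall v, `|to_chart S a x v| <= C * rnorm g x v /\ rnorm g x v <= C * `|to_chart S a x v|.

(** The geometry that the dynamics uses at a pair of close points. The chart has to be in [A], where
    the modulus of df is given, although bundle distances are estimated in the charts of [S]. *)
Definition good_chart (C : R) (a : chart M E) x y :=
  [/\ A a, chart_dom a x /\ chart_dom a y, comparable_norms C a x, comparable_norms C a y &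
    forall V W, \dim V = q -> \dim W = q -> forall d, 0 <= d -> close_planes S a x y V W d ->
      (dG (x, V) (y, W) <= C%:E * (dM x y + d%:E))%E].

Lemma comparable_le C C' a x : C <= C' -> comparable_norms C a x -> comparable_norms C' a x.
Proof.
move=> CC' h v; have [h1 h2] := h v; split; [apply: le_trans h1 _|apply: le_trans h2 _];
  by rewrite ler_wpM2r// sqrtr_ge0.
Qed.

(** Closeness of planes in the chart [a] of [A] passes to the preferred chart [e] up to the change
    of the derivative of the transition map from [y] to [x], which is Lipschitz. This and the
    displacement of the base point account for the term [dM x y] next to [d]. *)
Lemma uniform_charts : (q <= n)%N -> exists C r : R, [/\ 0 < C, 0 < r &
  forall x y, (dM x y < r%:E)%E -> exists a, good_chart C a x y].
Proof.
move=> qn; apply: (uniform_near_diagonal cM).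
  move=> C C' x y C0 CC' [a [Aa axy cx cy aP]]; exists a.
  split; [exact: Aa|exact: axy|exact: (comparable_le CC' cx)|exact: (comparable_le CC' cy)|].
  move=> V W dV dW d d0 /(aP V W dV dW d d0) /le_trans; apply.
  by rewrite lee_wpmul2r ?lee_fin// adde_ge0 ?rdist_ge0.
move=> p; set e := chart_at S p; have Be : B e := chart_at_B SB hS p.
have ep : chart_dom e p := chart_at_dom hS p.
have [a Aa ap] : exists2 a, A a & chart_dom a p by case: hA => _ h _; exact: h.
have Ba : B a := AB Aa.
have [C1 C10 [U nU UP]] := grass_local qn hB SB hS hgG p.
have [C3 C30 [V3 nV3 L3]] := dtrans_lipschitz hB Ba Be ap ep.
have [C4 C40 N4] := dtrans_bounded hB Ba Be ap ep.
have [C5 C50 N5] := dtrans_bounded hB Be Ba ep ap.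
have [C6 C60 N6] := metric_chart hB SB hS hg Ba ap.
pose W0 : set M := [set x | [/\ U x, V3 x, forall u, `|dtrans a e x u| <= C4 * `|u|,
  forall u, `|dtrans e a x u| <= C5 * `|u| & chart_dom a x /\ comparable_norms C6 a x]].
have nW0 : \forall x \near p, W0 x.
  by near=> x; split; near: x; [exact: nU|exact: nV3|exact: N4|exact: N5|exact: N6].
have [C2 [r [C20 r0 rP]]] := rdist_ge_chart hM hB SB hS hg Be ep nW0.
have [C2' [r' [C20' r0' rP']]] := rdist_ge_chart hM hB SB hS hg Ba ap nW0.
pose Cf := C1 * (C2 + C5 * C3 * C2' + C5 * C4).
have Cf0 : 0 < Cf by rewrite /Cf mulr_gt0 ?addr_gt0 ?mulr_gt0.
exists (C6 + Cf), (Num.min r r'); split; rewrite ?addr_gt0 ?lt_min ?r0//.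
near=> x => y; have Wx : W0 x by near: x; exact: nW0.
have xP : forall y, (dM x y < r%:E)%E -> W0 y /\
    (`|chart_map e x - chart_map e y|%:E <= C2%:E * dM x y)%E by near: x; exact: rP.
have xP' : forall y, (dM x y < r'%:E)%E -> W0 y /\
    (`|chart_map a x - chart_map a y|%:E <= C2'%:E * dM x y)%E by near: x; exact: rP'.
rewrite EFin_min lt_min => /andP[xyr xyr'].
have [Wy exy] := xP y xyr; have [_ axy] := xP' y xyr'.
have [t t0 tE] := rdist_fin (lt_trans xyr (ltry _)).
rewrite tE -EFinM lee_fin in exy; rewrite tE -EFinM lee_fin in axy.
have [Ux V3x b4x b5x [ax cx]] := Wx; have [Uy V3y b4y b5y [ay cy]] := Wy.
have [ex UPx] := UP x y Ux Uy; have [ey _] := UP y x Uy Ux.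
have C6le : C6 <= C6 + Cf by rewrite lerDl ltW.
exists a.
split; [exact: Aa|exact: (conj ax ay)|exact: (comparable_le C6le cx)|exact: (comparable_le C6le cy)|].
move=> V W dV dW d d0 aVW; rewrite tE -EFinD -EFinM.
have d'0 : 0 <= C5 * (C3 * C2' * t + C4 * d).
  by rewrite !(mulr_ge0, addr_ge0)// ltW.
have [_ /(_ _ d'0)] := UPx V W dV dW.
(* The bare inequality behind [eVW]: [n1] is the change of the transition derivative between the two
   points, [n2] the image of the defect measured in [a]. *)
have chain (n0 n1 n2 aU aW aUV ca : R) : n1 <= C3 * ca * aU -> n2 <= C4 * aUV ->
    aU <= C5 * aW -> aUV <= d * aU -> ca <= C2' * t -> n0 <= n1 + n2 -> 0 <= aU ->
    n0 <= C5 * (C3 * C2' * t + C4 * d) * aW.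
  move=> l1 l2 l3 l4 l5 l6 nU0; apply: (le_trans l6).
  apply: (@le_trans _ _ ((C3 * C2' * t + C4 * d) * aU)); last first.
    by rewrite [C5 * _]mulrC -[leRHS]mulrA ler_wpM2l// addr_ge0 ?mulr_ge0// ltW.
  rewrite mulrDl lerD//.
    by apply: (le_trans l1); rewrite ler_wpM2r// -mulrA ler_pM2l.
  by apply: (le_trans l2); rewrite -mulrA ler_pM2l.
have eVW : close_planes S e x y V W (C5 * (C3 * C2' * t + C4 * d)).
  move=> u /aVW[v vV uv]; exists v; first exact: vV.
  have ux : to_chart S e x v = dtrans a e x (to_chart S a x v).
    by rewrite (to_chart_trans hB SB hS).
  have uy : to_chart S e y u = dtrans a e y (to_chart S a y u).
    by rewrite (to_chart_trans hB SB hS).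
  have uy' : to_chart S a y u = dtrans e a y (to_chart S e y u).
    by rewrite (to_chart_trans hB SB hS).
  have k1 := L3 x y (to_chart S a y u) V3x V3y.
  have k2 := b4x (to_chart S a y u - to_chart S a x v).
  have k3 := b5y (to_chart S e y u); rewrite -uy' in k3.
  have dB : dtrans a e x (to_chart S a y u - to_chart S a x v) =
      dtrans a e x (to_chart S a y u) - to_chart S e x v by rewrite ux /dtrans linearB.
  rewrite distrC -uy in k1; rewrite dB in k2.
  by apply: chain k1 k2 k3 uv axy _ _; [exact: ler_distD|exact: normr_ge0].
move=> /(_ eVW) /le_trans; apply; rewrite lee_fin.
apply: (@le_trans _ _ (Cf * (t + d))); last by rewrite ler_wpM2r ?addr_ge0// lerDr ltW.
rewrite /Cf -[leRHS]mulrA ler_pM2l// -/e.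
have p1 : 0 <= C2 * d by rewrite mulr_ge0// ltW.
have p2 : 0 <= C5 * C3 * C2' * d by rewrite !mulr_ge0// ltW.
have p3 : 0 <= C5 * C4 * t by rewrite !mulr_ge0// ltW.
lra.
Unshelve. all: by end_near. Qed.

End UniformConstants.

(** * The unstable distribution *)

Lemma le_mul_trans (R : realType) (c d x y z : R) : 0 <= c -> x <= c * y -> y <= d * z ->
  x <= c * d * z.
Proof. by move=> c0 /le_trans xy yz; apply: xy; rewrite -mulrA ler_wpM2l. Qed.

Section ChartLinear.
Context {R : realType} {E : normedModType R} {X : Type} (S : charted X E).

Lemma to_chartD e x u v : to_chart S e x (u + v) = to_chart S e x u + to_chart S e x v.
Proof. exact: linearD. Qed.

Lemma to_chartB e x u v : to_chart S e x (u - v) = to_chart S e x u - to_chart S e x v.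
Proof. exact: linearB. Qed.

Lemma to_chart0 e x : to_chart S e x 0 = 0.
Proof. exact: linear0. Qed.

Lemma tangent_mapD f x u v :
  tangent_map S f x (u + v) = tangent_map S f x u + tangent_map S f x v.
Proof. exact: linearD. Qed.

End ChartLinear.

Section Splitting.
Context {K : fieldType} {V : vectType K} (U W : {vspace V}).
Hypotheses (UW : (U + W)%VS = fullv) (UW0 : (U :&: W)%VS = 0%VS).

Lemma daddv_pi_sub v : v - daddv_pi U W v \in W.
Proof.
have {1}<- : daddv_pi U W v + daddv_pi W U v = v.
  by apply: daddv_pi_add; rewrite ?UW0 ?UW ?memvf.
by rewrite addrAC subrr add0r memv_pi.
Qed.

Lemma daddv_pi_eq u w : u \in U -> w \in W -> daddv_pi U W (u + w) = u.
Proof.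
move=> uU wW; have h : daddv_pi U W (u + w) - u \in (U :&: W)%VS.
  rewrite memv_cap rpredB ?memv_pi//=.
  have -> : daddv_pi U W (u + w) - u = w - ((u + w) - daddv_pi U W (u + w)).
    by rewrite opprB addrCA opprD [- u - w]addrC [w + _]addrA subrr add0r.
  by rewrite rpredB// daddv_pi_sub.
by apply/eqP; rewrite -subr_eq0 -memv0 -UW0.
Qed.

End Splitting.

Section Hyperbolic.
Context {R : realType} {n q : nat}.
Local Notation E := 'rV[R]_n.
Local Notation EG := ('rV[R]_n * 'M[R]_(q, n - q))%type.
Context (M : topologicalType) (S : charted M E) (hS : smooth_manifold S).
Context (A : set (chart M E)) (hB : smooth_atlas (atlas S `|` A)).
Context (g : M -> E -> E -> R) (gG : M * {vspace E} -> EG -> EG -> R).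
Context (w : R -> R) (hw : modulus_of_continuity w) (Dw : Dini_summable w).
Context (f finv : M -> M) (hf : C1_diffeomorphism S f finv).
Context (L : set M) (Eu Es : M -> {vspace E}) (hL : hyperbolic_set S g f finv L Eu Es).
Context (hq : forall x, L x -> \dim (Eu x) = q).
Local Notation dM := (rdist S g).
Local Notation dG := (rdist (grass_bundle S q) gG).
Let B := atlas S `|` A.
Let SB : atlas S `<=` B. Proof. by move=> e; left. Qed.
Let AB : A `<=` B. Proof. by move=> e; right. Qed.

Context (C r0 Bd Cw : R) (m : nat) (a : M -> M -> chart M E).
Hypotheses (C0 : 0 < C) (r00 : 0 < r0) (r01 : r0 <= 1) (Bd0 : 0 < Bd) (Cw0 : 0 < Cw).
Hypothesis (aP : forall x y, (dM x y < r0%:E)%E -> good_chart S A g gG C (a x y) x y).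
Let K : R := 2 ^+ m.
Hypothesis (KP : forall x y, (dM x y < r0%:E)%E -> (dM (finv x) (finv y) <= K%:E * dM x y)%E).
Hypothesis (BdP : forall x v, rnorm g (f x) (tangent_map S f x v) <= Bd * rnorm g x v).
Hypothesis (CwP : forall e e', A e -> A e' -> forall x y,
  chart_dom e x -> chart_dom e y -> chart_dom e' (f x) -> chart_dom e' (f y) -> forall v : E,
  (`|dcharts e e' f x v - dcharts e e' f y v|%:E <=
    Cw%:E * modulus_at w (dM x y) * `|v|%:E)%E).

Let K1 : 1 <= K. Proof. by rewrite exprn_ege1// ler1n. Qed.
Let K0 : 0 < K. Proof. exact: lt_le_trans K1. Qed.
Let C1 : 0 <= C. Proof. exact: ltW. Qed.
Let df x : diff_at S f x. Proof. by case: hf => _ _ h _; exact: (C1_map_diff_at hB SB hS x h). Qed.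
Let dfinv x : diff_at S finv x. Proof. by case: hf => _ _ _ h; exact: (C1_map_diff_at hB SB hS x h). Qed.
Let fK : cancel f finv. Proof. by case: hf. Qed.
Let finvK : cancel finv f. Proof. by case: hf. Qed.
Let Lf x : L x -> L (f x). Proof. by move=> Lx; case: hL => _ <- *; exists x. Qed.
Let Lfinv x : L x -> L (finv x).
Proof. by case: hL => _ fL _ _ _; rewrite -{1}fL => -[z Lz <-]; rewrite fK. Qed.

Let ch x := a x x.
Let chP x : [/\ A (ch x), chart_dom (ch x) x & comparable_norms S g C (ch x) x].
Proof.
have xx : (dM x x < r0%:E)%E by rewrite rdist_xx lte_fin.
by have [h1 [h2 _] h3 _ _] := aP xx; split; [exact: h1|exact: h2|exact: h3].
Qed.

(** Comparable with [rnorm] and used in its place, because the triangle inequality is immediate for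
    it, whereas for [rnorm] it would go through the Cauchy-Schwarz inequality. *)
Definition chart_norm x (v : E) : R := `|to_chart S (ch x) x v|.
Local Notation nu := chart_norm.

Lemma chart_norm_le x v : nu x v <= C * rnorm g x v.
Proof. by have [_ _ h] := chP x; have [h1 _] := h v; exact: h1. Qed.

Lemma rnorm_le_chart x v : rnorm g x v <= C * nu x v.
Proof. by have [_ _ h] := chP x; have [_ h1] := h v; exact: h1. Qed.

Lemma chart_norm_trans b x v : comparable_norms S g C b x ->
  nu x v <= C * C * `|to_chart S b x v| /\ `|to_chart S b x v| <= C * C * nu x v.
Proof.
move=> h; have [h1 h2] := h v; split.
  exact: (le_mul_trans C1 (chart_norm_le x v) h2).
exact: (le_mul_trans C1 h1 (rnorm_le_chart x v)).
Qed.

Lemma chart_normD x u v : nu x (u + v) <= nu x u + nu x v.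
Proof. by rewrite /chart_norm to_chartD; exact: ler_normD. Qed.

Lemma chart_normB x u v : nu x (u - v) <= nu x u + nu x v.
Proof. by rewrite /chart_norm to_chartB; exact: ler_normB. Qed.

(** The distance cut off at [r0]: it is real-valued even between components, and the Lipschitz bound
    for [finv] holds for all pairs, so backward orbits may separate beyond [r0]. *)
Definition rho x y : R := if (dM x y < r0%:E)%E then fine (dM x y) else r0.

Lemma rho_close x y : (dM x y < r0%:E)%E -> dM x y = (rho x y)%:E.
Proof.
move=> xy; have [t t0 tE] := rdist_fin (lt_trans xy (ltry _)).
by rewrite /rho xy tE.
Qed.

Lemma rho_far x y : ~~ (dM x y < r0%:E)%E -> rho x y = r0.
Proof. by rewrite /rho => /negbTE->. Qed.

Lemma rho_ge0 x y : 0 <= rho x y.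
Proof.
have [xy|xy] := boolP (dM x y < r0%:E)%E; last by rewrite rho_far// ltW.
by rewrite -lee_fin -rho_close// rdist_ge0.
Qed.

Lemma rho_le x y t : (dM x y <= t%:E)%E -> rho x y <= t.
Proof.
move=> xt; have [xy|xy] := boolP (dM x y < r0%:E)%E.
  by rewrite -lee_fin -rho_close.
by rewrite rho_far// -lee_fin; move: xy; rewrite -leNgt => /le_trans; exact.
Qed.

Lemma rho_ler0 x y : rho x y <= r0.
Proof.
have [xy|xy] := boolP (dM x y < r0%:E)%E; last by rewrite rho_far.
by rewrite -lee_fin -rho_close// ltW.
Qed.

Lemma rho_finv x y : rho (finv x) (finv y) <= K * rho x y.
Proof.
have [xy|xy] := boolP (dM x y < r0%:E)%E.
  by apply: rho_le; rewrite EFinM -rho_close// KP.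
by rewrite (rho_far xy) (le_trans (rho_ler0 _ _))// ler_peMl// ltW.
Qed.

(* Far points are transported by 0: there [trunc w (K * rho _ _)] is bounded below,
   so [transport_step] holds for them as well. *)
Definition chart_transport x y (v : E) : E :=
  if (dM x y < r0%:E)%E then of_chart S (a x y) x (to_chart S (a x y) y v) else 0.
Local Notation T := chart_transport.

Lemma to_chart_transport x y v : (dM x y < r0%:E)%E ->
  to_chart S (a x y) x (T x y v) = to_chart S (a x y) y v.
Proof.
move=> xy; have [Aa [ax _] _ _ _] := aP xy; rewrite /T xy.
exact: (to_chartK hB SB hS _ (AB Aa) ax).
Qed.

Let C4 : R := C * C * (C * C).
Let C40 : 0 < C4. Proof. by rewrite !mulr_gt0. Qed.

Lemma transport_bounded x y v : nu x (T x y v) <= C4 * nu y v.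
Proof.
have [xy|xy] := boolP (dM x y < r0%:E)%E; last first.
  by rewrite /T (negbTE xy) /chart_norm to_chart0 normr0; apply: mulr_ge0; [exact: ltW|exact: normr_ge0].
have [_ _ cx cy _] := aP xy.
have [h1 _] := chart_norm_trans (T x y v) cx.
have [_ h2] := chart_norm_trans v cy.
rewrite (to_chart_transport v xy) in h1.
exact: (le_mul_trans (mulr_ge0 C1 C1) h1 h2).
Qed.

Lemma tangent_bounded x v : nu (f x) (tangent_map S f x v) <= C * Bd * C * nu x v.
Proof.
apply: (le_mul_trans (mulr_ge0 C1 (ltW Bd0)) _ (rnorm_le_chart x v)).
exact: (le_mul_trans C1 (chart_norm_le _ _) (BdP x v)).
Qed.

(** For close pairs the defect, read in the charts of the pairs [x, y] and [f x, f y], is the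
    difference of the differentials of [f] at the two points in these charts, to which the modulus
    applies. If either pair is far, then [r0 <= K * rho (f x) (f y)] and the positive number [w r0]
    absorbs both terms. *)
Lemma transport_step : exists2 CT : R, C4 <= CT & forall x y v,
  nu (f x) (T (f x) (f y) (tangent_map S f y v) - tangent_map S f x (T x y v)) <=
  CT * trunc w (K * rho (f x) (f y)) * nu y v.
Proof.
have w0 : 0 < w r0 by have [w0 _ _ wi _] := hw; rewrite -w0; exact: wi.
(* [D1] serves close pairs and [D2] bounds the two terms separately for far ones; [C4] is added so
   that the same [CT] also bounds the transport. *)
pose D1 := C4 * Cw; pose D2 := C4 * (C * Bd * C) + C * Bd * C * C4.
have D10 : 0 <= D1 by rewrite mulr_ge0 ?ltW.
have D20 : 0 <= D2 by rewrite !(addr_ge0, mulr_ge0)// ltW.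
have D30 : 0 <= D2 / w r0 by rewrite divr_ge0// ltW.
exists (C4 + D1 + D2 / w r0); first by rewrite -addrA lerDl addr_ge0.
move=> x y v; set tr := trunc w _.
have Kr0 : 0 <= K * rho (f x) (f y) by rewrite mulr_ge0 ?rho_ge0// ltW.
have tr0 : 0 <= tr by exact: trunc_ge0 hw _ Kr0.
have nv0 : 0 <= nu y v by exact: normr_ge0.
have rK : rho x y <= K * rho (f x) (f y) by have := rho_finv (f x) (f y); rewrite !fK.
have far : r0 <= K * rho (f x) (f y) ->
    nu (f x) (T (f x) (f y) (tangent_map S f y v) - tangent_map S f x (T x y v)) <=
    (C4 + D1 + D2 / w r0) * tr * nu y v.
  move=> rr; apply: le_trans (chart_normB _ _ _) _.
  have CBC0 : 0 <= C * Bd * C by rewrite !mulr_ge0// ltW.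
  have l1 := le_mul_trans (ltW C40) (transport_bounded (f x) (f y) (tangent_map S f y v))
    (tangent_bounded y v).
  have l2 := le_mul_trans CBC0 (tangent_bounded x (T x y v)) (transport_bounded x y v).
  have wtr : w r0 <= tr.
    have -> : w r0 = trunc w r0 by rewrite /trunc min_l.
    by apply: (trunc_nd hw) => //; exact: ltW.
  apply: le_trans (lerD l1 l2) _; rewrite -mulrDl; apply: ler_wpM2r => //.
  apply: (@le_trans _ _ (D2 / w r0 * tr)); last by rewrite ler_wpM2r// lerDr addr_ge0// ltW.
  by rewrite -/D2 mulrAC ler_pdivlMr// ler_wpM2l.
have [fxy|fxy] := boolP (dM (f x) (f y) < r0%:E)%E; last first.
  by apply: far; rewrite (rho_far fxy) ler_peMl// ltW.
have [xy|xy] := boolP (dM x y < r0%:E)%E; last first.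
  by apply: far; rewrite -(rho_far xy).
set b := a (f x) (f y); set e := a x y.
have [Ab [bx by_] cbx _ _] := aP fxy; have [Ae [ex ey] cex cey _] := aP xy.
have [h1 _] := chart_norm_trans (T (f x) (f y) (tangent_map S f y v) - tangent_map S f x (T x y v)) cbx.
have [_ h2] := chart_norm_trans v cey.
have [_ dy] := diff_at_charts hB SB hS (df y) (AB Ae) (AB Ab) ey by_.
have [_ dx] := diff_at_charts hB SB hS (df x) (AB Ae) (AB Ab) ex bx.
rewrite to_chartB (to_chart_transport _ fxy) dy dx (to_chart_transport _ xy) in h1.
have := CwP Ae Ab ex ey bx by_ (to_chart S e y v).
rewrite (rho_close xy) /= -!EFinM lee_fin distrC => h3.
have wtr : w (rho x y) <= tr.
  have -> : w (rho x y) = trunc w (rho x y).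
    by rewrite /trunc min_l// (le_trans (rho_ler0 x y)).
  by apply: (trunc_nd hw) => //; exact: rho_ge0.
have w0' : 0 <= w (rho x y) by have [_ wp _ _ _] := hw; apply: wp; exact: rho_ge0.
have h4 := le_mul_trans (mulr_ge0 (mulr_ge0 C1 C1) (mulr_ge0 (ltW Cw0) w0'))
  (le_mul_trans (mulr_ge0 C1 C1) h1 h3) h2.
apply: (le_trans h4); apply: ler_wpM2r => //.
apply: (@le_trans _ _ (D1 * tr)).
  have -> : C * C * (Cw * w (rho x y)) * (C * C) = D1 * w (rho x y) by rewrite /D1 /C4; ring.
  by rewrite ler_wpM2l.
by rewrite ler_wpM2r// addrAC lerDr addr_ge0// ltW.
Qed.

Lemma tangent_unstable x v : L x -> v \in Eu x -> tangent_map S f x v \in Eu (f x).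
Proof.
move=> Lx vE; case: hL => _ _ _ /(_ x Lx)[<- _] _.
by apply/memv_imgP; exists v; rewrite ?lfunE.
Qed.

Lemma tangent_stable x v : L x -> v \in Es x -> tangent_map S f x v \in Es (f x).
Proof.
move=> Lx vE; case: hL => _ _ _ /(_ x Lx)[_ <-] _.
by apply/memv_imgP; exists v; rewrite ?lfunE.
Qed.

Lemma tangent_unstable_surj x v : L x -> v \in Eu x ->
  exists2 v', v' \in Eu (finv x) & tangent_map S f (finv x) v' = v.
Proof.
move=> Lx; case: hL => _ _ _ /(_ _ (Lfinv Lx))[h _] _; rewrite finvK in h.
by rewrite -h => /memv_imgP[v' v'E ->]; exists v'; rewrite ?lfunE.
Qed.

Definition stable_proj x (v : E) : E := daddv_pi (Es x) (Eu x) v.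

Lemma unstable_transport : exists2 w' : R -> R,
  [/\ modulus_of_continuity w', Dini_summable w' & forall t, 0 <= t -> t <= w' t] &
  exists2 C' : R, 0 < C' & forall x y v, L x -> L y -> v \in Eu y ->
    nu x (stable_proj x (T x y v)) <= C' * w' (rho x y) * nu y v.
Proof.
have [_ _ spl _ [Ch [lam [Ch0 lam0 lam1 hyp]]]] := hL.
have th0 : 0 < lam ^+ 2 by rewrite exprn_gt0.
have th1 : lam ^+ 2 < 1 by rewrite exprn_ilt1// ltW.
have [w' [mw' Dw'] [tw' sw']] := dilate_modulus m hw Dw th0 th1.
exists w' => //.
have [CT CT4 CTP] := transport_step.
have CT0 : 0 < CT := lt_le_trans C40 CT4.
have spl' x : L x -> (Es x + Eu x)%VS = fullv /\ (Es x :&: Eu x)%VS = 0%VS.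
  by move=> /spl; rewrite addvC capvC.
have CC0 : 0 <= C * (Ch * C) by rewrite !mulr_ge0 ?(ltW Ch0).
have iterfK k : cancel (iter k f) (iter k finv).
  by elim: k => // k IH x; rewrite iterSr /= fK IH.
have cst k x y u v : L x -> rnorm g x u <= Ch * lam ^+ k * rnorm g y v ->
    nu x u <= C * Ch * C * lam ^+ k * nu y v.
  move=> _ h; have l0 : 0 <= Ch * lam ^+ k by rewrite mulr_ge0 ?exprn_ge0// ltW.
  have := le_mul_trans (mulr_ge0 C1 l0) (le_mul_trans C1 (chart_norm_le x u) h)
    (rnorm_le_chart y v).
  by have -> : C * (Ch * lam ^+ k) * C = C * Ch * C * lam ^+ k by ring.
have CK0 : 0 < C * Ch * C by rewrite !mulr_gt0.
have Liter k x : L x -> L (iter k f x) by move=> Lx; elim: k => //= k; exact: Lf.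
have stab k x v : L x -> v \in Es x ->
    nu (iter k f x) (tangent_map S (iter k f) x v) <= C * Ch * C * lam ^+ k * nu x v.
  by move=> Lx vE; apply: cst; [exact: Liter|have [h _] := hyp x Lx k v; exact: h].
have itu k x v : L x -> v \in Eu x -> tangent_map S (iter k f) x v \in Eu (iter k f x).
  elim: k x v => [|k IH] x v Lx vE; first by rewrite (diff_at_id hB SB hS x).2.
  by rewrite (tangent_iterSr hB SB hS k x v df) iterSr; apply: IH; [exact: Lf|exact: tangent_unstable].
(* Contraction on the unstable bundle is stated for [finv]: it is applied at [iter k f x] to the
   image of [v], where the two tangent maps cancel. *)
have unst k x v : L x -> v \in Eu x ->
    nu x v <= C * Ch * C * lam ^+ k * nu (iter k f x) (tangent_map S (iter k f) x v).
  move=> Lx vE; apply: cst => //.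
  have [_ h] := hyp _ (Liter k x Lx) k (tangent_map S (iter k f) x v).
  have := h (itu k x v Lx vE); rewrite iterfK (tangent_mapK hB SB hS _ (iterfK k))//.
    exact: (diff_at_iter hB SB hS k _ df).
  exact: (diff_at_iter hB SB hS k _ dfinv).
have PEs x v : L x -> stable_proj x v \in Es x by move=> _; exact: memv_pi.
have PEu x v : L x -> v - stable_proj x v \in Eu x.
  by move=> /spl'[h1 h2]; exact: daddv_pi_sub.
have PD x u v : stable_proj x (u + v) = stable_proj x u + stable_proj x v by exact: linearD.
have PE x v : L x -> stable_proj (f x) (tangent_map S f x v) = tangent_map S f x (stable_proj x v).
  move=> Lx; rewrite -{1}[v](subrK (stable_proj x v)) addrC tangent_mapD.
  have [h1 h2] := spl' _ (Lf Lx); apply: daddv_pi_eq => //.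
    by apply: tangent_stable => //; exact: PEs.
  by apply: tangent_unstable => //; exact: PEu.
have rK x y : L x -> L y -> rho (finv x) (finv y) <= K * rho x y.
  by move=> _ _; exact: rho_finv.
have Tb x y v : L x -> L y -> nu x (T x y v) <= CT * nu y v.
  move=> _ _; apply: le_trans (transport_bounded x y v) _.
  by apply: ler_wpM2r => //; exact: normr_ge0.
have Ts x y v : L x -> L y ->
  nu (f x) (T (f x) (f y) (tangent_map S f y v) - tangent_map S f x (T x y v)) <=
  CT * trunc w (K * rho (f x) (f y)) * nu y v by move=> _ _; exact: CTP.
have nu0 x v : 0 <= nu x v by exact: normr_ge0.
have it0 x v : tangent_map S (iter 0 f) x v = v by exact: (diff_at_id hB SB hS x).2.
have itS k x v : tangent_map S (iter k.+1 f) x v =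
    tangent_map S (iter k f) (f x) (tangent_map S f x v).
  exact: (tangent_iterSr hB SB hS k x v df).
have itD k x u v : tangent_map S (iter k f) x (u + v) =
  tangent_map S (iter k f) x u + tangent_map S (iter k f) x v by exact: tangent_mapD.
have CB0 : 0 <= C * Bd * C by rewrite !mulr_ge0// ltW.
have tb x v : L x -> nu (f x) (tangent_map S f x v) <= C * Bd * C * nu x v.
  by move=> _; exact: tangent_bounded.
have [C' C'0 C'P] := transport_unstable (Eu := fun x v => v \in Eu x)
  (Es := fun x v => v \in Es x) (it := fun k => tangent_map S (iter k f))
  finvK Lf Lfinv nu0 chart_normD chart_normB it0 itS itD CK0 lam0 lam1 CB0
  stab unst tb PEs PEu PD PE hw K1 rho_ge0 rK CT0 Tb Ts tangent_unstable_surj.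
(* The cocycle estimate gives [w' (K * rho x y)]; concavity and [w' 0 = 0] bound it by
   [K * w' (rho x y)]. *)
exists (C' * K); first exact: mulr_gt0.
move=> x y v Lx Ly vE.
have Kr0 : 0 <= K * rho x y by rewrite mulr_ge0 ?rho_ge0// ltW.
have h := C'P x y v (w' (K * rho x y)) Lx Ly vE (fun N => sw' _ N Kr0).
apply: (le_trans h); apply: ler_wpM2r => //; rewrite -mulrA ler_wpM2l ?(ltW C'0)//.
have [w'0 _ _ _ cc] := mw'.
have := concave_scale (a := K^-1) cc _ Kr0; rewrite w'0 mulKf ?gt_eqF// => /(_ (lexx _)).
rewrite -ler_pdivrMl//; apply; first by rewrite invr_ge0 ltW.
by rewrite invf_le1.
Qed.

Lemma unstable_close : exists2 w' : R -> R,
  [/\ modulus_of_continuity w', Dini_summable w' & forall t, 0 <= t -> t <= w' t] &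
  exists2 C' : R, 0 < C' & forall x y, L x -> L y -> (dM x y < r0%:E)%E ->
    (dG (x, Eu x) (y, Eu y) <= C'%:E * modulus_at w' (dM x y))%E.
Proof.
have [w' [mw' Dw' tw'] [C' C'0 C'P]] := unstable_transport; exists w' => //.
have [_ _ spl _ _] := hL.
exists (C * (1 + C * C * C' * (C * C))); first by rewrite mulr_gt0// addr_gt0// !mulr_gt0.
move=> x y Lx Ly xy; have [Aa [ax ay] cx cy gr] := aP xy.
have rh := rho_ge0 x y; set t := rho x y in rh *.
have wt0 : 0 <= w' t by apply: le_trans (tw' _ rh).
pose d := C * C * C' * (C * C) * w' t.
have d0 : 0 <= d by rewrite !mulr_ge0// ltW.
have [spl1 spl2] : (Es x + Eu x)%VS = fullv /\ (Es x :&: Eu x)%VS = 0%VS.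
  by have [] := spl x Lx; rewrite addvC capvC.
have cl : close_planes S (a x y) x y (Eu x) (Eu y) d.
  (* Removing the stable part of the transported vector leaves a vector of [Eu x], and the stable
     part is the error. *)
  move=> v vE; exists (T x y v - stable_proj x (T x y v)); first exact: daddv_pi_sub.
  rewrite to_chartB (to_chart_transport v xy) opprB addrC subrK.
  have [_ h1] := chart_norm_trans (stable_proj x (T x y v)) cx.
  have [h2 _] := chart_norm_trans v cy.
  have CC := mulr_ge0 C1 C1.
  have h3 := le_mul_trans CC h1 (C'P x y v Lx Ly vE).
  have := le_mul_trans (mulr_ge0 CC (mulr_ge0 (ltW C'0) wt0)) h3 h2.
  suff -> : C * C * (C' * w' t) * (C * C) = d by [].
  by rewrite /d; ring.
apply: le_trans (gr _ _ (hq Lx) (hq Ly) d d0 cl) _.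
(* The displacement of the base point is absorbed by [t <= w' t]. *)
rewrite (rho_close xy) -/t /= -!EFinM lee_fin -[leRHS]mulrA ler_wpM2l// mulrDl mul1r lerD2r.
exact: tw'.
Qed.

End Hyperbolic.

Theorem theorem1p2 (R : realType) (n q : nat)
    (M : topologicalType) (S : charted M 'rV[R]_n)
    (g : M -> 'rV[R]_n -> 'rV[R]_n -> R)
    (gG : M * {vspace 'rV[R]_n} ->
          'rV[R]_n * 'M[R]_(q, n - q) -> 'rV[R]_n * 'M[R]_(q, n - q) -> R)
    (w : R -> R) (f finv : M -> M) (L : set M)
    (Eu Es : M -> {vspace 'rV[R]_n}) :
  compact [set: M] -> hausdorff_space M ->
  smooth_manifold S -> riemannian_metric S g ->
  riemannian_metric (grass_bundle S q) gG ->
  modulus_of_continuity w -> Dini_summable w ->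
  C1_diffeomorphism S f finv -> C1_modulus S g w f ->
  compact L -> hyperbolic_set S g f finv L Eu Es ->
  (forall x, L x -> \dim (Eu x) = q) ->
  exists w' : R -> R,
    [/\ modulus_of_continuity w', Dini_summable w' &
    exists2 C : R, 0 < C &
      forall x y, L x -> L y ->
        (rdist (grass_bundle S q) gG (x, Eu x) (y, Eu y)
         <= C%:E * modulus_at w' (rdist S g x y))%E].
Proof.
move=> cM hM hS hg hgG hw Dw hf [A [finA hA hB [Cw Cw0 CwP]]] cL hL hq.
(* A point of [L] gives [q <= n], on which the charts of the bundle depend; for empty [L] the
   conclusion is vacuous. *)
have [[x0 Lx0]|noL] := pselect (exists x, L x); last first.
  exists w; split => //; exists 1 => // x y Lx; case: noL; by exists x.
have qn : (q <= n)%N.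
  have := dimvS (subvf (Eu x0)); rewrite (hq _ Lx0) dimvf.
  by rewrite /dim /= mul1n.
have SB : atlas S `<=` atlas S `|` A by move=> e; left.
have [_ _ C1f C1finv] := hf.
have [C [r1 [C0 r10 CP]]] := uniform_charts hM cM hS hA hB hg hgG qn.
have [KL [r2 [KL0 r20 KLP]]] := uniform_lipschitz hM cM hS hB hg C1finv.
have [Bd Bd0 BdP] := tangent_map_uniform cM hS hB hg C1f.
(* The Lipschitz constant is rounded up to a power of 2, so that dilation by it is a shift of dyadic
   scales. *)
have [m mP] : exists m, KL <= 2 ^+ m.
  exists (Num.truncn KL).+1; apply: le_trans (ltW (truncnS_gt KL)) _.
  by rewrite -natrX ler_nat ltnW// ltn_expl.
pose r0 : R := Num.min 1 (Num.min r1 r2).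
have r00 : 0 < r0 by rewrite !lt_min ltr01 r10.
have r01 : r0 <= 1 by rewrite ge_min lexx.
have r0r1 : r0 <= r1 by rewrite !ge_min lexx orbT.
have r0r2 : r0 <= r2 by rewrite !ge_min lexx !orbT.
have ex (xy : M * M) : exists a, (rdist S g xy.1 xy.2 < r0%:E)%E ->
    good_chart S A g gG C a xy.1 xy.2.
  have [h|h] := pselect (rdist S g xy.1 xy.2 < r0%:E)%E; last by exists (chart_at S x0).
  have [|a aP] := CP xy.1 xy.2; last by exists a.
  by apply: lt_le_trans h _; rewrite lee_fin.
have [a aP] := choice ex.
have aP' x y : (rdist S g x y < r0%:E)%E -> good_chart S A g gG C (a (x, y)) x y.
  exact: (aP (x, y)).
have KP x y : (rdist S g x y < r0%:E)%E ->
    (rdist S g (finv x) (finv y) <= (2 ^+ m)%:E * rdist S g x y)%E.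
  move=> xy; have xy2 : (rdist S g x y < r2%:E)%E by apply: lt_le_trans xy _; rewrite lee_fin.
  by apply: le_trans (KLP _ _ xy2) _; rewrite lee_wpmul2r ?lee_fin ?rdist_ge0.
have [w' [mw' Dw' tw'] [C' C'0 C'P]] := unstable_close hS hB hw Dw hf hL hq C0 r00 r01
  Bd0 Cw0 aP' KP BdP CwP.
have [D D0 DP] := grass_far qn hB SB hS hgG cM g.
exists w'; split => //; exists (C' + D / r0); first by rewrite addr_gt0 ?divr_gt0.
move=> x y Lx Ly; have [_ w'0 _ _ _] := mw'.
have C'le : C' <= C' + D / r0 by rewrite lerDl divr_ge0 ?ltW.
have Dle : D / r0 <= C' + D / r0 by rewrite lerDr ltW.
have [xy|xy] := boolP (rdist S g x y < r0%:E)%E.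
  apply: le_trans (C'P _ _ Lx Ly xy) _; have [t t0 ->] := rdist_fin (lt_trans xy (ltry _)).
  by rewrite /= -!EFinM lee_fin ler_wpM2r// w'0.
(* At infinite distance the right-hand side is infinite. At finite distance [t >= r0] the bound [D]
   is at most [D / r0 * t], hence at most [D / r0 * w' t]. *)
have [xyo|xyo] := boolP (rdist S g x y < +oo)%E; last first.
  have -> : rdist S g x y = +oo%E by apply/eqP; rewrite -leye_eq leNgt.
  by rewrite /= gt0_muley ?leey// lte_fin addr_gt0 ?divr_gt0.
apply: le_trans (DP _ _ xyo _ _ (hq _ Lx) (hq _ Ly)) _.
have [t t0 tE] := rdist_fin xyo; rewrite tE /= -EFinM lee_fin.
move: xy; rewrite tE lte_fin -leNgt => r0t.
apply: (@le_trans _ _ (D / r0 * w' t)); last by rewrite ler_wpM2r// w'0.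
apply: (@le_trans _ _ (D / r0 * t)); last by rewrite ler_wpM2l ?tw'// divr_ge0// ltW.
by rewrite mulrAC ler_pdivlMr// ler_wpM2l// ltW.
Qed.
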